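(* The proof that $u^{(\epsilon)}\to u$ in $C([-T,T];H^1(M))$ as $\epsilon\to0$ for every finite $T>0$ (where $M=\mathbb{R}$ or $\mathbb{T}$, the data $u_0^{(\epsilon)}$ are bounded in $H^2(M)$ and $u_0^{(\epsilon)}\to u_0$ in $H^1(M)$) cannot be extended to $T=\infty$. The following examples illustrate the failure of $u^{(\epsilon)}\to u$ in $C([0,\infty);H^s(M))$ as $\epsilon\to0$. (i) For $M=\mathbb{R}^d$, the linear evolution diverges. Let $u_0=\langle\nabla\rangle^{-s}|\nabla|^{\frac{1-d}{2}}e^{-\frac{|x|^2}{2}}\in H^s(\mathbb{R}^d)$. Then there are dimensional constants $C_1,C_2>0$ such that $$\begin{aligned}\|(U_\epsilon(t)-U(t))u_0\|_{H^s}^2&=\int_{\mathbb{R}^d}2(1-\cos(\epsilon^2t|\xi|^4))\langle\xi\rangle^{2s}|\widehat{u_0}|^2\,d\xi=C_1\int_0^\infty(1-\cos(\epsilon^2tr^4))e^{-r^2}\,dr\\&=C_2\left(\frac{\sqrt{2\pi}\left(\sin\left(\frac18\left(\pi-\frac{1}{t\epsilon^2}\right)\right)J_{\frac14}\left(\frac{1}{8t\epsilon^2}\right)-\cos\left(\frac18\left(\pi+\frac{1}{t\epsilon^2}\right)\right)J_{-\frac14}\left(\frac{1}{8t\epsilon^2}\right)\right)}{\sqrt t\,\epsilon}+4\right),\end{aligned}$$ and the last expression is an increasing function of $t\in[0,\infty)$ whose limit as $t\to\infty$ is $4C_2$ for all $\epsilon>0$. (ii) For $M=\mathbb{T}^d$,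 let $n\in\mathbb{Z}^d$ and $u_0(x)=\langle n\rangle^{-s}e^{in\cdot x}$. An exact solution of the equation for $u^{(\epsilon)}$ with data $u_0$ is $$u^{(\epsilon)}(x,t)=e^{-it(\epsilon^2|n|^4+|n|^2-\langle n\rangle^{-2s})}\langle n\rangle^{-s}e^{in\cdot x},$$ and, with $u$ the corresponding solution for $\epsilon=0$ with the same data, $$\sup_{t\in[0,\infty)}\|u^{(\epsilon)}-u\|_{H^s}=\sup_{t\in[0,\infty)}c_d\,|e^{-it\epsilon^2|n|^4}-1|=2c_d$$ for all $\epsilon>0$, where $c_d$ is a constant depending on $d$.
   Context: $u^{(\epsilon)}$ denotes the solution of $i\partial_tu^{(\epsilon)}+\Delta u^{(\epsilon)}-\epsilon^2\Delta^2u^{(\epsilon)}=-\big((I-\epsilon^2\Delta)^{-1}(|u^{(\epsilon)}|^2)\big)u^{(\epsilon)}$ on $M\times\mathbb{R}$ with data $u_0^{(\epsilon)}$ (equal to $u_0$ in example (ii)), and $u$ the solution of the focusing cubic nonlinear Schr\''odinger equation $i\partial_tu+\Delta u=-|u|^2u$ with data $u_0$. Here $s\in\mathbb{R}$, $\langle\xi\rangle=(1+|\xi|^2)^{1/2}$, and $\langle\nabla\rangle^\sigma$, $|\nabla|^\sigma$ are the Fourier multipliers with symbols $\langle\xi\rangle^\sigma$, $|\xi|^\sigma$. $U_\epsilon(t)$ is the Fourier multiplier with symbol $e^{-it(\epsilon^2|\xi|^4+|\xi|^2)}$ and $U(t)=U_0(t)$. $(I-\epsilon^2\Delta)^{-1}$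 is the Fourier multiplier with symbol $(1+\epsilon^2|\xi|^2)^{-1}$. $J_{\pm\frac14}$ is the Bessel function of the first kind of order $\pm\frac14$. $\widehat{u_0}$ is the Fourier transform of $u_0$, and $\|f\|_{H^s}$ is the $L^2$ (on $\mathbb{R}^d$) or $\ell^2$ (on $\mathbb{T}^d$, over $\mathbb{Z}^d$) norm of $\langle\cdot\rangle^s\hat f$.
   Formalization: In (ii) the value 2c_d of the supremum (and the failure of convergence) is stated for n ≠ 0 only, since for n = 0 the two solutions coincide and the supremum is 0; in (i) the last expression, undefined at t = 0, is given its limit 0 there. *)

(* Defs.v *)
From HB Require Import structures.
From mathcomp Require Import all_boot all_order all_algebra.
From mathcomp Require Import complex.
From mathcomp Require Import all_classical all_reals all_analysis.

Set Implicit Arguments.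
Unset Strict Implicit.
Unset Printing Implicit Defensive.

Import Order.TTheory GRing.Theory Num.Theory.
Import numFieldNormedType.Exports.

Local Open Scope classical_set_scope.
Local Open Scope ring_scope.
Local Open Scope complex_scope.

(* R^d is the type d.-tuple R, with its product Borel sigma-algebra; Z^d is   *)
(* d.-tuple int; functions on the torus (R / 2 pi Z)^d are the functions on   *)
(* R^d that are 2 pi-periodic in each coordinate.  The Fourier transform is   *)
(* unitary:                                                                   *)
(*   on R^d   f^(xi) = (2 pi)^(-d/2) \int_(R^d)       e^(-i xi.x) f(x) dx     *)
(*   on T^d   f^(k)  = (2 pi)^(-d/2) \int_([0,2 pi]^d) e^(-i k.x) f(x) dx     *)

Section euclidean.
Context {R : realType}.

Definition dot d (x y : d.-tuple R) : R := \sum_(i < d) tnth x i * tnth y i.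

Definition enorm d (x : d.-tuple R) : R := Num.sqrt (dot x x).

Definition japanese d (x : d.-tuple R) : R := Num.sqrt (1 + enorm x ^+ 2).

Definition zvec d (k : d.-tuple int) : d.-tuple R :=
  [tuple (tnth k i)%:~R | i < d].

Definition update d (x : d.-tuple R) (i : 'I_d) (r : R) : d.-tuple R :=
  [tuple if j == i then r else tnth x j | j < d].

End euclidean.

Section lebesgue.
Context {R : realType}.

Definition consR d (p : d.-tuple R * measurableTypeR R) : d.+1.-tuple R :=
  [the d.+1.-tuple R of (p.2 : R) :: p.1].

Lemma measurable_consR d :
  measurable_fun [set: d.-tuple R * measurableTypeR R] (@consR d).
Proof.
by apply: measurable_cons; [exact: measurable_snd|exact: measurable_fst].
Qed.

HB.instance Definition _ d :=
  isMeasurableFun.Build _ _ _ _ (@consR d) (@measurable_consR d).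

Definition lebesgue_step d (mu : {measure set (d.-tuple R) -> \bar R}) :=
  pushforward (mu \x @lebesgue_measure R)%E (@consR d).

Section lebesgue_step_measure.
Context d (mu : {measure set (d.-tuple R) -> \bar R}).

Let lebesgue_step0 : lebesgue_step mu set0 = 0%E.
Proof. exact: measure0. Qed.

Let lebesgue_step_ge0 A : (0 <= lebesgue_step mu A)%E.
Proof. exact: measure_ge0. Qed.

Let lebesgue_step_sigma_additive : semi_sigma_additive (lebesgue_step mu).
Proof. exact: measure_semi_sigma_additive. Qed.

HB.instance Definition _ := isMeasure.Build _ _ _ (lebesgue_step mu)
  lebesgue_step0 lebesgue_step_ge0 lebesgue_step_sigma_additive.

End lebesgue_step_measure.

(* d-fold product of the one-dimensional Lebesgue measure *)
Fixpoint lebesgue_Rd (d : nat) : {measure set (d.-tuple R) -> \bar R} :=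
  match d with
  | 0 => dirac [tuple]
  | d'.+1 => lebesgue_step (lebesgue_Rd d')
  end.

End lebesgue.

Section complex_valued.
Context {R : realType}.

Definition cis (a : R) : R[i] := cos a +i* sin a.

Definition cabs (z : R[i]) : R := complex.Re `|z|.

Definition cintegral d (T : measurableType d)
    (mu : {measure set T -> \bar R}) (D : set T) (f : T -> R[i]) : R[i] :=
  (\int[mu]_(x in D) complex.Re (f x)) +i* (\int[mu]_(x in D) complex.Im (f x)).

Definition cmeasurable d (T : measurableType d) (f : T -> R[i]) : Prop :=
  measurable_fun setT (fun x => complex.Re (f x)) /\
  measurable_fun setT (fun x => complex.Im (f x)).

Definition cintegrable d (T : measurableType d)
    (mu : {measure set T -> \bar R}) (f : T -> R[i]) : Prop :=
  mu.-integrable setT (fun x => (complex.Re (f x))%:E) /\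
  mu.-integrable setT (fun x => (complex.Im (f x))%:E).

Definition cderivable (g : R -> R[i]) (r : R) : Prop :=
  derivable (fun t => complex.Re (g t)) r 1 /\
  derivable (fun t => complex.Im (g t)) r 1.

Definition cderive (g : R -> R[i]) (r : R) : R[i] :=
  derive1 (fun t => complex.Re (g t)) r +i*
  derive1 (fun t => complex.Im (g t)) r.

Definition clim (u : nat -> R[i]) : R[i] :=
  limn (fun N => complex.Re (u N)) +i* limn (fun N => complex.Im (u N)).

End complex_valued.

Section smooth.
Context {R : realType} {d : nat}.
Implicit Types (f phi : d.-tuple R -> R[i]).

Definition has_partial (i : 'I_d) f (x : d.-tuple R) : Prop :=
  cderivable (fun r => f (update x i r)) (tnth x i).

Definition partial (i : 'I_d) f (x : d.-tuple R) : R[i] :=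
  cderive (fun r => f (update x i r)) (tnth x i).

Definition iter_partial (l : seq 'I_d) f : d.-tuple R -> R[i] :=
  foldr partial f l.

Definition laplacian f (x : d.-tuple R) : R[i] :=
  \sum_(i < d) partial i (partial i f) x.

(* Smooth with all derivatives bounded.  Continuity of the derivatives need   *)
(* not be required: bounded first order partial derivatives make a function   *)
(* Lipschitz.  For periodic functions this is just smoothness.                *)
Definition smooth_bounded f : Prop :=
  (forall (l : seq 'I_d) (i : 'I_d) x, has_partial i (iter_partial l f) x) /\
  (forall l : seq 'I_d, exists B : R, forall x, cabs (iter_partial l f x) <= B).

(* B bounds the Schwartz seminorms of f of order at most N *)
Definition schwartz_bound (N : nat) f (B : R) : Prop :=
  forall (l : seq 'I_d) (k : nat) x, (size l <= N)%N -> (k <= N)%N ->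
    (1 + enorm x) ^+ k * cabs (iter_partial l f x) <= B.

Definition schwartz f : Prop :=
  (forall (l : seq 'I_d) (i : 'I_d) x, has_partial i (iter_partial l f) x) /\
  (forall N : nat, exists B : R, schwartz_bound N f B).

End smooth.

Section fourier_Rd.
Context {R : realType} {d : nat}.
Implicit Types (f g phi psi m : d.-tuple R -> R[i]).

Definition fourier_cst : R := (2 * pi) `^ (- (d%:R / 2)).

Definition fourier f (xi : d.-tuple R) : R[i] :=
  fourier_cst%:C *
  cintegral (lebesgue_Rd d) setT (fun x => cis (- dot xi x) * f x).

Definition inv_fourier f (x : d.-tuple R) : R[i] :=
  fourier_cst%:C *
  cintegral (lebesgue_Rd d) setT (fun xi => cis (dot x xi) * f xi).

(* A distribution is a functional of which only the values at Schwartz        *)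
(* functions matter.                                                          *)
Definition distr_Rd : Type := (d.-tuple R -> R[i]) -> R[i].
Implicit Types T : distr_Rd.

Definition tempered T : Prop :=
  (forall (a : R[i]) phi psi, schwartz phi -> schwartz psi ->
     T (fun x => a * phi x + psi x) = a * T phi + T psi) /\
  (exists (C : R) (N : nat), forall phi (B : R), schwartz phi ->
     schwartz_bound N phi B -> cabs (T phi) <= C * B).

Definition dist_of_fun f : distr_Rd :=
  fun phi => cintegral (lebesgue_Rd d) setT (fun x => f x * phi x).

Definition dist_sub T1 T2 : distr_Rd := fun phi => T1 phi - T2 phi.

(* the Fourier transform phi |-> T (fourier phi) of T is the function g *)
Definition is_fourier T g : Prop :=
  cmeasurable g /\
  forall phi, schwartz phi ->
    cintegrable (lebesgue_Rd d) (fun xi => g xi * phi xi) /\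
    T (fourier phi) = dist_of_fun g phi.

(* A representative of the Fourier transform of T, which is unique up to null *)
(* sets; it has no meaning when the Fourier transform is not a function.      *)
Definition hat T : d.-tuple R -> R[i] :=
  xget (fun _ => 0) [set g | is_fourier T g].

(* m(D) T = F^-1 (m F(T)), for T whose Fourier transform is a function *)
Definition multiplier m T : distr_Rd :=
  fun phi => dist_of_fun (fun xi => m xi * hat T xi) (inv_fourier phi).

Definition Hs_norm (s : R) T : \bar R :=
  Lnorm (lebesgue_Rd d) 2%:E
    (fun xi => (japanese xi `^ s * cabs (hat T xi))%:E).

Definition in_Hs (s : R) T : Prop :=
  [/\ tempered T, exists g, is_fourier T g & (Hs_norm s T < +oo)%E].

Definition japanese_mult (sigma : R) : distr_Rd -> distr_Rd :=
  multiplier (fun xi => (japanese xi `^ sigma)%:C).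

Definition riesz_mult (sigma : R) : distr_Rd -> distr_Rd :=
  multiplier (fun xi => (enorm xi `^ sigma)%:C).

(* the linear propagator U_eps(t); U(t) is propagator 0 t *)
Definition propagator (eps t : R) : distr_Rd -> distr_Rd :=
  multiplier
    (fun xi => cis (- (t * (eps ^+ 2 * enorm xi ^+ 4 + enorm xi ^+ 2)))).

Definition gaussian : distr_Rd :=
  dist_of_fun (fun x => (expR (- (enorm x ^+ 2 / 2)))%:C).

End fourier_Rd.
Arguments distr_Rd R d : clear implicits.

Section bessel.
Context {R : realType}.

(* Euler's integral, for 0 < x *)
Definition Gamma (x : R) : R :=
  \int[lebesgue_measure]_(y in `]0, +oo[) (y `^ (x - 1) * expR (- y)).

(* Bessel function of the first kind, for -1 < nu and 0 < z *)
Definition besselJ (nu z : R) : R :=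
  limn (series (fun m : nat =>
    (-1) ^+ m / (m`!%:R * Gamma (m%:R + nu + 1)) * (z / 2) `^ (2 * m%:R + nu))).

(* The formula is singular at t = 0, where it is extended by its limit, 0. *)
Definition bessel_expr (C2 eps t : R) : R :=
  if t == 0 then 0 else
  C2 * (Num.sqrt (2 * pi) *
        (sin (8^-1 * (pi - (t * eps ^+ 2)^-1)) *
           besselJ 4^-1 (8 * t * eps ^+ 2)^-1 -
         cos (8^-1 * (pi + (t * eps ^+ 2)^-1)) *
           besselJ (- 4^-1) (8 * t * eps ^+ 2)^-1)
        / (Num.sqrt t * eps) + 4).

End bessel.

Section torus.
Context {R : realType} {d : nat}.
Implicit Types (f v m : d.-tuple R -> R[i]).

Definition periodic f : Prop :=
  forall (i : 'I_d) x, f (update x i (tnth x i + 2 * pi)) = f x.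

Definition torus_cell : set (d.-tuple R) :=
  [set x | forall i : 'I_d, 0 <= tnth x i <= 2 * pi].

Definition hatT f (k : d.-tuple int) : R[i] :=
  (@fourier_cst R d)%:C *
  cintegral (lebesgue_Rd d) torus_cell
    (fun x => cis (- dot (zvec k) x) * f x).

Definition HsT_norm (s : R) f : \bar R :=
  ((\esum_(k in [set: d.-tuple int])
     ((japanese (zvec k : d.-tuple R) `^ s * cabs (hatT f k)) ^+ 2)%:E)
   `^ 2^-1)%E.

(* the points of Z^d in the cube [-N, N]^d *)
Definition cube_point (N : nat) (j : d.-tuple 'I_N.*2.+1) : d.-tuple int :=
  [tuple (tnth j i)%:Z - N%:Z | i < d].

(* Fourier multiplier on the torus, by cubic partial sums of Fourier series *)
Definition multiplierT m f (x : d.-tuple R) : R[i] :=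
  (@fourier_cst R d)%:C *
  clim (fun N => \sum_(j : d.-tuple 'I_N.*2.+1)
    m (zvec (cube_point j)) * hatT f (cube_point j) *
    cis (dot (zvec (cube_point j)) x)).

(* (I - eps^2 Delta)^-1 *)
Definition resolvent (eps : R) : (d.-tuple R -> R[i]) -> d.-tuple R -> R[i] :=
  multiplierT (fun xi => ((1 + eps ^+ 2 * enorm xi ^+ 2)^-1)%:C).

Definition sqmod f (x : d.-tuple R) : R[i] := (cabs (f x) ^+ 2)%:C.

(* u is a smooth solution, on T^d x R and with data u0, of                    *)
(*   i u_t + Delta u - eps^2 Delta^2 u = - V(u) u                             *)
Definition schrodinger (V : (d.-tuple R -> R[i]) -> d.-tuple R -> R[i])
    (eps : R) (u0 : d.-tuple R -> R[i]) (u : R -> d.-tuple R -> R[i]) : Prop :=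
  [/\ forall t, periodic (u t) /\ smooth_bounded (u t),
      forall t x, cderivable (fun r => u r x) t,
      forall x, u 0 x = u0 x &
      forall t x,
        'i * cderive (fun r => u r x) t + laplacian (u t) x
        - (eps ^+ 2)%:C * laplacian (laplacian (u t)) x
        = - (V (u t) x * u t x)].

Definition regularized_NLS (eps : R) :=
  schrodinger (fun v => resolvent eps (sqmod v)) eps.

Definition cubic_NLS := schrodinger sqmod 0.

Definition plane_wave (s : R) (n : d.-tuple int) (x : d.-tuple R) : R[i] :=
  (japanese (zvec n : d.-tuple R) `^ (- s))%:C * cis (dot (zvec n) x).

Definition wave_solution (s : R) (n : d.-tuple int) (eps t : R)
    (x : d.-tuple R) : R[i] :=
  let N := enorm (zvec n : d.-tuple R) in
  cis (- (t * (eps ^+ 2 * N ^+ 4 + N ^+ 2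
               - japanese (zvec n : d.-tuple R) `^ (- (2 * s))))) *
  plane_wave s n x.

End torus.

(* Main.v *)
Require Import Defs.
From HB Require Import structures.
From mathcomp Require Import all_boot all_order all_algebra.
From mathcomp Require Import complex ring lra zify.
From mathcomp Require Import all_classical all_reals all_analysis.
From mathcomp Require Import measurable_realfun.
Import Order.TTheory GRing.Theory Num.Theory.
Import numFieldNormedType.Exports.
Set Implicit Arguments.
Unset Strict Implicit.
Unset Printing Implicit Defensive.
Local Open Scope classical_set_scope.
Local Open Scope ring_scope.
Local Open Scope complex_scope.

(** On the torus a plane wave has constant modulus, so that the potential is a
    constant: the regularized and the cubic equation act on it as linear
    equations, with time frequencies that differ by eps^2 |n|^4. At time
    pi / (eps^2 |n|^4) the two solutions are in antiphase, whatever eps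
    ([torus_plane_waves]). Frequency 1 and data that do not depend on eps then
    refute the uniform convergence ([torus_convergence_fails]).

    On R^d the two propagators are unimodular multipliers whose quotient is
    exp(-i eps^2 t |xi|^4), which gives the factor 2 (1 - cos(eps^2 t |xi|^4));
    the data are chosen so that the remaining weight is
    |xi|^(1-d) exp(-|xi|^2), and polar coordinates leave a one-dimensional
    integral ([sqr_Hs_norm_linear], [sqr_Hs_norm_polar]). Fourier transforms
    of tempered distributions are defined only through Schwartz functions, so
    this rests on inversion for Schwartz functions ([fourier_inversion]) and on
    the uniqueness almost everywhere of a Fourier transform that is a function
    ([is_fourier_unique]), which is obtained by testing against Gaussians.

    The one-dimensional integral is [osc_gauss] l, the integral over r >= 0 of
    (1 - cos(l r^4)) exp(-r^2), with l = eps^2 t. It is studied through the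
    integrals of r^m exp(-a r^4) cos(l r^4), which have a closed form
    ([osc_closed]): the linear differential system in l that they satisfy is a
    rotation in polar coordinates for (a, l).
      - Monotonicity. The function exp(-r^2) is a mixture of functions
        exp(-a r^4), a > 0 ([osc_gauss_mixture]), and for each a the closed
        form with m = 0 is decreasing in l >= 0.
      - Bessel functions. Expanding exp(-r^2) and integrating termwise gives a
        series in powers of l^(-1/2) with quartic moments and cosines
        ([cvg_gauss_cos]). By Kummer's identity
        exp(z) 0F1(; a + 1/2; z^2 / 4) = 1F1(a; 2 a; 2 z), applied on the
        imaginary axis with a = 1/4 and a = 3/4, its even and odd parts are
        Bessel series of order -1/4 and 1/4 times a cosine
        ([kummer_product], [gauss_cos_bessel]). The constants are related by
        the reflection formula for Gamma at 1/4 ([quartic_reflection]).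
      - Limit. The same series bounds the integral of cos(l r^4) exp(-r^2) by
        a multiple of l^(-1/4) ([gauss_cos_decay]), which leaves the integral
        of exp(-r^2), positive and independent of eps. *)

(** * Complex numbers *)

Section complex_numbers.
Context {R : realType}.
Implicit Types (a b : R) (z w : R[i]).

Lemma cabs_def z : cabs z = Num.sqrt (complex.Re z ^+ 2 + complex.Im z ^+ 2).
Proof. by rewrite /cabs normc_def. Qed.

Lemma ReD z w : complex.Re (z + w) = complex.Re z + complex.Re w.
Proof. by case: z w => [? ?] [? ?]. Qed.
Lemma ImD z w : complex.Im (z + w) = complex.Im z + complex.Im w.
Proof. by case: z w => [? ?] [? ?]. Qed.
Lemma ReN z : complex.Re (- z) = - complex.Re z.
Proof. by case: z. Qed.
Lemma ImN z : complex.Im (- z) = - complex.Im z.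
Proof. by case: z. Qed.
Lemma ReM z w : complex.Re (z * w) =
  complex.Re z * complex.Re w - complex.Im z * complex.Im w.
Proof. by case: z w => [? ?] [? ?]. Qed.
Lemma ImM z w : complex.Im (z * w) =
  complex.Re z * complex.Im w + complex.Im z * complex.Re w.
Proof. by case: z w => [? ?] [? ?]. Qed.

Definition ReImE := (ReD, ImD, ReN, ImN, ReM, ImM).

Lemma complexP z w : complex.Re z = complex.Re w ->
  complex.Im z = complex.Im w -> z = w.
Proof. by case: z w => [? ?] [? ?] /= -> ->. Qed.

Lemma cabs_ge0 z : 0 <= cabs z.
Proof. by rewrite cabs_def sqrtr_ge0. Qed.

Lemma cabsC z : (cabs z)%:C = `|z|.
Proof. by rewrite cabs_def normc_def. Qed.

Lemma cabsM z w : cabs (z * w) = cabs z * cabs w.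
Proof. by apply: complexI; rewrite rmorphM /= !cabsC normrM. Qed.

Lemma cabsD z w : cabs (z + w) <= cabs z + cabs w.
Proof. by rewrite -lecR rmorphD /= !cabsC ler_normD. Qed.

Lemma cabsN z : cabs (- z) = cabs z.
Proof. by apply: complexI; rewrite !cabsC normrN. Qed.

Lemma cabsB z w : cabs (z - w) <= cabs z + cabs w.
Proof. by rewrite -(cabsN w) cabsD. Qed.

Lemma cabs0 : cabs (0 : R[i]) = 0.
Proof. by apply: complexI; rewrite cabsC normr0. Qed.

Lemma cabs_eq0 z : (cabs z == 0) = (z == 0).
Proof. by rewrite -(inj_eq (@complexI R)) cabsC normr_eq0. Qed.

Lemma cabs_real a : cabs a%:C = `|a|.
Proof. by rewrite cabs_def /= expr0n addr0 sqrtr_sqr. Qed.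

Lemma cabs1 : cabs (1 : R[i]) = 1.
Proof. by apply: complexI; rewrite cabsC normr1. Qed.

Lemma sqr_cabs z : cabs z ^+ 2 = complex.Re z ^+ 2 + complex.Im z ^+ 2.
Proof. by rewrite cabs_def sqr_sqrtr// addr_ge0 ?sqr_ge0. Qed.

Lemma Re_le_cabs z : `|complex.Re z| <= cabs z.
Proof.
by rewrite -(ler_pXn2r (n:=2))// ?nnegrE ?cabs_ge0// sqr_cabs real_normK ?num_real// lerDl sqr_ge0.
Qed.

Lemma Im_le_cabs z : `|complex.Im z| <= cabs z.
Proof.
by rewrite -(ler_pXn2r (n:=2))// ?nnegrE ?cabs_ge0// sqr_cabs real_normK ?num_real// lerDr sqr_ge0.
Qed.

Lemma cabs_le_ReIm z : cabs z <= `|complex.Re z| + `|complex.Im z|.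
Proof.
rewrite -(ler_pXn2r (n:=2))// ?nnegrE ?cabs_ge0 ?addr_ge0// sqr_cabs sqrrD.
rewrite !real_normK ?num_real// [leRHS]addrAC lerDl mulrn_wge0// mulr_ge0//.
Qed.

Lemma cis0 : cis 0 = 1 :> R[i].
Proof. by rewrite /cis cos0 sin0. Qed.

Lemma cisD a b : cis (a + b) = cis a * cis b.
Proof. by apply: complexP; rewrite !ReImE /= (cosD, sinD)//; rewrite addrC. Qed.

Lemma cabs_cis a : cabs (cis a) = 1.
Proof. by rewrite cabs_def /= cos2Dsin2 sqrtr1. Qed.

Lemma cabs_cisM a z : cabs (cis a * z) = cabs z.
Proof. by rewrite cabsM cabs_cis mul1r. Qed.

Lemma realCM_Re a z : complex.Re (a%:C * z) = a * complex.Re z.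
Proof. by rewrite ReM /= mul0r subr0. Qed.
Lemma realCM_Im a z : complex.Im (a%:C * z) = a * complex.Im z.
Proof. by rewrite ImM /= mul0r addr0. Qed.

Lemma mulii : 'i * 'i = -1 :> R[i].
Proof. by rewrite -expr2 sqr_i. Qed.

Lemma cis_sub1 a : cabs (cis a - 1) ^+ 2 = 2 * (1 - cos a).
Proof.
rewrite sqr_cabs !ReImE /= subr0 sqrrB mulr1 expr1n.
by have := cos2Dsin2 a => h; lra.
Qed.

End complex_numbers.

(** * Complex-valued integrals *)

Section real_integral.
Context {R : realType} {d : measure_display} {T : measurableType d}.
Variable mu : {measure set T -> \bar R}.
Implicit Types (D : set T) (f g : T -> R).

Lemma dominated_cvg_Rintegral D (F : nat -> T -> R) f g : measurable D ->
  (forall n, measurable_fun D (F n)) ->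
  (forall x, D x -> F n x @[n --> \oo] --> f x) ->
  mu.-integrable D (EFin \o g) ->
  (forall n x, D x -> `|F n x| <= g x) ->
  mu.-integrable D (EFin \o f) /\
  \int[mu]_(x in D) F n x @[n --> \oo] --> \int[mu]_(x in D) f x.
Proof.
move=> mD mF Ff ig Fg.
have cF x : D x -> (F n x)%:E @[n --> \oo] --> (f x)%:E.
  by move=> Dx; apply: cvg_EFin; [exact: nearW|exact: Ff].
have mf : measurable_fun D (EFin \o f).
  by apply: (emeasurable_fun_cvg (fun n x => (F n x)%:E)) => // n; exact/measurable_EFinP.
have [i1 _ c1] := @dominated_convergence _ _ _ mu D mD (fun n x => (F n x)%:E)
  (EFin \o f) (EFin \o g) (fun n => (measurable_EFinP _ _).2 (mF n)) mf
  (aeW _ cF) ig (aeW _ (fun x n => Fg n x)).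
split => //; apply: fine_cvg.
by rewrite /Rintegral fineK//; exact: integrable_fin_num.
Qed.

Lemma ae_eq_integrable D f g : measurable D -> measurable_fun D g ->
  mu.-integrable D (EFin \o f) -> {ae mu, forall x, f x = g x} ->
  mu.-integrable D (EFin \o g).
Proof.
move=> mD mg /integrableP[mf fi] fg; apply/integrableP; split.
  exact/measurable_EFinP.
rewrite -(_ : \int[mu]_(x in D) `|(f x)%:E| = \int[mu]_(x in D) `|(g x)%:E|)%E//.
apply: ae_eq_integral => //.
- exact: measurableT_comp.
- by apply: measurableT_comp => //; exact/measurable_EFinP.
- by apply: (filterS _ fg) => x /= ->.
Qed.

Lemma bounded_integrable D f g : measurable D -> measurable_fun D f ->
  mu.-integrable D (EFin \o g) -> (forall x, D x -> `|f x| <= g x) ->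
  mu.-integrable D (EFin \o f).
Proof.
move=> mD mf ig fg; apply: le_integrable ig => //; first exact/measurable_EFinP.
by move=> x Dx /=; rewrite lee_fin (le_trans (fg x Dx))// ler_norm.
Qed.

Lemma integrable_mull D (c : R) f : measurable D -> mu.-integrable D (EFin \o f) ->
  mu.-integrable D (EFin \o (fun x => c * f x)).
Proof. by move=> mD fi; exact: (integrableZl mD c fi). Qed.

Lemma integrable_add D f g : measurable D -> mu.-integrable D (EFin \o f) ->
  mu.-integrable D (EFin \o g) -> mu.-integrable D (EFin \o (fun x => f x + g x)).
Proof. by move=> mD fi gi; exact: (integrableD mD fi gi). Qed.

Lemma integrable_sub D f g : measurable D -> mu.-integrable D (EFin \o f) ->
  mu.-integrable D (EFin \o g) -> mu.-integrable D (EFin \o (fun x => f x - g x)).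
Proof. by move=> mD fi gi; exact: (integrableB mD fi gi). Qed.

Lemma integrable_normr D f : mu.-integrable D (EFin \o f) ->
  mu.-integrable D (EFin \o (fun x => `|f x|)).
Proof. exact: integrable_abse. Qed.

End real_integral.

Section cintegral.
Context {R : realType} {d : measure_display} {T : measurableType d}.
Variable mu : {measure set T -> \bar R}.
Implicit Types (f g : T -> R[i]) (c : R[i]).

Lemma cmeasurableD f g : cmeasurable f -> cmeasurable g ->
  cmeasurable (fun x => f x + g x).
Proof.
move=> [f1 f2] [g1 g2]; split.
  by under eq_fun do rewrite ReD; exact: measurable_funD.
by under eq_fun do rewrite ImD; exact: measurable_funD.
Qed.

Lemma cmeasurableN f : cmeasurable f -> cmeasurable (fun x => - f x).
Proof.
move=> [f1 f2]; split.
  by under eq_fun do rewrite ReN; exact: measurableT_comp.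
by under eq_fun do rewrite ImN; exact: measurableT_comp.
Qed.

Lemma cmeasurableM f g : cmeasurable f -> cmeasurable g ->
  cmeasurable (fun x => f x * g x).
Proof.
move=> [f1 f2] [g1 g2]; split.
  by under eq_fun do rewrite ReM; apply: measurable_funB; exact: measurable_funM.
by under eq_fun do rewrite ImM; apply: measurable_funD; exact: measurable_funM.
Qed.

Lemma cmeasurable_cst c : cmeasurable (fun _ : T => c).
Proof. by split; exact: measurable_cst. Qed.

Lemma cmeasurable_real (h : T -> R) : measurable_fun setT h ->
  cmeasurable (fun x => (h x)%:C).
Proof. by split. Qed.

Lemma cmeasurable_cis (h : T -> R) : measurable_fun setT h ->
  cmeasurable (fun x => cis (h x)).
Proof.
move=> mh; split.
  by apply: (measurableT_comp (f:=cos)) => //; apply: continuous_measurable_fun; exact: continuous_cos.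
by apply: (measurableT_comp (f:=sin)) => //; apply: continuous_measurable_fun; exact: continuous_sin.
Qed.

Lemma measurable_cabs f : cmeasurable f -> measurable_fun setT (fun x => cabs (f x)).
Proof.
move=> [f1 f2]; under eq_fun do rewrite cabs_def.
apply: (@measurableT_comp _ _ _ _ _ _ (@Num.sqrt R)).
  by apply: continuous_measurable_fun; exact: sqrt_continuous.
by apply: measurable_funD; exact: measurable_funX.
Qed.

Lemma cintegrable_measurable f : cintegrable mu f -> cmeasurable f.
Proof.
by move=> [/measurable_int/measurable_EFinP ? /measurable_int/measurable_EFinP ?].
Qed.

Lemma dominated_cintegrable f (h : T -> R) : cmeasurable f ->
  mu.-integrable setT (EFin \o h) -> (forall x, cabs (f x) <= h x) ->
  cintegrable mu f.
Proof.
move=> [f1 f2] ih fh; split; apply: le_integrable ih => //;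
  try exact/measurable_EFinP.
  move=> x _ /=; rewrite lee_fin.
  by rewrite (le_trans (Re_le_cabs _))// (le_trans (fh x))// ler_norm.
move=> x _ /=; rewrite lee_fin; by rewrite (le_trans (Im_le_cabs _))// (le_trans (fh x))// ler_norm.
Qed.

Lemma integrable_cabs f : cintegrable mu f ->
  mu.-integrable setT (fun x => (cabs (f x))%:E).
Proof.
move=> fi; have fm := cintegrable_measurable fi; case: fi => f1 f2.
apply: (le_integrable measurableT) (integrableD measurableT (integrable_abse f1) (integrable_abse f2)).
  by apply/measurable_EFinP; exact: measurable_cabs.
move=> x _ /=; rewrite lee_fin ger0_norm ?cabs_ge0// ger0_norm ?addr_ge0//.
exact: cabs_le_ReIm.
Qed.

Lemma cintegrable_real (h : T -> R) : mu.-integrable setT (EFin \o h) ->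
  cintegrable mu (fun x => (h x)%:C).
Proof. by split => //=; exact: integrable0. Qed.

Lemma cintegrableD f g : cintegrable mu f -> cintegrable mu g ->
  cintegrable mu (fun x => f x + g x).
Proof.
move=> [f1 f2] [g1 g2]; split.
  by under eq_fun do rewrite ReD EFinD; exact: integrableD.
by under eq_fun do rewrite ImD EFinD; exact: integrableD.
Qed.

Lemma cintegrableZ c f : cintegrable mu f -> cintegrable mu (fun x => c * f x).
Proof.
move=> [f1 f2]; split.
  under eq_fun do rewrite ReM EFinB !EFinM.
  by apply: integrableB => //; exact: integrableZl.
under eq_fun do rewrite ImM EFinD !EFinM.
by apply: integrableD => //; exact: integrableZl.
Qed.

Lemma cintegrableB f g : cintegrable mu f -> cintegrable mu g ->
  cintegrable mu (fun x => f x - g x).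
Proof.
move=> fi gi; have := cintegrableD fi (cintegrableZ (-1) gi).
by under eq_fun do rewrite mulN1r.
Qed.

Lemma bounded_cintegrableM f g (B : R) : cmeasurable f ->
  (forall x, cabs (f x) <= B) -> cintegrable mu g ->
  cintegrable mu (fun x => f x * g x).
Proof.
move=> mf fB gi; have mg := cintegrable_measurable gi.
apply: (@dominated_cintegrable _ (fun x => B * cabs (g x))).
- exact: cmeasurableM.
- rewrite /comp; under eq_fun do rewrite EFinM.
  by apply: integrableZl => //; exact: integrable_cabs.
- by move=> x; rewrite cabsM ler_wpM2r ?cabs_ge0.
Qed.

Lemma cis_cintegrableM (h : T -> R) g : measurable_fun setT h ->
  cintegrable mu g -> cintegrable mu (fun x => cis (h x) * g x).
Proof.
move=> mh; apply: (@bounded_cintegrableM _ _ 1).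
  exact: cmeasurable_cis.
by move=> x; rewrite cabs_cis.
Qed.

Lemma eq_cintegral f g : f =1 g -> cintegral mu setT f = cintegral mu setT g.
Proof. by move=> /funext ->. Qed.

Lemma cintegralD f g : cintegrable mu f -> cintegrable mu g ->
  cintegral mu setT (fun x => f x + g x) =
  cintegral mu setT f + cintegral mu setT g.
Proof.
move=> [f1 f2] [g1 g2]; apply: complexP; rewrite ?ReD ?ImD/=.
  by under eq_fun do rewrite ReD; rewrite RintegralD.
by under eq_fun do rewrite ImD; rewrite RintegralD.
Qed.

Lemma cintegralZ c f : cintegrable mu f ->
  cintegral mu setT (fun x => c * f x) = c * cintegral mu setT f.
Proof.
have iZ (r : R) (h : T -> R) : mu.-integrable setT (EFin \o h) ->
   mu.-integrable setT (EFin \o (fun x => r * h x)).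
  by move=> ih; rewrite /comp; under eq_fun do rewrite EFinM; exact: integrableZl.
move=> [f1 f2]; apply: complexP; rewrite ?ReM ?ImM/=.
  under eq_fun do rewrite ReM.
  by rewrite RintegralB ?RintegralZl//; exact: iZ.
under eq_fun do rewrite ImM.
by rewrite RintegralD ?RintegralZl//; exact: iZ.
Qed.

Lemma cintegralB f g : cintegrable mu f -> cintegrable mu g ->
  cintegral mu setT (fun x => f x - g x) =
  cintegral mu setT f - cintegral mu setT g.
Proof.
move=> fi gi; rewrite -mulN1r -cintegralZ// -cintegralD//; last exact: cintegrableZ.
by apply: eq_cintegral => x; rewrite mulN1r.
Qed.

(** With z the value of the integral, the modulus of z is the integral of the
    real part of (conj z / |z|) f. *)
Lemma cabs_cintegral_le f : cintegrable mu f ->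
  cabs (cintegral mu setT f) <= \int[mu]_x (cabs (f x)).
Proof.
move=> fi; set z := cintegral _ _ _.
have [->|z0] := eqVneq z 0; first by rewrite cabs0 Rintegral_ge0// => x _; exact: cabs_ge0.
have cz : 0 < cabs z by rewrite lt_def cabs_eq0 z0 cabs_ge0.
rewrite -(ler_pM2l cz) -expr2 sqr_cabs.
pose w : R[i] := complex.Re z +i* (- complex.Im z).
have -> : complex.Re z ^+ 2 + complex.Im z ^+ 2 = complex.Re (w * z).
  by rewrite ReM /= mulNr opprK -!expr2.
rewrite /z -cintegralZ //= -RintegralZl//; last exact: integrable_cabs.
have [h1 h2] := cintegrableZ w fi.
apply: le_Rintegral => //.
  rewrite /comp; under eq_fun do rewrite EFinM.
  by apply: integrableZl => //; exact: integrable_cabs.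
move=> x _; apply: (le_trans (ler_norm _)); apply: (le_trans (Re_le_cabs _)).
rewrite cabsM; rewrite -/z; have -> : cabs w = cabs z by rewrite !cabs_def /= sqrrN.
exact: lexx.
Qed.

Lemma ae_eq_cintegral f g : cmeasurable f -> cmeasurable g ->
  {ae mu, forall x, f x = g x} -> cintegral mu setT f = cintegral mu setT g.
Proof.
move=> [f1 f2] [g1 g2] fg; rewrite /cintegral /Rintegral; congr (fine _ +i* fine _).
  apply: ae_eq_integral => //; try exact/measurable_EFinP.
  by apply: (filterS _ fg) => x /= ->.
apply: ae_eq_integral => //; try exact/measurable_EFinP.
by apply: (filterS _ fg) => x /= ->.
Qed.

Lemma ae_cintegrable f g : cmeasurable g -> cintegrable mu f ->
  {ae mu, forall x, f x = g x} -> cintegrable mu g.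
Proof.
move=> [g1 g2] [f1 f2] fg; split.
  apply: (ae_eq_integrable measurableT g1 f1).
  by apply: (filterS _ fg) => x /= ->.
apply: (ae_eq_integrable measurableT g2 f2).
by apply: (filterS _ fg) => x /= ->.
Qed.

Lemma dominated_cvg_cintegral (F : nat -> T -> R[i]) f (h : T -> R) :
  (forall n, cmeasurable (F n)) -> cmeasurable f ->
  (forall x, cabs (F n x - f x) @[n --> \oo] --> 0) ->
  mu.-integrable setT (EFin \o h) ->
  (forall n x, cabs (F n x) <= h x) ->
  cabs (cintegral mu setT (F n) - cintegral mu setT f) @[n --> \oo] --> 0.
Proof.
move=> mF mf Ff ih Fh.
have iF n : cintegrable mu (F n) by exact: dominated_cintegrable ih _.
have fh x : cabs (f x) <= h x.
  apply/ler_addgt0Pr => e e0.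
  have /cvgr0_norm_lt/(_ _ e0)[n _ /(_ n (leqnn n))] := Ff x.
  rewrite ger0_norm ?cabs_ge0// => ltn.
  have -> : f x = F n x - (F n x - f x) by rewrite opprB addrC subrK.
  by rewrite (le_trans (cabsB _ _))// lerD// ltW.
have fi : cintegrable mu f by exact: dominated_cintegrable ih _.
have iFf n : mu.-integrable setT (fun x => (cabs (F n x - f x))%:E).
  exact/integrable_cabs/cintegrableB.
have cvg0 : \int[mu]_x (cabs (F n x - f x)) @[n --> \oo] --> 0.
  have -> : 0 = \int[mu]_(x in setT) (0 : R) by rewrite Rintegral_cst// mul0r.
  apply: (@dominated_cvg_Rintegral _ _ _ mu setT _ (fun=> 0) (fun x => h x + h x) measurableT _ _ _ _).2 => //.
  - by move=> n; apply/measurable_EFinP; exact: measurable_int (iFf n).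
  - by rewrite /comp; under eq_fun do rewrite EFinD; exact: integrableD.
  - move=> n x _ /=; rewrite ger0_norm ?cabs_ge0//.
    by rewrite (le_trans (cabsB _ _))// lerD.
apply: (@squeeze_cvgr _ _ _ _ (fun=> 0) (fun n => \int[mu]_x (cabs (F n x - f x)))) => //.
  apply: nearW => n; rewrite cabs_ge0 /= -cintegralB// cabs_cintegral_le//.
  exact: cintegrableB.
exact: cvg_cst.
Qed.

End cintegral.

(** * Integration on R^d *)

Section sigma_finite_of.
Context {R : realType} {d : measure_display} {T : measurableType d}.
Variables (mu : {measure set T -> \bar R}) (mu_sf : sigma_finite setT mu).

(** Lebesgue measure on R^d is defined by recursion as a bare measure; this
    alias carries its sigma-finiteness, which Fubini's theorem needs. *)
Definition sigma_finite_of of sigma_finite setT mu : set T -> \bar R := mu.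

HB.instance Definition _ := Measure.copy (sigma_finite_of mu_sf) (Measure.sort mu).
HB.instance Definition _ := Measure_isSigmaFinite.Build _ _ _ (sigma_finite_of mu_sf) mu_sf.

End sigma_finite_of.

Section lebesgue_Rd_theory.
Context {R : realType}.
Local Notation leb := (@lebesgue_measure R).

Definition unconsR d (x : d.+1.-tuple R) : d.-tuple R * measurableTypeR R :=
  ([tuple of behead x], thead x).

Lemma measurable_unconsR d : measurable_fun setT (@unconsR d).
Proof.
apply/measurable_fun_pairP; split; first exact: measurable_behead.
exact: measurable_tnth.
Qed.

Lemma consRK d : cancel (@consR R d) (@unconsR d).
Proof. by move=> [x r]; congr pair; apply: val_inj. Qed.

Lemma lebesgue_Rd_sigma_finite d : sigma_finite setT (@lebesgue_Rd R d).
Proof.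
elim: d => [|d IH].
  exists (fun=> setT); first by rewrite bigcup_const.
  by move=> n; split => //=; rewrite /dirac indicT ltry.
pose mu' := sigma_finite_of IH : {sigma_finite_measure set _ -> \bar R}.
have /sigma_finiteP[F [FT Fnd Foo]] := IH.
have /sigma_finiteP[G [GT Gnd Goo]] := sigma_finiteT leb.
exists (fun n => @unconsR d @^-1` (F n `*` G n)).
  rewrite -preimage_bigcup; apply/esym; rewrite -subTset => x _.
  have [n _ Fn] : (\bigcup_n F n) (unconsR x).1 by rewrite -FT.
  have [m _ Gm] : (\bigcup_n G n) (unconsR x).2 by rewrite -GT.
  exists (maxn n m) => //; split.
    by move: Fn; apply/subsetPset/Fnd; rewrite leq_maxl.
  by move: Gm; apply/subsetPset/Gnd; rewrite leq_maxr.
move=> n; have [mF Foo1] := Foo n; have [mG Goo1] := Goo n.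
have mFG : measurable (F n `*` G n) by exact: measurableX.
split; first by rewrite -[X in measurable X]setTI; exact: measurable_unconsR.
rewrite /= /lebesgue_step /pushforward -comp_preimage.
rewrite (_ : (unconsR (d:=d) \o consR (d:=d)) @^-1` _ = F n `*` G n); last first.
  by apply/seteqP; split => x; rewrite /preimage /comp /mkset consRK.
rewrite (_ : (_ \x _)%E _ = (mu' \x leb)%E (F n `*` G n))//.
rewrite product_measure1E// lte_mul_pinfty//.
by rewrite ge0_fin_numE.
Qed.

Definition sf_lebesgue_Rd d : {sigma_finite_measure set (d.-tuple R) -> \bar R} :=
  sigma_finite_of (lebesgue_Rd_sigma_finite d).

Lemma ge0_integral_lebesgue_RdS d (f : d.+1.-tuple R -> \bar R) :
  measurable_fun setT f -> (forall x, 0 <= f x)%E ->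
  (\int[lebesgue_Rd d.+1]_x f x =
   \int[lebesgue_Rd d]_x \int[leb]_r f (consR (x, r)))%E.
Proof.
move=> mf f0.
transitivity (\int[(sf_lebesgue_Rd d \x leb)%E]_p f (consR p))%E.
  exact: ge0_integral_pushforward.
rewrite fubini_tonelli1//.
exact: measurableT_comp mf _.
Qed.

Lemma integral_lebesgue_Rd0 (f : 0.-tuple R -> \bar R) : (\int[lebesgue_Rd 0]_x f x = f [tuple])%E.
Proof.
have mf : measurable_fun setT f.
  move=> _ Y mY; have [fY|fY] := pselect (Y (f [tuple])).
    rewrite (_ : _ `&` _ = setT); first exact: measurableT.
    by apply/seteqP; split => // x _; split => //=; rewrite (tuple0 x).
  rewrite (_ : _ `&` _ = set0); first exact: measurable0.
  by apply/seteqP; split => // x []; rewrite /= (tuple0 x).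
by rewrite /= integral_dirac// diracT mul1e.
Qed.

End lebesgue_Rd_theory.
Section tensor.
Context {R : realType} {d1 d2 : measure_display}
  {T1 : measurableType d1} {T2 : measurableType d2}.
Variables (m1 : {sigma_finite_measure set T1 -> \bar R})
  (m2 : {sigma_finite_measure set T2 -> \bar R}).

Lemma integrable_tensor (f : T1 -> R) (g : T2 -> R) :
  m1.-integrable setT (EFin \o f) -> m2.-integrable setT (EFin \o g) ->
  (m1 \x m2)%E.-integrable setT (fun p => (f p.1 * g p.2)%:E).
Proof.
move=> fi gi; have /integrableP[mf foo] := fi; have /integrableP[mg goo] := gi.
have m : measurable_fun setT (fun p : T1 * T2 => (f p.1 * g p.2)%:E).
  apply/measurable_EFinP; apply: measurable_funM.
    apply: (measurableT_comp (f:=f)); [exact/measurable_EFinP|exact: measurable_fst].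
  apply: (measurableT_comp (f:=g)); [exact/measurable_EFinP|exact: measurable_snd].
have mag : measurable_fun setT (fun y => `|g y|%:E).
  by apply/measurable_EFinP; apply: measurableT_comp => //; exact/measurable_EFinP.
have maf : measurable_fun setT (fun y => `|f y|%:E).
  by apply/measurable_EFinP; apply: measurableT_comp => //; exact/measurable_EFinP.
apply: (@integrable12ltyP _ _ _ _ _ m1 m2 _ m).2 => /=.
under eq_integral => x _.
  under eq_integral => y _ do rewrite /= normrM EFinM.
  rewrite ge0_integralZl//; over.
rewrite ge0_integralZr//; last by apply: integral_ge0.
by rewrite lte_mul_pinfty// ?integral_ge0// ge0_fin_numE ?integral_ge0.
Qed.

Lemma integral_tensor (f : T1 -> R) (g : T2 -> R) :
  m1.-integrable setT (EFin \o f) -> m2.-integrable setT (EFin \o g) ->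
  (\int[(m1 \x m2)%E]_p (f p.1 * g p.2)%:E =
  (\int[m1]_x (f x)%:E) * (\int[m2]_x (g x)%:E))%E.
Proof.
move=> fi gi; rewrite -(integral12_prod_meas1 (integrable_tensor fi gi)) /fubini_F /=.
under eq_integral => x _.
  under eq_integral => y _ do rewrite EFinM.
  rewrite integralZl//; over.
rewrite -(fineK (integrable_fin_num measurableT gi)) integralZr//.
Qed.

Lemma cintegrable_tensor (f : T1 -> R[i]) (g : T2 -> R[i]) :
  cintegrable m1 f -> cintegrable m2 g ->
  cintegrable (m1 \x m2)%E (fun p => f p.1 * g p.2).
Proof.
move=> [f1 f2] [g1 g2]; split.
  under eq_fun do rewrite ReM EFinB.
  by apply: integrableB => //; [exact: (integrable_tensor f1 g1)|exact: (integrable_tensor f2 g2)].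
under eq_fun do rewrite ImM EFinD.
by apply: integrableD => //; [exact: (integrable_tensor f1 g2)|exact: (integrable_tensor f2 g1)].
Qed.

Lemma cintegral_tensor (f : T1 -> R[i]) (g : T2 -> R[i]) :
  cintegrable m1 f -> cintegrable m2 g ->
  cintegral (m1 \x m2)%E setT (fun p => f p.1 * g p.2) =
  cintegral m1 setT f * cintegral m2 setT g.
Proof.
move=> [f1 f2] [g1 g2]; apply: complexP; rewrite ?ReM ?ImM/=.
  under eq_fun do rewrite ReM.
  rewrite RintegralB//; [|exact: (integrable_tensor f1 g1)|exact: (integrable_tensor f2 g2)].
  by rewrite /Rintegral (integral_tensor f1 g1) (integral_tensor f2 g2) !fineM ?integrable_fin_num.
under eq_fun do rewrite ImM.
rewrite RintegralD//; [|exact: (integrable_tensor f1 g2)|exact: (integrable_tensor f2 g1)].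
by rewrite /Rintegral (integral_tensor f1 g2) (integral_tensor f2 g1) !fineM ?integrable_fin_num.
Qed.

End tensor.

Section cfubini.
Context {R : realType} {d1 d2 : measure_display}
  {T1 : measurableType d1} {T2 : measurableType d2}.
Variables (m1 : {sigma_finite_measure set T1 -> \bar R})
  (m2 : {sigma_finite_measure set T2 -> \bar R}).

Lemma Rintegral_fubini (f : T1 * T2 -> R) :
  (m1 \x m2)%E.-integrable setT (EFin \o f) ->
  (forall x, m2.-integrable setT (fun y => (f (x, y))%:E)) ->
  (forall y, m1.-integrable setT (fun x => (f (x, y))%:E)) ->
  \int[m1]_x \int[m2]_y f (x, y) = \int[m2]_y \int[m1]_x f (x, y).
Proof.
move=> fi f1 f2; rewrite /Rintegral; congr fine.
under eq_integral => x _ do rewrite fineK ?integrable_fin_num//.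
rewrite (Fubini fi).
by apply: eq_integral => y _; rewrite fineK ?integrable_fin_num.
Qed.

Lemma cfubini (f : T1 * T2 -> R[i]) :
  cintegrable (m1 \x m2)%E f ->
  (forall x, cintegrable m2 (fun y => f (x, y))) ->
  (forall y, cintegrable m1 (fun x => f (x, y))) ->
  cintegral m1 setT (fun x => cintegral m2 setT (fun y => f (x, y))) =
  cintegral m2 setT (fun y => cintegral m1 setT (fun x => f (x, y))).
Proof.
move=> [fR fI] f1 f2; apply: complexP => /=.
  by apply: (Rintegral_fubini (f := fun p => complex.Re (f p))) => //; move=> x; [case: (f1 x)|case: (f2 x)].
by apply: (Rintegral_fubini (f := fun p => complex.Im (f p))) => //; move=> x; [case: (f1 x)|case: (f2 x)].
Qed.

End cfubini.

Section product_functions.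
Context {R : realType}.
Local Notation leb := (@lebesgue_measure R).

Lemma cmeasurable_comp {d1 d2} {T1 : measurableType d1} {T2 : measurableType d2}
    (f : T2 -> R[i]) (h : T1 -> T2) :
  measurable_fun setT h -> cmeasurable f -> cmeasurable (f \o h).
Proof. by move=> mh [f1 f2]; split; [exact: measurableT_comp f1 mh|exact: measurableT_comp f2 mh]. Qed.

Lemma cintegrable_lebesgue_RdS d (F : d.+1.-tuple R -> R[i]) :
  cmeasurable F ->
  cintegrable (sf_lebesgue_Rd d \x leb)%E (fun p => F (consR p)) ->
  cintegrable (lebesgue_Rd d.+1) F /\
  cintegral (lebesgue_Rd d.+1) setT F =
  cintegral (sf_lebesgue_Rd d \x leb)%E setT (fun p => F (consR p)).
Proof.
move=> [F1 F2] [i1 i2]; split; last first.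
  rewrite /cintegral /Rintegral; congr (fine _ +i* fine _).
    exact: (integral_pushforward (measurable_consR (d:=d)) (proj2 (measurable_EFinP _ _) F1) i1).
  exact: (integral_pushforward (measurable_consR (d:=d)) (proj2 (measurable_EFinP _ _) F2) i2).
split.
  exact: (integrable_pushforward (measurable_consR (d:=d)) (proj2 (measurable_EFinP _ _) F1) i1).
exact: (integrable_pushforward (measurable_consR (d:=d)) (proj2 (measurable_EFinP _ _) F2) i2).
Qed.

Lemma tnth_behead d (x : d.+1.-tuple R) (i : 'I_d) :
  tnth [tuple of behead x] i = tnth x (lift ord0 i).
Proof. by rewrite [in RHS](tuple_eta x) tnthS; congr tnth; exact: val_inj. Qed.

Lemma tnth_consR0 d (p : d.-tuple R * measurableTypeR R) : tnth (consR p) ord0 = p.2.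
Proof. by []. Qed.

Lemma tnth_consRS d (p : d.-tuple R * measurableTypeR R) (i : 'I_d) :
  tnth (consR p) (lift ord0 i) = tnth p.1 i.
Proof. by rewrite tnthS; congr tnth; exact: val_inj. Qed.

Lemma cmeasurable_prod d (F : 'I_d -> R -> R[i]) :
  (forall i, cmeasurable (F i : measurableTypeR R -> _)) ->
  cmeasurable (fun x : d.-tuple R => \prod_(i < d) F i (tnth x i)).
Proof.
move=> mF; elim: (index_enum _) => [|i s IH].
  by under eq_fun do rewrite big_nil; exact: cmeasurable_cst.
under eq_fun do rewrite big_cons; apply: cmeasurableM => //.
by apply: (cmeasurable_comp (h := fun x : d.-tuple R => tnth x i)) (mF i); exact: measurable_tnth.
Qed.

(** Induction on the dimension, by Fubini. *)
Lemma cintegral_prod d (F : 'I_d -> R -> R[i]) :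
  (forall i, cintegrable leb (F i)) ->
  cintegrable (lebesgue_Rd d) (fun x => \prod_(i < d) F i (tnth x i)) /\
  cintegral (lebesgue_Rd d) setT (fun x => \prod_(i < d) F i (tnth x i)) =
  \prod_(i < d) cintegral leb setT (F i).
Proof.
elim: d F => [|d IH] F iF.
  under eq_fun do rewrite big_ord0.
  have i1 : (\d_[tuple] : measure (0.-tuple R) R).-integrable setT (fun=> (1%R : R)%:E).
    apply/integrableP; split; first exact: measurable_cst.
    by rewrite integral_dirac// diracT mul1e /= normr1 ltry.
  split; first by split => //=; exact: integrable0.
  rewrite big_ord0 /cintegral /=; congr (_ +i* _).
    by rewrite /Rintegral integral_dirac// diracT mul1e.
  by rewrite Rintegral_cst// mul0r.
have mF := cmeasurable_prod (fun i => cintegrable_measurable (iF i)).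
have [iG eG] := IH (fun i => F (lift ord0 i)) (fun i => iF _).
have FE : (fun p => \prod_(i < d.+1) F i (tnth (consR p) i)) =
    (fun p => \prod_(i < d) F (lift ord0 i) (tnth p.1 i) * F ord0 p.2).
  apply/funext => p; rewrite big_ord_recl tnth_consR0 mulrC; congr (_ * _).
  by apply: eq_bigr => i _; rewrite tnth_consRS.
have iT := @cintegrable_tensor R _ _ _ _ (sf_lebesgue_Rd d) leb _ _ iG (iF ord0).
have := cintegrable_lebesgue_RdS mF.
rewrite FE => /(_ iT)[i1 ->]; split => //.
rewrite (@cintegral_tensor R _ _ _ _ (sf_lebesgue_Rd d) leb _ _ iG (iF ord0)).
by rewrite big_ord_recl mulrC -eG.
Qed.

Lemma integral_prod d (F : 'I_d -> R -> R) :
  (forall i, leb.-integrable setT (EFin \o F i)) ->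
  (lebesgue_Rd d).-integrable setT (fun x => (\prod_(i < d) F i (tnth x i))%:E) /\
  \int[lebesgue_Rd d]_x (\prod_(i < d) F i (tnth x i)) =
  \prod_(i < d) \int[leb]_r (F i r).
Proof.
move=> iF; have [] := cintegral_prod (fun i => cintegrable_real (iF i)).
under eq_fun do rewrite -rmorph_prod/=.
move=> [i1 _] /(congr1 (@complex.Re R)) /= H; split=> //; rewrite H.
rewrite (eq_bigr (fun i => (\int[leb]_r (F i r))%:C)) -?rmorph_prod// => i _.
by apply: complexP => //=; rewrite Rintegral_cst// mul0r.
Qed.

End product_functions.

Section affine.
Context {R : realType}.
Local Notation leb := (@lebesgue_measure R).

Definition affine (a c : R) (r : measurableTypeR R) : measurableTypeR R := a + c * r.

Lemma measurable_affine (a c : R) : measurable_fun setT (affine a c).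
Proof. by apply: measurable_funD => //; exact: measurable_funM. Qed.

HB.instance Definition _ (a c : R) :=
  isMeasurableFun.Build _ _ _ _ (affine a c) (measurable_affine a c).

Lemma ge0_integral_affine (a c : R) (f : R -> \bar R) : 0 < c ->
  measurable_fun setT f -> (forall r, 0 <= f r)%E ->
  (\int[leb]_r f r = c%:E * \int[leb]_r f (a + c * r)%R)%E.
Proof.
move=> c0 mf f0; have c0' : 0 <= c by exact: ltW.
pose pf : {measure set (measurableTypeR R) -> \bar R} :=
  measure_function_pushforward__canonical__measure_function_Measure leb (measurable_affine a c).
pose m := mscale (NngNum c0') pf.
transitivity (\int[m]_r f r)%E.
  apply: eq_measure_integral => A mA _.
  apply: lebesgue_measure_unique => // _ [[u v]] _ <-.
  rewrite -[RHS]/(c%:E * leb (affine a c @^-1` `]u, v]))%E.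
  rewrite (_ : affine a c @^-1` _ = `](c^-1 * (u - a)), (c^-1 * (v - a))]%classic).
    rewrite !lebesgue_measure_itv /= !lte_fin ltr_pM2l ?invr_gt0// ltrD2r.
    case: ifPn => uv; last by rewrite mule0.
    by rewrite -!EFinB -EFinM; congr EFin; field; rewrite gt_eqF.
  apply/seteqP; split => x /=; rewrite /affine !in_itv/= !(mulrC c^-1) ltr_pdivrMr// ler_pdivlMr// (mulrC c); lra.
rewrite ge0_integral_mscale//; congr (_ * _)%E.
rewrite ge0_integral_pushforward//=.
Qed.

Definition vaffine d (a : d.-tuple R) (c : R) (x : d.-tuple R) : d.-tuple R :=
  [tuple tnth a i + c * tnth x i | i < d].

Lemma measurable_vaffine d (a : d.-tuple R) (c : R) : measurable_fun setT (vaffine a c).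
Proof.
apply/measurable_fun_tnthP => i; rewrite /comp.
under eq_fun do rewrite tnth_mktuple.
apply: measurable_funD => //; apply: measurable_funM => //; exact: measurable_tnth.
Qed.

Lemma vaffine_consR d (a : d.+1.-tuple R) c p : vaffine a c (consR p) =
  consR (vaffine [tuple of behead a] c p.1, tnth a ord0 + c * p.2).
Proof.
apply: eq_from_tnth => i; rewrite tnth_mktuple.
case: (unliftP ord0 i) => [j|] ->; last by rewrite !tnth_consR0.
by rewrite !tnth_consRS tnth_mktuple tnth_behead.
Qed.

Lemma ge0_integral_vaffine d (a : d.-tuple R) (c : R) (f : d.-tuple R -> \bar R) :
  0 < c -> measurable_fun setT f -> (forall x, 0 <= f x)%E ->
  (\int[lebesgue_Rd d]_x f x = (c ^+ d)%:E * \int[lebesgue_Rd d]_x f (vaffine a c x))%E.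
Proof.
move=> c0; elim: d a f => [|d IH] a f mf f0.
  by rewrite !integral_lebesgue_Rd0 expr0 mul1e; congr f; rewrite (tuple0 (vaffine _ _ _)).
have mfc : measurable_fun setT (f \o @consR R d) by exact: measurableT_comp mf _.
have mfa : measurable_fun setT (f \o vaffine a c) by exact: measurableT_comp mf (measurable_vaffine a c).
rewrite ge0_integral_lebesgue_RdS//.
transitivity (\int[lebesgue_Rd d]_x (c%:E * \int[leb]_r f (consR (x, tnth a ord0 + c * r))%R))%E.
  apply: eq_integral => x _; apply: ge0_integral_affine => //.
  exact: (measurableT_comp mfc (pair1_measurable x)).
have mg : measurable_fun setT (fun p : d.-tuple R * measurableTypeR R => f (consR (p.1, affine (tnth a ord0) c p.2))).
  apply: (measurableT_comp mfc); apply/measurable_fun_pairP; split; first exact: measurable_fst.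
  exact: (measurableT_comp (measurable_affine _ _) measurable_snd).
have mF := @measurable_fun_fubini_tonelli_F _ _ _ _ _ leb _ mg (fun p => f0 _).
rewrite ge0_integralZl//; last 2 first.
- by move=> x _; apply: integral_ge0.
- by rewrite lee_fin ltW.
rewrite [X in (_ * X)%E](IH [tuple of behead a])//; last by move=> x; exact: integral_ge0.
rewrite muleA -EFinM -exprS; congr (_ * _)%E.
rewrite (ge0_integral_lebesgue_RdS mfa (fun x => f0 _)).
by apply: eq_integral => x _; apply: eq_integral => r _; rewrite /= vaffine_consR.
Qed.

Lemma fine_scale_sub (k : R) (a b : \bar R) : 0 < k -> (0 <= a)%E -> (0 <= b)%E ->
  fine (k%:E * a - k%:E * b)%E = k * fine (a - b)%E.
Proof.
move=> k0; case: a b => [a| |] [b| |] //= a0 b0; rewrite ?gt0_muley ?lte_fin//= ?mulr0//.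
by rewrite mulrBr.
Qed.

Lemma Rintegral_vaffine d (a : d.-tuple R) (c : R) (f : d.-tuple R -> R) : 0 < c ->
  measurable_fun setT f ->
  \int[lebesgue_Rd d]_x f x = c ^+ d * \int[lebesgue_Rd d]_x f (vaffine a c x).
Proof.
move=> c0 mf; rewrite /Rintegral.
have mf' := (measurable_EFinP setT f).2 mf.
rewrite integralE (@ge0_integral_vaffine d a c)//; last exact: measurable_funepos.
rewrite (@ge0_integral_vaffine d a c (_^\-)%E)//; last exact: measurable_funeneg.
have -> : (\int[lebesgue_Rd d]_x (f (vaffine a c x))%:E =
    \int[lebesgue_Rd d]_x (EFin \o f)^\+ (vaffine a c x) -
    \int[lebesgue_Rd d]_x (EFin \o f)^\- (vaffine a c x))%E.
  rewrite (integralE _ setT (fun x => (f (vaffine a c x))%:E)); congr (_ - _)%E; apply: eq_integral => x _.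
    by rewrite !funeposE.
  by rewrite !funenegE.
apply: fine_scale_sub; first by rewrite exprn_gt0.
  by apply: integral_ge0 => x _; exact: funepos_ge0.
by apply: integral_ge0 => x _; exact: funeneg_ge0.
Qed.

End affine.

(** * Plane waves on the torus *)

Section calculus.
Context {R : realType}.
Local Notation leb := (@lebesgue_measure R).
Implicit Types (f F : R -> R).

Lemma derive_continuous f (df : R -> R) : (forall x : R, is_derive x 1 f (df x)) -> continuous f.
Proof.
by move=> fE x; apply/differentiable_continuous/derivable1_diffP; exact: ex_derive.
Qed.

Lemma integral_derive F f (a b : R) : a < b -> continuous f ->
  (forall x : R, is_derive x 1 F (f x)) ->
  \int[leb]_(x in `[a, b]) f x = F b - F a.
Proof.
move=> ab cf dF; have cF := derive_continuous dF.
rewrite /Rintegral (@continuous_FTC2 _ _ F)//.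
- exact: continuous_subspaceT.
- split => //.
  + by apply: cvg_at_right_filter; exact: cF.
  + by apply: cvg_at_left_filter; exact: cF.
- by move=> x _; rewrite derive1E derive_val.
Qed.

Lemma is_derive_affine_comp f (df a b x : R) : is_derive (a + b * x) 1 f df ->
  is_derive x 1 (fun r => f (a + b * r)) (b * df).
Proof.
move=> fE; have aE : is_derive x 1 (fun r => a + b * r) b.
  by apply: is_derive_eq; rewrite /GRing.scale /=; ring.
by have := @is_derive1_comp R f (fun r => a + b * r) x df b fE aE; rewrite /GRing.scale /= mulrC.
Qed.

Lemma is_derive_cos_affine (a b x : R) :
  is_derive x 1 (fun r => cos (a + b * r)) (- b * sin (a + b * x)).
Proof. by rewrite mulNr -mulrN; exact: is_derive_affine_comp. Qed.

Lemma is_derive_sin_affine (a b x : R) :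
  is_derive x 1 (fun r => sin (a + b * r)) (b * cos (a + b * x)).
Proof. exact: is_derive_affine_comp. Qed.

Lemma is_derive_cosM (b x : R) :
  is_derive x 1 (fun r => cos (b * r)) (- b * sin (b * x)).
Proof.
by have := is_derive_cos_affine 0 b x; rewrite add0r; under eq_fun do rewrite add0r.
Qed.

Lemma is_derive_sinM (b x : R) :
  is_derive x 1 (fun r => sin (b * r)) (b * cos (b * x)).
Proof.
by have := is_derive_sin_affine 0 b x; rewrite add0r; under eq_fun do rewrite add0r.
Qed.

End calculus.

Section cis.
Context {R : realType}.
Local Notation leb := (@lebesgue_measure R).

Lemma cis_sum d (F : 'I_d -> R) : cis (\sum_(i < d) F i) = \prod_(i < d) cis (F i).
Proof.
by apply: (big_morph _ (fun a b => cisD a b)); exact: cis0.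
Qed.

Lemma cderive_cis (A : R[i]) (a b r : R) :
  cderivable (fun r => A * cis (a + b * r)) r /\
  cderive (fun r => A * cis (a + b * r)) r = b%:C * 'i * (A * cis (a + b * r)).
Proof.
have dR : is_derive r 1 (fun t => complex.Re (A * cis (a + b * t)))
    (complex.Re (b%:C * 'i * (A * cis (a + b * r)))).
  under eq_fun do rewrite ReM /=.
  have d1 := is_derive_cos_affine a b r; have d2 := is_derive_sin_affine a b r.
  by apply: is_derive_eq; rewrite !ReImE /= /GRing.scale /=; ring.
have dI : is_derive r 1 (fun t => complex.Im (A * cis (a + b * t)))
    (complex.Im (b%:C * 'i * (A * cis (a + b * r)))).
  under eq_fun do rewrite ImM /=.
  have d1 := is_derive_cos_affine a b r; have d2 := is_derive_sin_affine a b r.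
  by apply: is_derive_eq; rewrite !ReImE /= /GRing.scale /=; ring.
split; first by split; exact: ex_derive.
by apply: complexP; rewrite /= derive1E derive_val.
Qed.

Lemma cis_2pi_int (k : int) : cis (k%:~R * (2 * pi)) = 1 :> R[i].
Proof.
have c1 : cis (2 * pi) = 1 :> R[i] by rewrite /cis mulr_natl cos2pi sin2pi.
have cn (n : nat) : cis (n%:R * (2 * pi)) = 1 :> R[i].
  by elim: n => [|n IH]; rewrite ?mul0r ?cis0// -natr1 mulrDl mul1r cisD IH c1 mul1r.
case: k => [n|n]; first exact: cn.
have := cn n.+1; rewrite NegzE mulrNz mulNr /cis cosN sinN => -[-> ->].
by rewrite oppr0.
Qed.

Lemma integral_cis_period (k : int) :
  cintegral leb `[0, 2 * pi] (fun r => cis (k%:~R * r)) =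
  (if k == 0 then 2 * pi else 0)%:C.
Proof.
have p2 : 0 < 2 * pi :> R by rewrite mulr_gt0// pi_gt0.
have [->|k0] := eqVneq k 0.
  rewrite /cintegral /=.
  under eq_Rintegral do rewrite mul0r cos0.
  under [X in _ +i* X]eq_Rintegral do rewrite mul0r sin0.
  rewrite !Rintegral_cst// mul0r mul1r.
  rewrite [X in fine X](_ : _ = (2 * pi)%:E)//.
  by apply: (etrans (lebesgue_measure_itv _)); rewrite /= lte_fin p2 sube0.
have k0' : k%:~R != 0 :> R by rewrite intr_eq0.
have := cis_2pi_int k; rewrite /cis => -[c1 s1].
have cc := @derive_continuous R _ _ (is_derive_cosM k%:~R).
have cs := @derive_continuous R _ _ (is_derive_sinM k%:~R).
have dc (x : R) : is_derive x 1 (fun r : R => k%:~R^-1 * sin (0 + k%:~R * r)) (cos (k%:~R * x)).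
  have d2 := is_derive_sin_affine 0 k%:~R x.
  by apply: is_derive_eq; rewrite /GRing.scale /= add0r; field.
have ds (x : R) : is_derive x 1 (fun r : R => - k%:~R^-1 * cos (0 + k%:~R * r)) (sin (k%:~R * x)).
  have d2 := is_derive_cos_affine 0 k%:~R x.
  by apply: is_derive_eq; rewrite /GRing.scale /= add0r; field.
rewrite /cintegral /= (integral_derive p2 cc dc) (integral_derive p2 cs ds).
by rewrite !add0r !mulr0 c1 s1 sin0 cos0 mulr0 !subrr.
Qed.

End cis.

Section torus_fourier.
Context {R : realType}.
Local Notation leb := (@lebesgue_measure R).

Definition period : set R := `[0, 2 * pi]%classic.

(** Fubini for the product of the functions cut off to one period. *)
Lemma cintegral_torus_cell d (A : R[i]) (F : 'I_d -> R -> R[i]) :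
  (forall i, cmeasurable (F i : measurableTypeR R -> _)) ->
  (forall i r, cabs (F i r) <= 1) ->
  cintegral (lebesgue_Rd d) torus_cell (fun x => A * \prod_(i < d) F i (tnth x i)) =
  A * \prod_(i < d) cintegral leb period (F i).
Proof.
move=> mF F1; pose G i r := (\1_period r)%:C * F i r.
have mp : measurable (period : set (measurableTypeR R)) by exact: measurable_itv.
have iG i : cintegrable leb (G i).
  apply: (@dominated_cintegrable R _ _ leb (G i) (fun r => \1_period r : R)).
  - by apply: cmeasurableM => //; exact: cmeasurable_real.
  - exact: integrable_indic_itv.
  - by move=> r; rewrite cabsM cabs_real ger0_norm// ler_piMr.
have GE i : cintegral leb period (F i) = cintegral leb setT (G i).
  rewrite /cintegral Rintegral_mkcond [X in _ +i* X]Rintegral_mkcond.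
  congr (_ +i* _); apply: eq_Rintegral => r _; rewrite /G patchE ?realCM_Re ?realCM_Im indicE;
    by case: ifPn; rewrite ?mul1r ?mul0r.
rewrite (eq_bigr _ (fun i _ => GE i)).
have [iP <-] := cintegral_prod iG; rewrite -(cintegralZ A iP).
have GP x : \prod_(i < d) G i (tnth x i) = (\1_torus_cell x)%:C * \prod_(i < d) F i (tnth x i).
  rewrite /G big_split /= -rmorph_prod /=; congr (_%:C * _).
  rewrite [RHS]indicE; have [xc|xc] := boolP (x \in torus_cell).
    rewrite big1// => i _; rewrite indicE mem_set// /period /= in_itv/=.
    by move: xc; rewrite inE; exact.
  have /existsNP[i ni] : ~ torus_cell x by move: xc; rewrite notin_setE.
  apply/eqP; rewrite prodf_seq_eq0; apply/hasP; exists i; rewrite ?mem_index_enum//=.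
  by rewrite indicE memNset// /period /= in_itv.
rewrite /cintegral Rintegral_mkcond [X in _ +i* X]Rintegral_mkcond.
congr (_ +i* _); apply: eq_Rintegral => x _; rewrite GP mulrCA patchE ?realCM_Re ?realCM_Im indicE;
    by case: ifPn; rewrite ?mul1r ?mul0r.
Qed.

Definition torus_cst d : R := (2 * pi) `^ (d%:R / 2).

Lemma twopi_gt0 : 0 < 2 * pi :> R. Proof. by rewrite mulr_gt0// pi_gt0. Qed.

Lemma torus_cst_gt0 d : 0 < torus_cst d. Proof. by rewrite powR_gt0// twopi_gt0. Qed.

Lemma fourier_cst_gt0 d : 0 < @fourier_cst R d.
Proof. by rewrite powR_gt0// twopi_gt0. Qed.

Lemma fourier_torus_cst d : @fourier_cst R d * torus_cst d = 1.
Proof.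
by rewrite /fourier_cst /torus_cst powRN mulVf// gt_eqF// powR_gt0 // twopi_gt0.
Qed.

Lemma torus_cst_sqr d : torus_cst d ^+ 2 = (2 * pi) ^+ d.
Proof. by rewrite /torus_cst -powR_mulrn ?powR_ge0// -powRrM divfK// powR_mulrn// ltW// twopi_gt0. Qed.

Lemma hatT_cis d (A : R[i]) (n k : d.-tuple int) :
  hatT (fun x => A * cis (dot (zvec n) x)) k =
  if k == n then A * (torus_cst d)%:C else 0.
Proof.
rewrite /hatT.
pose F (i : 'I_d) r := cis ((tnth n i - tnth k i)%:~R * r) : R[i].
have FE x : cis (- dot (zvec k) x) * (A * cis (dot (zvec n) x)) =
    A * \prod_(i < d) F i (tnth x i).
  rewrite mulrCA; congr (_ * _); rewrite -cisD /F -cis_sum; congr cis.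
  rewrite /dot -sumrN -big_split; apply: eq_bigr => i _ /=.
  by rewrite !tnth_mktuple rmorphB /= addrC -mulNr -mulrDl.
have -> : cintegral (lebesgue_Rd d) torus_cell
    (fun x => cis (- dot (zvec k) x) * (A * cis (dot (zvec n) x))) =
    A * \prod_(i < d) cintegral leb period (F i).
  rewrite -cintegral_torus_cell; last 2 first.
  - move=> i; apply: cmeasurable_cis; exact: measurable_funM.
  - by move=> i r; rewrite cabs_cis.
  by congr cintegral; apply/funext.
under eq_bigr do rewrite /F /period integral_cis_period.
have [->|kn] := eqVneq k n.
  rewrite (eq_bigr (fun=> (2 * pi)%:C)); last by move=> i _; rewrite subrr eqxx.
  rewrite prodr_const card_ord -rmorphXn /= -torus_cst_sqr mulrCA -rmorphM /=.
  by rewrite expr2 mulrA fourier_torus_cst mul1r.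
have [i ki] : exists i, tnth n i != tnth k i.
  apply/existsP; rewrite -negb_forall; apply: contra kn => /forallP kn.
  by apply/eqP/eq_from_tnth => i; apply/esym/eqP.
by rewrite (bigD1 i)//= subr_eq0 (negbTE ki) mul0r !mulr0.
Qed.

Lemma HsT_norm_cis d (s : R) (A : R[i]) (n : d.-tuple int) :
  HsT_norm s (fun x => A * cis (dot (zvec n) x)) =
  (japanese (zvec n : d.-tuple R) `^ s * (cabs A * torus_cst d))%:E.
Proof.
rewrite /HsT_norm.
pose a k := ((japanese (zvec k : d.-tuple R) `^ s * cabs (hatT (fun x => A * cis (dot (zvec n) x)) k)) ^+ 2)%:E.
have -> : \esum_(k in [set: d.-tuple int]) a k = a n.
  rewrite -(@esum_set1 _ _ n a) ?lee_fin ?sqr_ge0// [RHS]esum_mkcond.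
  apply: eq_esum => k _; rewrite in_set1 /a hatT_cis.
  by case: ifPn => // _; rewrite cabs0 mulr0 expr0n.
rewrite /a hatT_cis eqxx poweR_EFin cabsM cabs_real (ger0_norm (ltW (torus_cst_gt0 d))).
rewrite -powR_mulrn ?mulr_ge0 ?powR_ge0 ?cabs_ge0 ?(ltW (torus_cst_gt0 d))//.
by rewrite -powRrM divff// powRr1 ?mulr_ge0 ?powR_ge0 ?cabs_ge0 ?(ltW (torus_cst_gt0 d)).
Qed.

(** Only the zero frequency survives, where the symbol is 1; so all cubic
    partial sums are equal. *)
Lemma resolvent_cst d (eps : R) (A : R[i]) (x : d.-tuple R) :
  resolvent eps (fun _ => A) x = A.
Proof.
pose z : d.-tuple int := [tuple 0 | i < d].
have dz (y : d.-tuple R) : dot (zvec z) y = 0.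
  by rewrite /dot big1// => i _; rewrite !tnth_mktuple mul0r.
have hA k : hatT (fun _ : d.-tuple R => A) k = if k == z then A * (torus_cst d)%:C else 0.
  have AE : (fun _ : d.-tuple R => A) = fun y => A * cis (dot (zvec z) y).
    by apply/funext => y; rewrite dz cis0 mulr1.
  by rewrite AE hatT_cis.
rewrite /resolvent /multiplierT.
set F := (X in clim X).
have FE N : F N = A * (torus_cst d)%:C.
  rewrite /F.
  pose j0 : d.-tuple 'I_N.*2.+1 := [tuple inord N | i < d].
  have cj j : (cube_point j == z) = (j == j0).
    apply/eqP/eqP => [/(congr1 (fun t => tnth t _)) jz|->].
      apply: eq_from_tnth => i; have := jz i; rewrite !tnth_mktuple => /eqP.
      rewrite subr_eq0 => /eqP[ji]; apply: ord_inj; rewrite inordK ?ji//.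
      by rewrite ltnS -addnn leq_addr.
    apply: (@eq_from_tnth d int) => i; rewrite !tnth_mktuple inordK ?subrr//.
    by rewrite ltnS -addnn leq_addr.
  rewrite (bigD1 j0)//= big1 ?addr0; last first.
    by move=> j jj0; rewrite hA cj (negbTE jj0) mulr0 mul0r.
  have -> : cube_point j0 = z by apply/eqP; rewrite cj.
  rewrite hA eqxx dz cis0 mulr1 /enorm dz sqrtr0 expr0n mulr0 addr0 invr1 mul1r//.
have -> : clim F = A * (torus_cst d)%:C.
  apply: complexP; rewrite /clim /=.
    by under eq_fun do rewrite FE; exact: lim_cst.
  by under eq_fun do rewrite FE; exact: lim_cst.
by rewrite mulrCA -rmorphM /= fourier_torus_cst mulr1.
Qed.

End torus_fourier.

Section plane_waves.
Context {R : realType} {d : nat}.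
Variable n : d.-tuple int.
Local Notation nv := (zvec n : d.-tuple R).

Lemma dot_update (x : d.-tuple R) i r : dot nv (update x i r) =
  (dot nv x - tnth nv i * tnth x i) + tnth nv i * r.
Proof.
rewrite /dot (bigD1 i)//= [in RHS](bigD1 i)//= [tnth (update _ _ _) i]tnth_mktuple eqxx.
rewrite [X in X - _]addrC addrK addrC; congr (_ + _).
by apply: eq_bigr => j ji; rewrite [tnth (update _ _ _) j]tnth_mktuple (negbTE ji).
Qed.

Lemma cis_partial (A : R[i]) i (x : d.-tuple R) :
  has_partial i (fun x => A * cis (dot nv x)) x /\
  partial i (fun x => A * cis (dot nv x)) x =
  (tnth nv i)%:C * 'i * (A * cis (dot nv x)).
Proof.
rewrite /has_partial /partial.
under eq_fun do rewrite dot_update.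
have [h1 h2] := cderive_cis A (dot nv x - tnth nv i * tnth x i) (tnth nv i) (tnth x i).
by rewrite h2; split => //; rewrite subrK.
Qed.

Lemma cis_partialE (A : R[i]) i :
  partial i (fun x => A * cis (dot nv x)) =
  fun x => ((tnth nv i)%:C * 'i * A) * cis (dot nv x).
Proof. by apply/funext => x; rewrite (cis_partial A i x).2 mulrA. Qed.

Lemma cis_iter_partial (A : R[i]) l : exists B : R[i],
  iter_partial l (fun x => A * cis (dot nv x)) = fun x => B * cis (dot nv x).
Proof.
elim: l => [|i l [B IH]] /=; first by exists A.
by exists ((tnth nv i)%:C * 'i * B); rewrite IH cis_partialE.
Qed.

Lemma cis_smooth_bounded (A : R[i]) :
  smooth_bounded (fun x => A * cis (dot nv x)).
Proof.
split => [l i x|l]; have [B ->] := cis_iter_partial A l.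
  exact: (cis_partial B i x).1.
by exists (cabs B) => x; rewrite cabsM cabs_cis mulr1.
Qed.

Lemma cis_periodic (A : R[i]) : Defs.periodic (fun x : d.-tuple R => A * cis (dot nv x)).
Proof.
move=> i x; rewrite dot_update mulrDr addrA subrK cisD.
by rewrite tnth_mktuple cis_2pi_int mulr1.
Qed.

Lemma cis_laplacian (A : R[i]) :
  laplacian (fun x => A * cis (dot nv x)) =
  fun x => (- (enorm nv ^+ 2)%:C * A) * cis (dot nv x).
Proof.
apply/funext => x; rewrite /laplacian.
under eq_bigr do rewrite !cis_partialE.
rewrite -mulr_suml; congr (_ * _).
under eq_bigr => i _.
  rewrite (_ : _ * _ = - (tnth nv i * tnth nv i)%:C * A); last first.
    rewrite rmorphM /=; transitivity ((tnth nv i)%:C * (tnth nv i)%:C * A * ('i * 'i)); first by ring.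
    by rewrite mulii; ring.
  over.
rewrite -mulr_suml sumrN -rmorph_sum /= /enorm sqr_sqrtr//.
by apply: sumr_ge0 => i _; rewrite -expr2 sqr_ge0.
Qed.

End plane_waves.

Section plane_wave_solutions.
Context {R : realType} {d : nat}.
Variables (s : R) (n : d.-tuple int).
Local Notation nv := (zvec n : d.-tuple R).
Local Notation J := (japanese nv).
Local Notation N := (enorm nv).

Definition wave_freq (eps : R) : R := eps ^+ 2 * N ^+ 4 + N ^+ 2 - J `^ (- (2 * s)).

Definition wave_amp (eps t : R) : R[i] :=
  cis (- (t * wave_freq eps)) * (J `^ (- s))%:C.

Lemma wave_solutionE eps t :
  wave_solution s n eps t = fun x : d.-tuple R => wave_amp eps t * cis (dot nv x).
Proof. by apply/funext => x; rewrite /wave_solution /plane_wave mulrA. Qed.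

Lemma japanese_gt0 (x : d.-tuple R) : 0 < japanese x.
Proof. by rewrite sqrtr_gt0 ltr_wpDr// sqr_ge0. Qed.

Lemma cabs_wave_amp eps t : cabs (wave_amp eps t) = J `^ (- s).
Proof. by rewrite cabs_cisM cabs_real ger0_norm// powR_ge0. Qed.

Lemma sqmod_wave eps t (x : d.-tuple R) :
  sqmod (wave_solution s n eps t) x = (J `^ (- (2 * s)))%:C.
Proof.
rewrite wave_solutionE /sqmod cabsM cabs_wave_amp cabs_cis mulr1; congr (_%:C).
by rewrite -powR_mulrn ?powR_ge0// -powRrM; congr (_ `^ _); ring.
Qed.

Lemma wave_cderive eps t (x : d.-tuple R) :
  cderivable (fun r => wave_solution s n eps r x) t /\
  cderive (fun r => wave_solution s n eps r x) t =
  (- wave_freq eps)%:C * 'i * wave_solution s n eps t x.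
Proof.
have E r : wave_solution s n eps r x =
    (J `^ (- s))%:C * cis (dot nv x) * cis (0 + - wave_freq eps * r).
  by rewrite wave_solutionE /wave_amp add0r mulNr [r * _]mulrC; ring.
under eq_fun do rewrite E.
by rewrite E; exact: cderive_cis.
Qed.

(** When the potential is a constant, the wave solves a linear equation, and
    its time frequency is the value of the symbol minus that constant. *)
Lemma schrodinger_wave V eps :
  (forall t (x : d.-tuple R),
    V (wave_solution s n eps t) x = (J `^ (- (2 * s)))%:C) ->
  schrodinger V eps (plane_wave s n) (wave_solution s n eps).
Proof.
move=> VE; split.
- by move=> t; rewrite wave_solutionE; split; [exact: cis_periodic|exact: cis_smooth_bounded].
- by move=> t x; exact: (wave_cderive eps t x).1.
- by move=> x; rewrite wave_solutionE /wave_amp mul0r oppr0 cis0 mul1r.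
- move=> t x; rewrite VE (wave_cderive eps t x).2 wave_solutionE !cis_laplacian /=.
  set A := wave_amp eps t; set E := cis _; rewrite /wave_freq.
  have -> : 'i * ((- (eps ^+ 2 * N ^+ 4 + N ^+ 2 - J `^ (- (2 * s))))%:C * 'i * (A * E)) =
     (eps ^+ 2 * N ^+ 4 + N ^+ 2 - J `^ (- (2 * s)))%:C * (A * E).
    rewrite rmorphN /=; set W := _%:C.
    by transitivity (- W * ('i * 'i) * (A * E)); [ring|rewrite mulii; ring].
  rewrite (_ : N ^+ 4 = N ^+ 2 * N ^+ 2); last by ring.
  by rewrite rmorphB rmorphD !rmorphM /=; ring.
Qed.

Lemma regularized_NLS_wave eps :
  regularized_NLS eps (plane_wave s n) (wave_solution s n eps).
Proof.
apply: schrodinger_wave => t x.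
have -> : sqmod (wave_solution s n eps t) = fun _ : d.-tuple R => (J `^ (- (2 * s)))%:C.
  by apply/funext => y; exact: sqmod_wave.
exact: resolvent_cst.
Qed.

Lemma cubic_NLS_wave : cubic_NLS (plane_wave s n) (wave_solution s n 0).
Proof. by apply: schrodinger_wave => t x; exact: sqmod_wave. Qed.

Lemma HsT_norm_wave_diff eps t :
  HsT_norm s (fun x : d.-tuple R =>
    wave_solution s n eps t x - wave_solution s n 0 t x) =
  (torus_cst d * cabs (cis (- (t * eps ^+ 2 * N ^+ 4)) - 1 : R[i]))%:E.
Proof.
have -> : (fun x : d.-tuple R => wave_solution s n eps t x - wave_solution s n 0 t x) =
   fun x => (wave_amp eps t - wave_amp 0 t) * cis (dot nv x).
  by apply/funext => x; rewrite !wave_solutionE mulrBl.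
rewrite HsT_norm_cis; congr (_%:E).
have -> : wave_amp eps t - wave_amp 0 t =
    cis (- (t * wave_freq 0)) * ((J `^ (- s))%:C * (cis (- (t * eps ^+ 2 * N ^+ 4)) - 1)).
  rewrite mulrCA mulrBr mulr1 -cisD mulrBr; congr (_ - _); rewrite /wave_amp mulrC; congr (_ * cis _).
    by rewrite /wave_freq; ring.
rewrite cabs_cisM cabsM cabs_real (ger0_norm (powR_ge0 _ _)) !mulrA -powRD; last first.
  by rewrite (gt_eqF (japanese_gt0 _)) implybT.
by rewrite subrr powRr0 mul1r mulrC.
Qed.

(** The supremum is attained at t = pi / (eps^2 |n|^4). *)
Lemma sup_wave_diff eps : 0 < eps -> (exists i, tnth n i != 0) ->
  ereal_sup [set (torus_cst d * cabs (cis (- (t * eps ^+ 2 * N ^+ 4)) - 1 : R[i]))%:E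
     | t in `[0, +oo[%classic] = (2 * torus_cst d)%:E.
Proof.
move=> e0 [i ni].
have N0 : 0 < N.
  rewrite sqrtr_gt0 /dot (bigD1 i)//= ltr_pwDl//.
    by rewrite -expr2 lt_def sqr_ge0 sqrf_eq0 tnth_mktuple intr_eq0 ni.
  by apply: sumr_ge0 => j _; rewrite -expr2 sqr_ge0.
apply/eqP; rewrite eq_le; apply/andP; split.
  apply: ge_ereal_sup => _ [t _ <-]; rewrite lee_fin mulrC ler_wpM2r ?(ltW (torus_cst_gt0 d))//.
  by rewrite (le_trans (cabsB _ _))// cabs_cis cabs1.
apply: ereal_sup_ubound; exists (pi / (eps ^+ 2 * N ^+ 4)).
  by rewrite /= in_itv/= andbT divr_ge0 ?pi_ge0// mulr_ge0 ?exprn_ge0// ltW.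
rewrite -mulrA divfK ?mulf_neq0 ?expf_neq0 ?gt_eqF//; congr (_%:E).
rewrite mulrC; congr (_ * _); rewrite /cis cosN sinN cospi sinpi oppr0.
by rewrite cabs_def /= subr0 expr0n addr0 sqrtr_sqr ltr0_norm; lra.
Qed.

End plane_wave_solutions.

(** * Examples on the torus *)

Lemma not_cvg0_at_right {R : realType} (f : R -> \bar R) (c : R) : 0 < c ->
  (forall e, 0 < e -> (c%:E <= f e)%E) -> ~ (f e @[e --> 0^'+] --> 0%E).
Proof.
move=> c0 cf f0.
have : (c%:E <= lim (f e @[e --> 0^'+]))%E.
  by apply: lime_ge; [apply/cvg_ex; exists 0%E|near=> e; apply: cf; near: e; exact: nbhs_right_gt].
by rewrite (cvg_lim _ f0)// lee_fin leNgt c0.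
Unshelve. all: by end_near. Qed.

Section torus_examples.
Context {R : realType}.

Lemma torus_plane_waves (d : nat) :
   exists c : R, 0 < c /\ forall (s : R) (n : d.-tuple int),
     let u0 : d.-tuple R -> R[i] := plane_wave s n in
     let u := wave_solution s n 0 in
     let dist eps := ereal_sup
       [set HsT_norm s (fun x => wave_solution s n eps t x - u t x)
       | t in `[0, +oo[%classic] in
     [/\ forall eps : R, 0 < eps ->
           regularized_NLS eps u0 (wave_solution s n eps),
         cubic_NLS u0 u,
         forall eps : R, 0 < eps ->
           dist eps =
           ereal_sup
             [set (c * cabs (cis (- (t * eps ^+ 2 *
                       enorm (zvec n : d.-tuple R) ^+ 4)) - 1))%:E
             | t in `[0, +oo[%classic] &
         (exists i, tnth n i != 0) ->
           (forall eps : R, 0 < eps -> dist eps = (2 * c)%:E) /\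
           ~ (dist eps @[eps --> 0^'+] --> 0%E)].
Proof.
exists (torus_cst d); split; first exact: torus_cst_gt0.
move=> s n u0 u dist.
have distE eps : dist eps = ereal_sup
  [set (torus_cst d * cabs (cis (- (t * eps ^+ 2 *
        enorm (zvec n : d.-tuple R) ^+ 4)) - 1))%:E | t in `[0, +oo[%classic].
  by rewrite /dist; congr ereal_sup; apply: eq_imagel => t _; exact: HsT_norm_wave_diff.
split => [eps _||eps _|n0].
- exact: regularized_NLS_wave.
- exact: cubic_NLS_wave.
- exact: distE.
have d2 eps : 0 < eps -> dist eps = (2 * torus_cst d)%:E.
  by move=> e0; rewrite distE; exact: (sup_wave_diff e0 n0).
split => //; apply: (@not_cvg0_at_right _ _ (2 * torus_cst d)).
  by rewrite mulr_gt0// torus_cst_gt0.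
by move=> e e0; rewrite d2.
Qed.

(** The plane wave of frequency 1 is a counterexample, with data independent
    of epsilon. *)
Lemma torus_convergence_fails :
  ~ (forall (u0e : R -> 1.-tuple R -> R[i]) (u0 : 1.-tuple R -> R[i])
       (ue : R -> R -> 1.-tuple R -> R[i]) (u : R -> 1.-tuple R -> R[i]),
       (exists B : R, forall eps, 0 < eps ->
          (HsT_norm 2 (u0e eps) <= B%:E)%E) ->
       HsT_norm 1 (fun x => u0e eps x - u0 x) @[eps --> 0^'+] --> 0%E ->
       (forall eps, 0 < eps -> regularized_NLS eps (u0e eps) (ue eps)) ->
       cubic_NLS u0 u ->
       ereal_sup [set HsT_norm 1 (fun x => ue eps t x - u t x)
                 | t in `[0, +oo[%classic] @[eps --> 0^'+] --> 0%E).
Proof.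
move=> H; have [c [c0 /(_ 1 [tuple 1%:Z])[h1 h2 _ h4]]] := torus_plane_waves 1.
have [|_ +] := h4; first by exists ord0.
apply; apply: (H (fun=> plane_wave 1 [tuple 1%:Z])) h2 => //.
  exists (japanese (zvec [tuple 1%:Z] : 1.-tuple R) `^ 2 *
     (cabs (japanese (zvec [tuple 1%:Z] : 1.-tuple R) `^ (- 1))%:C * torus_cst 1)).
  by move=> eps _; rewrite -HsT_norm_cis.
have -> : (fun _ : R => HsT_norm 1 (fun x => plane_wave 1 [tuple 1%:Z] x - plane_wave 1 [tuple 1%:Z] x)) =
   fun _ : R => (0 : \bar R)%E.
  apply/funext => e; rewrite -[RHS](_ : HsT_norm 1 (fun x : 1.-tuple R => 0 * cis (dot (zvec [tuple 1%:Z]) x)) = _).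
    by congr HsT_norm; apply/funext => x; rewrite subrr mul0r.
  by rewrite HsT_norm_cis cabs0 mul0r mulr0.
exact: cvg_cst.
Qed.

End torus_examples.

(** * Oscillatory integrals on the half-line *)

Section half_line.
Context {R : realType}.
Local Notation leb := (@lebesgue_measure R).
Local Notation I0 := (`[0%R, +oo[%classic : set R).
Implicit Types (f g F : R -> R).

Lemma I0P (r : R) : I0 r <-> 0 <= r.
Proof. by rewrite /= in_itv/= andbT. Qed.

Lemma measurable_I0 : measurable (I0 : set (measurableTypeR R)).
Proof. exact: measurable_itv. Qed.

Lemma gauss_dominated f (C : R) : continuous f ->
  (forall r, 0 <= r -> `|f r| <= C * gauss_fun r) -> leb.-integrable I0 (EFin \o f).
Proof.
move=> cf fC; apply: (@bounded_integrable R _ _ leb I0 f (fun r => C * gauss_fun r)).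
- exact: measurable_I0.
- by apply: measurable_funTS; exact: continuous_measurable_fun.
- apply: integrable_mull; first exact: measurable_I0.
  by apply: integrableS integrableT_gauss => //; exact: measurable_I0.
- by move=> r /I0P; exact: fC.
Qed.

Lemma expr_le_expR m (r : R) : 0 <= r -> r ^+ m <= m`!%:R * expR r.
Proof.
move=> r0; case: m => [|m]; first by rewrite expr0 fact0 mul1r -[leLHS]expR0 ler_expR.
rewrite -ler_pdivrMl ?ltr0n ?fact_gt0// mulrC.
by rewrite (le_trans _ (expR_ge1Dxn m r0))// lerDr.
Qed.

(** The quartic term dominates the quadratic one by completing the square, and
    the power of r by the exponential. *)
Lemma quartic_decay m (k a : R) : 0 < a -> exists C, forall r, 0 <= r ->
  r ^+ m * expR (k * r ^+ 2 - a * r ^+ 4) <= C * gauss_fun r.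
Proof.
move=> a0; exists (m`!%:R * expR (1 + (k + 2) ^+ 2 / (4 * a))) => r r0.
rewrite /gauss_fun -mulrA -expRD.
apply: (@le_trans _ _ (m`!%:R * expR r * expR (k * r ^+ 2 - a * r ^+ 4))).
  by rewrite ler_wpM2r ?expR_ge0// expr_le_expR.
rewrite -mulrA -expRD ler_wpM2l// ler_expR.
have h1 : r <= 1 + r ^+ 2 by nra.
have h2 : (k + 2) * r ^+ 2 - a * r ^+ 4 <= (k + 2) ^+ 2 / (4 * a).
  rewrite ler_pdivlMr ?mulr_gt0//.
  have : 0 <= (2 * a * r ^+ 2 - (k + 2)) ^+ 2 by rewrite sqr_ge0.
  nra.
nra.
Qed.

Lemma quartic_integrable f m (k a : R) : 0 < a -> continuous f ->
  (forall r, 0 <= r -> `|f r| <= r ^+ m * expR (k * r ^+ 2 - a * r ^+ 4)) ->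
  leb.-integrable I0 (EFin \o f).
Proof.
move=> a0 cf ff; have [C hC] := quartic_decay m k a0.
by apply: (@gauss_dominated _ C cf) => r r0; apply: le_trans (ff r r0) (hC r r0).
Qed.

Lemma cvgn_itv0y f : measurable_fun setT f -> leb.-integrable I0 (EFin \o f) ->
  \int[leb]_(r in `[0, n.+1%:R]) f r @[n --> \oo] --> \int[leb]_(r in I0) f r.
Proof.
move=> mf fi.
have E n : \int[leb]_(r in `[0, n.+1%:R]) f r =
    \int[leb]_(r in I0) (f \_ `[0, n.+1%:R]) r.
  rewrite -Rintegral_mkcondr; congr Rintegral; apply/seteqP; split => r /=.
    by rewrite !in_itv/= => /andP[-> ->].
  by case.
under eq_fun do rewrite E.
apply: (@dominated_cvg_Rintegral _ _ _ leb I0 _ f (fun r => `|f r|) measurable_I0 _ _ _ _).2.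
- move=> n; apply: measurable_funTS; apply: (measurable_restrictT _ _).1 => //.
  exact: measurable_funTS.
- move=> r /I0P r0; apply: cvg_near_cst; near=> n.
  rewrite patchE mem_set//= in_itv/= r0/=.
  rewrite (le_trans (ltW (truncnS_gt r)))// ler_nat ltnS; near: n.
  exact: nbhs_infty_ge.
- by have := integrable_abse fi.
- move=> n r _; rewrite patchE; case: ifPn => //; by rewrite normr0.
Unshelve. all: by end_near. Qed.

Lemma integral_derive0y F f (l : R) : continuous f ->
  (forall x : R, is_derive x 1 F (f x)) ->
  leb.-integrable I0 (EFin \o f) ->
  F n.+1%:R @[n --> \oo] --> l ->
  \int[leb]_(r in I0) f r = l - F 0.
Proof.
move=> cf dF fi Fl.
have h := cvgn_itv0y (continuous_measurable_fun cf) fi.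
apply: (cvg_unique _ h) => //=.
under eq_fun => n do rewrite (integral_derive _ cf dF) ?ltr0n//.
apply: cvgB => //; exact: cvg_cst.
Qed.

Lemma cvg_gauss_bound F (C : R) : (forall r, 0 <= r -> `|F r| <= C * gauss_fun r) ->
  F n.+1%:R @[n --> \oo] --> 0.
Proof.
move=> FC; apply/norm_cvg0P.
apply: (@squeeze_cvgr _ _ _ _ (fun=> 0) (fun n => C * gauss_fun n.+1%:R)).
- by apply: nearW => n; rewrite normr_ge0 FC.
- exact: cvg_cst.
rewrite -[X in _ --> X](mulr0 C); apply: cvgMr.
apply: (@cvg_comp _ _ _ (fun n : nat => n.+1%:R : R) gauss_fun); last exact: cvg_gauss_fun.
by have := @cvgr_idn R; rewrite -(cvg_shiftS (fun n => n%:R : R)).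
Qed.

End half_line.

Section oscillatory.
Context {R : realType}.
Local Notation leb := (@lebesgue_measure R).
Local Notation I0 := (`[0%R, +oo[%classic : set R).

Lemma continuous_oscf m (a p l : R) :
  continuous (fun r : R => r ^+ m * expR (- (a * r ^+ 4)) * cos (p + l * r ^+ 4)).
Proof.
move=> r; apply: cvgM.
  apply: cvgM; first exact: exprn_continuous.
  apply: continuous_comp; last exact: continuous_expR.
  by apply: cvgN; apply: cvgM; [exact: cvg_cst|exact: exprn_continuous].
apply: continuous_comp; last exact: continuous_cos.
by apply: cvgD; [exact: cvg_cst|apply: cvgM; [exact: cvg_cst|exact: exprn_continuous]].
Qed.

(** The phase p makes this one family closed under all operations below:
    p = - pi / 2 replaces the cosine by a sine, and a derivative in l adds
    pi / 2 to p. *)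
Definition osc m (a p l : R) : R :=
  \int[leb]_(r in I0) (r ^+ m * expR (- (a * r ^+ 4)) * cos (p + l * r ^+ 4)).

Lemma normr_cos_le1 (x : R) : `|cos x| <= 1.
Proof. by rewrite ler_norml cos_geN1 cos_le1. Qed.

Lemma normr_oscf_le m (a p l r : R) : 0 <= r ->
  `|r ^+ m * expR (- (a * r ^+ 4)) * cos (p + l * r ^+ 4)| <=
  r ^+ m * expR (- (a * r ^+ 4)).
Proof.
move=> r0; rewrite normrM ger0_norm ?mulr_ge0 ?exprn_ge0 ?expR_ge0//.
by rewrite ler_piMr ?mulr_ge0 ?exprn_ge0 ?expR_ge0// normr_cos_le1.
Qed.

Lemma integrable_oscf m (a p l : R) : 0 < a ->
  leb.-integrable I0 (EFin \o (fun r => r ^+ m * expR (- (a * r ^+ 4)) * cos (p + l * r ^+ 4))).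
Proof.
move=> a0; have cf := @continuous_oscf m a p l.
apply: (quartic_integrable (m := m) (k := 0) a0 cf) => r r0.
by rewrite mul0r add0r; exact: normr_oscf_le.
Qed.

Lemma continuous_quartic m (a : R) : continuous (fun r : R => r ^+ m * expR (- (a * r ^+ 4))).
Proof.
have := @continuous_oscf m a 0 0.
by under eq_fun do rewrite mul0r add0r cos0 mulr1.
Qed.

Lemma integrable_quartic m (a : R) : 0 < a ->
  leb.-integrable I0 (EFin \o (fun r => r ^+ m * expR (- (a * r ^+ 4)))).
Proof.
move=> a0; have cf := @continuous_quartic m a.
apply: (quartic_integrable (m := m) (k := 0) a0 cf) => r r0.
by rewrite mul0r add0r ger0_norm// mulr_ge0 ?exprn_ge0 ?expR_ge0.
Qed.

Lemma is_derive_osc m (a p l : R) : 0 < a ->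
  is_derive l 1 (osc m a p) (osc (m + 4) a (p + pi / 2) l).
Proof.
move=> a0.
pose f l (r : R) := r ^+ m * expR (- (a * r ^+ 4)) * cos (p + l * r ^+ 4).
have df (x r : R) : is_derive x 1 (f ^~ r)
    (r ^+ (m + 4) * expR (- (a * r ^+ 4)) * cos (p + pi / 2 + x * r ^+ 4)).
  rewrite /f; have d := is_derive_cos_affine p (r ^+ 4) x.
  under eq_fun => y do rewrite (mulrC y).
  apply: is_derive_eq; rewrite /GRing.scale /= addrAC cosDpihalf exprD [x * _]mulrC.
  by ring.
have Il : `]l - 1, l + 1[%classic l by rewrite /= in_itv/=; lra.
have H1 : forall x, `]l - 1, l + 1[%classic x -> leb.-integrable I0 (EFin \o f x).
  by move=> x _; exact: integrable_oscf.
have H2 : forall x y, `]l - 1, l + 1[%classic x -> I0 y -> derivable (f ^~ y) x 1.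
  by move=> x y _ _; exact: ex_derive.
pose G (r : R) := `|r ^+ (m + 4) * expR (- (a * r ^+ 4))|.
have H3 : leb.-integrable I0 (EFin \o G).
  by apply: integrable_normr; exact: integrable_quartic.
have H4 : forall x y, `]l - 1, l + 1[%classic x -> I0 y -> `|partial1of2 f x y| <= G y.
  move=> x y _ /I0P y0; rewrite partial1of2E derive_val /G normrM.
  by rewrite ler_piMr ?normr_cos_le1.
have D := @derivable_under_integral R _ _ leb f I0 (measurable_I0 (R:=R)) l _ _ Il H1 H2 G (fun=> normr_ge0 _) H3 H4.
have E := @differentiation_under_integral R _ _ leb f I0 (measurable_I0 (R:=R)) l _ _ Il H1 H2 G (fun=> normr_ge0 _) H3 H4.
apply: DeriveDef; first exact: D.
rewrite -derive1E E; apply: eq_Rintegral => r _.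
by rewrite partial1of2E derive_val.
Qed.

Lemma is_derive_quartic_comp (f : R -> R) (df p l x : R) : is_derive (p + l * x ^+ 4) 1 f df ->
  is_derive x 1 (fun r => f (p + l * r ^+ 4)) (4 * l * x ^+ 3 * df).
Proof.
move=> fE; have aE : is_derive x 1 (fun r => p + l * r ^+ 4) (4 * l * x ^+ 3).
  by apply: is_derive_eq; rewrite /GRing.scale /=; ring.
by have := @is_derive1_comp R f (fun r => p + l * r ^+ 4) x df _ fE aE; rewrite /GRing.scale /= mulrC.
Qed.

Lemma is_derive_exprS m (x : R) : is_derive x 1 (fun r => r ^+ m.+1) (m.+1%:R * x ^+ m).
Proof.
have := @is_deriveX R R id m.+1 x 1 1 (is_derive_id x 1).
rewrite (_ : id ^+ m.+1 = (fun r : R => r ^+ m.+1)); last first.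
  by apply/funext => r; rewrite exprfctE.
by rewrite /GRing.scale /= mulr1.
Qed.

Lemma is_derive_quartic (a x : R) :
  is_derive x 1 (fun r => expR (- (a * r ^+ 4))) (- (4 * a * x ^+ 3) * expR (- (a * x ^+ 4))).
Proof.
have := @is_derive_quartic_comp expR (expR (0 + (- a) * x ^+ 4)) 0 (- a) x (is_derive_expR _).
by under eq_fun do rewrite add0r mulNr; rewrite add0r mulNr mulrN mulNr.
Qed.

(** Integrate the derivative of r^(m+1) exp(-a r^4) cos(p + l r^4). *)
Lemma osc_parts m (a p l : R) : 0 < a ->
  (m.+1%:R) * osc m a p l = 4 * a * osc (m + 4) a p l - 4 * l * osc (m + 4) a (p + pi / 2) l.
Proof.
move=> a0.
pose F (r : R) := r ^+ m.+1 * expR (- (a * r ^+ 4)) * cos (p + l * r ^+ 4).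
pose f1 (r : R) := r ^+ m * expR (- (a * r ^+ 4)) * cos (p + l * r ^+ 4).
pose f2 (r : R) := r ^+ (m + 4) * expR (- (a * r ^+ 4)) * cos (p + l * r ^+ 4).
pose f3 (r : R) := r ^+ (m + 4) * expR (- (a * r ^+ 4)) * cos (p + pi / 2 + l * r ^+ 4).
pose f r := m.+1%:R * f1 r - 4 * a * f2 r + 4 * l * f3 r.
have cf : continuous f.
  move=> r; apply: cvgD; [apply: cvgB|]; apply: cvgM; try exact: cvg_cst; exact: continuous_oscf.
have dF (x : R) : is_derive x 1 F (f x).
  have d1 := is_derive_exprS m x; have d2 := is_derive_quartic a x.
  have d3 := is_derive_quartic_comp (is_derive_cos (p + l * x ^+ 4)).
  rewrite /F; apply: is_derive_eq.
  rewrite /f /f1 /f2 /f3 /GRing.scale /= [p + pi / 2 + _]addrAC cosDpihalf exprD exprS.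
  by ring.
have [i1 i2 i3] : [/\ leb.-integrable I0 (EFin \o f1), leb.-integrable I0 (EFin \o f2) & leb.-integrable I0 (EFin \o f3)].
  by split; exact: integrable_oscf.
have mI := measurable_I0 (R:=R).
have fi : leb.-integrable I0 (EFin \o f).
  by apply: integrable_add => //; [apply: integrable_sub => //|]; apply: integrable_mull.
have [C hC] := @quartic_decay R m.+1 0 a a0.
have F0 : F n.+1%:R @[n --> \oo] --> 0.
  apply: (@cvg_gauss_bound R F C) => r r0; apply: le_trans (normr_oscf_le _ _ _ _ r0) _.
  by have := hC r r0; rewrite mul0r add0r.
have := @integral_derive0y R F f 0 cf dF fi F0.
rewrite [F 0](_ : _ = 0); last by rewrite /F expr0n !mul0r.
rewrite subr0 /f RintegralD//; last 2 first.
- by apply: integrable_sub => //; apply: integrable_mull.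
- by apply: integrable_mull.
rewrite RintegralB//; try by apply: integrable_mull.
rewrite !RintegralZl// => H.
by apply/eqP; rewrite -subr_eq0 -H /osc /f1 /f2 /f3; apply/eqP; ring.
Qed.

Lemma osc_addpi m (a p l : R) : 0 < a -> osc m a (p - pi / 2) l = - osc m a (p + pi / 2) l.
Proof.
move=> a0; rewrite -[RHS]mulN1r [in RHS]/osc -RintegralZl; last 2 first.
- exact: measurable_I0.
- exact: integrable_oscf.
apply: eq_Rintegral => r _; rewrite mulN1r -[RHS]mulrN; congr (_ * _).
by rewrite addrAC [in RHS]addrAC cosBpihalf cosDpihalf opprK.
Qed.

(** The pair of integrals with cosine and sine satisfies a linear differential
    system in the frequency; in polar coordinates for (a, l) it is solved by a
    rotation of angle b atan (l/a). *)
Lemma osc_polar m (a l : R) : 0 < a ->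
  osc m a 0 l = osc m a 0 0 * (1 + (l / a) ^+ 2) `^ (- (m.+1%:R / 8)) *
    cos (m.+1%:R / 4 * atan (l / a)).
Proof.
move=> a0; pose b : R := m.+1%:R / 4.
have aN0 : a != 0 by rewrite gt_eqF.
pose c mu := osc m a 0 (0 + a * mu); pose s mu := osc m a (- (pi / 2)) (0 + a * mu).
pose A mu := osc (m + 4) a 0 (0 + a * mu); pose B mu := osc (m + 4) a (pi / 2) (0 + a * mu).
have mu1 (mu : R) : 0 < 1 + mu ^+ 2 by rewrite ltr_wpDr ?sqr_ge0.
have mu1' (mu : R) : 1 + mu ^+ 2 != 0 by rewrite gt_eqF.
have dc (mu : R) : is_derive mu 1 c (a * B mu).
  have := @is_derive_affine_comp R (osc m a 0) _ 0 a mu (is_derive_osc m 0 _ a0).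
  by rewrite add0r.
have ds (mu : R) : is_derive mu 1 s (a * A mu).
  have := @is_derive_affine_comp R (osc m a (- (pi / 2))) _ 0 a mu (is_derive_osc m _ _ a0).
  by rewrite addNr.
have Ec (mu : R) : b * c mu = a * A mu - a * mu * B mu.
  have := osc_parts m 0 (0 + a * mu) a0; rewrite add0r -/(c mu) -/(A mu) -/(B mu) /b add0r.
  by rewrite -[osc _ _ _ (a * mu)]/(osc _ _ _ _) /c /A /B !add0r => H; rewrite mulrAC H; field.
have Es (mu : R) : b * s mu = - (a * B mu) - a * mu * A mu.
  have := osc_parts m (- (pi / 2)) (0 + a * mu) a0; rewrite addNr.
  have := osc_addpi (m + 4) 0 (0 + a * mu) a0; rewrite !add0r => ->.
  by rewrite /s /A /B /b !add0r => H; rewrite mulrAC H; field.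
have EA (mu : R) : a * A mu = b * (c mu - mu * s mu) / (1 + mu ^+ 2).
  rewrite mulrBr mulrCA Ec Es; field; exact: mu1'.
have EB (mu : R) : a * B mu = - (b * (mu * c mu + s mu) / (1 + mu ^+ 2)).
  rewrite mulrDr mulrCA Ec Es; field; exact: mu1'.
pose P mu := expR (b / 2 * ln (1 + mu ^+ 2)).
have dP (mu : R) : is_derive mu 1 P (b * mu / (1 + mu ^+ 2) * P mu).
  have d1 : is_derive mu 1 (fun x : R => 1 + x ^+ 2) (2 * mu).
    by apply: is_derive_eq; rewrite /GRing.scale /=; ring.
  have d2 := @is_derive1_comp R (@ln R) (fun x => 1 + x ^+ 2) mu _ _ (is_derive1_ln (mu1 mu)) d1.
  have d3 : is_derive mu 1 (fun x => b / 2 * ln (1 + x ^+ 2)) (b * mu / (1 + mu ^+ 2)).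
    by apply: is_derive_eq; rewrite /GRing.scale /=; field; exact: mu1'.
  have := @is_derive1_comp R expR (fun x => b / 2 * ln (1 + x ^+ 2)) mu _ _ (is_derive_expR _) d3.
  by rewrite [X in is_derive _ _ _ X]mulrC.
have dth (mu : R) : is_derive mu 1 (fun x => 0 + b * atan x) (b / (1 + mu ^+ 2)).
  have d1 := is_derive1_atan mu.
  by apply: is_derive_eq; rewrite /GRing.scale /=; field; exact: mu1'.
have dC (mu : R) : is_derive mu 1 (fun x => cos (0 + b * atan x)) (- sin (0 + b * atan mu) * (b / (1 + mu ^+ 2))).
  exact: (@is_derive1_comp R cos _ mu _ _ (is_derive_cos _) (dth mu)).
have dS (mu : R) : is_derive mu 1 (fun x => sin (0 + b * atan x)) (cos (0 + b * atan mu) * (b / (1 + mu ^+ 2))).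
  exact: (@is_derive1_comp R sin _ mu _ _ (is_derive_sin _) (dth mu)).
pose X mu := P mu * (c mu * cos (0 + b * atan mu) + s mu * sin (0 + b * atan mu)).
pose Y mu := P mu * (s mu * cos (0 + b * atan mu) - c mu * sin (0 + b * atan mu)).
have dX (mu : R) : is_derive mu 1 X 0.
  have := dc mu; have := ds mu; rewrite EA EB => ds1 dc1.
  have := dC mu; have := dS mu; have := dP mu => dP1 dS1 dC1.
  rewrite /X; apply: is_derive_eq; rewrite /GRing.scale /=.
  by field; exact: mu1'.
have dY (mu : R) : is_derive mu 1 Y 0.
  have := dc mu; have := ds mu; rewrite EA EB => ds1 dc1.
  have := dC mu; have := dS mu; have := dP mu => dP1 dS1 dC1.
  rewrite /Y; apply: is_derive_eq; rewrite /GRing.scale /=.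
  by field; exact: mu1'.
have s0 : s 0 = 0.
  rewrite /s mulr0 addr0 /osc.
  under eq_Rintegral do rewrite mul0r addr0 cosN cos_pihalf mulr0.
  by rewrite Rintegral_cst ?mul0r//; exact: measurable_I0.
have X0 : X 0 = osc m a 0 0.
  by rewrite /X /P expr0n addr0 ln1 mulr0 expR0 mul1r atan0 mulr0 add0r cos0 sin0 mulr1 s0 mul0r addr0 /c mulr0 addr0.
have Y0 : Y 0 = 0.
  by rewrite /Y atan0 mulr0 add0r sin0 s0 mul0r mulr0 subrr mulr0.
set mu := l / a.
have Xm : X mu = osc m a 0 0 by rewrite -X0; exact: is_derive_0_is_cst.
have Ym : Y mu = 0 by rewrite -Y0; exact: is_derive_0_is_cst.
have -> : (1 + mu ^+ 2) `^ (- (m.+1%:R / 8)) = (P mu)^-1.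
  by rewrite /powR gt_eqF// -expRN; congr expR; rewrite /b; field.
have -> : osc m a 0 l = c mu by rewrite /c add0r /mu mulrC divfK.
have P0 : P mu != 0 by rewrite gt_eqF// expR_gt0.
rewrite -/b -Xm /X !add0r.
have := Ym; rewrite /Y !add0r => /eqP; rewrite mulf_eq0 (negbTE P0)/= subr_eq0 => /eqP sc.
rewrite [X in _ = X](_ : _ = (c mu * cos (b * atan mu) + s mu * sin (b * atan mu)) * cos (b * atan mu)); last by field.
rewrite mulrDl mulrAC [s mu * _ * _]mulrAC sc.
by rewrite -[LHS]mulr1 -(cos2Dsin2 (b * atan mu)); ring.
Qed.

End oscillatory.

Section half_line_substitution.
Context {R : realType}.
Local Notation leb := (@lebesgue_measure R).
Local Notation I0 := (`[0%R, +oo[%classic : set R).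
Local Notation J0 := (`]0%R, +oo[%classic : set R).

Lemma ge0_integral_scale (c : R) (f : R -> \bar R) : 0 < c ->
  measurable_fun setT f -> (forall r, 0 <= r -> (0 <= f r)%E) ->
  (\int[leb]_(r in I0) f r = c%:E * \int[leb]_(r in I0) f (c * r)%R)%E.
Proof.
move=> c0 mf f0; rewrite integral_mkcond [in RHS]integral_mkcond.
rewrite (@ge0_integral_affine _ 0 c (f \_ I0))//.
- congr (_ * _)%E; apply: eq_integral => r _.
  by rewrite !patchE add0r; congr (if _ then _ else _); apply/idP/idP;
    rewrite !inE /= !in_itv/= !andbT pmulr_rge0.
- by apply/(measurable_restrictT _ (measurable_I0 (R:=R))); exact: measurable_funTS.
- by move=> r; rewrite patchE; case: ifPn => // /set_mem/I0P; exact: f0.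
Qed.

Lemma cvg_itv_J0 p (f : R -> R) : {in J0, continuous f} -> (forall r, 0 < r -> 0 <= f r) ->
  (\int[leb]_(r in `[(n.+1%:R^-1 ^+ p.+1)%R, (n.+1%:R ^+ p.+1)%R]) (f r)%:E)%E @[n --> \oo] -->
  (\int[leb]_(r in J0) (f r)%:E)%E.
Proof.
move=> cf f0.
have mf : measurable_fun J0 f.
  by apply: open_continuous_measurable_fun => //; exact: interval_open.
pose A n : set R := `[n.+1%:R^-1 ^+ p.+1, n.+1%:R ^+ p.+1]%classic.
have AJ n : A n `<=` J0.
  move=> r; rewrite /A /= !in_itv/= andbT => /andP[h _]; apply: lt_le_trans h.
  by rewrite exprn_gt0// invr_gt0 ltr0n.
have UA : \bigcup_n A n = J0.
  apply/seteqP; split => [r [n _]|r]; first exact: AJ.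
  rewrite /= in_itv/= andbT => r0.
  pose n := maxn (Num.trunc r) (Num.trunc r^-1).
  have h1 : r <= n.+1%:R.
    by rewrite (le_trans (ltW (truncnS_gt r)))// ler_nat ltnS leq_maxl.
  have h2 : r^-1 <= n.+1%:R.
    by rewrite (le_trans (ltW (truncnS_gt r^-1)))// ler_nat ltnS leq_maxr.
  have n1 : 1 <= n.+1%:R :> R by rewrite ler1n.
  exists n => //; rewrite /A /= in_itv/=; apply/andP; split.
    rewrite exprVn invf_ple ?posrE ?exprn_gt0 ?ltr0n// (le_trans h2)//.
    by rewrite exprS ler_peMr ?exprn_ege1// ltW// ltr0n.
  by rewrite (le_trans h1)// exprS ler_peMr ?exprn_ege1// ltW// ltr0n.
rewrite -UA; apply: ge0_nondecreasing_set_cvg_integral.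
- move=> n m nm; apply/subsetPset => r; rewrite /A /= !in_itv/= => /andP[h1 h2].
  apply/andP; split.
    apply: le_trans h1; rewrite ler_pXn2r ?nnegrE ?invr_ge0//.
    by rewrite lef_pV2 ?posrE ?ltr0n// ler_nat.
  by apply: (le_trans h2); rewrite ler_pXn2r ?nnegrE// ler_nat.
- by move=> n; exact: measurable_itv.
- by move=> n; apply/measurable_EFinP; by apply: (measurable_funS _ (AJ n) mf); exact: measurable_itv.
- by move=> n r /AJ; rewrite /= in_itv/= andbT lee_fin; exact: f0.
Qed.

(** The case of the substitution rule that covers powers of the radius; the
    integrand may be singular at 0. *)
Lemma ge0_integral_power_substitution p (f : R -> R) :
  {in J0, continuous f} -> (forall r, 0 < r -> 0 <= f r) ->
  (\int[leb]_(r in J0) (f r)%:E =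
   \int[leb]_(r in J0) (f (r ^+ p.+1) * (p.+1%:R * r ^+ p))%:E)%E.
Proof.
move=> cf f0.
pose g r := f (r ^+ p.+1) * (p.+1%:R * r ^+ p).
have J0P (r : R) : J0 r <-> 0 < r by rewrite /= in_itv/= andbT.
have cfp : {in J0, continuous (f \o (fun r : R => r ^+ p.+1))}.
  move=> r /set_mem/J0P r0; apply: continuous_comp; first exact: exprn_continuous.
  by apply: cf; apply/mem_set/J0P; rewrite exprn_gt0.
have cd : continuous (fun r : R => p.+1%:R * r ^+ p).
  by move=> r; apply: cvgM; [exact: cvg_cst|exact: exprn_continuous].
have cg : {in J0, continuous g}.
  by move=> r rJ; apply: cvgM; [exact: cfp|exact: cd].
have g0 r : 0 < r -> 0 <= g r.
  by move=> r0; rewrite mulr_ge0 ?f0 ?exprn_gt0// mulr_ge0// exprn_ge0// ltW.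
have h1 := @cvg_itv_J0 p f cf f0.
have h2 := @cvg_itv_J0 0 g cg g0.
apply: (cvg_unique _ h1) => //=; apply: cvg_trans h2; apply: near_eq_cvg; near=> n.
rewrite !expr1.
have n0 : 0 < n.+1%:R^-1 :> R by rewrite invr_gt0 ltr0n.
have nn : n.+1%:R^-1 <= n.+1%:R :> R.
  by rewrite (@le_trans _ _ 1)// ?invf_le1 ?ltr0n ?ler1n.
have dE : (fun r : R => r ^+ p.+1)^`()%classic = fun r => p.+1%:R * r ^+ p.
  by apply/funext => r; have d := is_derive_exprS p r; rewrite derive1E derive_val.
rewrite (@integration_by_substitution_increasing _ (fun r => r ^+ p.+1) f)//.
- by apply: eq_integral => r _; rewrite dE.
- move=> x y; rewrite !in_itv/= => /andP[x1 _] /andP[y1 _] xy.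
  by rewrite ltr_pXn2r ?nnegrE// (le_trans (ltW n0)).
- by rewrite dE => x _; exact: cd.
- by rewrite dE; apply/cvg_ex; exists (p.+1%:R * n.+1%:R^-1 ^+ p); apply: cvg_at_right_filter; exact: cd.
- by rewrite dE; apply/cvg_ex; exists (p.+1%:R * n.+1%:R ^+ p); apply: cvg_at_left_filter; exact: cd.
- split.
  + by move=> x _; have d := is_derive_exprS p x; exact: ex_derive.
  + by apply: cvg_at_right_filter; exact: exprn_continuous.
  + by apply: cvg_at_left_filter; exact: exprn_continuous.
- apply: continuous_in_subspaceT => x; rewrite inE /= in_itv/= => /andP[x1 _].
  by apply: cf; apply/mem_set/J0P; apply: lt_le_trans x1; rewrite exprn_gt0.
Unshelve. all: by end_near. Qed.

Lemma integral_J0I0 (f : R -> R) : measurable_fun J0 f ->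
  (\int[leb]_(r in J0) (f r)%:E = \int[leb]_(r in I0) (f r)%:E)%E.
Proof. by move=> mf; rewrite integral_itv_obnd_cbnd//; exact/measurable_EFinP. Qed.

Section tonelli.
Variable f : R -> R -> R.
Hypothesis mf : measurable_fun setT
  (fun p : measurableTypeR R * measurableTypeR R => f p.1 p.2).
Hypothesis f0 : forall x y, 0 <= x -> 0 <= y -> 0 <= f x y.

Let g (p : measurableTypeR R * measurableTypeR R) : \bar R :=
  (\1_I0 p.1 * \1_I0 p.2 * f p.1 p.2)%:E.

Let mg : measurable_fun setT g.
Proof.
apply/measurable_EFinP; apply: measurable_funM => //; apply: measurable_funM.
  by apply: (measurableT_comp (f := \1_I0 : measurableTypeR R -> R)).
by apply: (measurableT_comp (f := \1_I0 : measurableTypeR R -> R)).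
Qed.

Let g0 p : (0 <= g p)%E.
Proof.
rewrite /g !indicE lee_fin.
case: (boolP (p.1 \in I0)) => [/set_mem/I0P h1|_]; last by rewrite !mul0r.
case: (boolP (p.2 \in I0)) => [/set_mem/I0P h2|_]; last by rewrite mulr0 mul0r.
by rewrite !mul1r f0.
Qed.

Let gE x : (\int[leb]_y g (x, y) =
  ((fun x => \int[leb]_(y in I0) (f x y)%:E) \_ I0) x)%E.
Proof.
rewrite patchE; case: ifPn => xI.
  rewrite [RHS]integral_mkcond; apply: eq_integral => y _; rewrite patchE /g !indicE /= xI mul1r.
  by case: ifPn => _; rewrite ?mul1r ?mul0r.
by under eq_integral do rewrite /g indicE /= (negbTE xI) !mul0r; rewrite integral0.
Qed.

Lemma measurable_integral_I0 :
  measurable_fun I0 (fun x => \int[leb]_(y in I0) (f x y)%:E)%E.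
Proof.
apply/(measurable_restrictT _ (measurable_I0 (R:=R))).
have <- : (fun x => \int[leb]_y g (x, y))%E = (fun x => \int[leb]_(y in I0) (f x y)%:E)%E \_ I0.
  by apply/funext => x; rewrite gE.
exact: (@measurable_fun_fubini_tonelli_F _ _ _ _ _ leb g mg g0).
Qed.

Lemma tonelli_I0 :
  (\int[leb]_(x in I0) \int[leb]_(y in I0) (f x y)%:E =
   \int[leb]_(y in I0) \int[leb]_(x in I0) (f x y)%:E)%E.
Proof.
have T := @fubini_tonelli _ _ _ _ R leb leb g mg g0.
rewrite integral_mkcond [RHS]integral_mkcond.
transitivity (\int[leb]_x \int[leb]_y g (x, y))%E.
  by apply: eq_integral => x _; rewrite gE.
rewrite T; apply: eq_integral => x _; rewrite patchE; case: ifPn => xI.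
  rewrite [RHS]integral_mkcond; apply: eq_integral => y _; rewrite patchE /g !indicE /= xI mulr1.
  by case: ifPn => _; rewrite ?mul1r ?mul0r.
by under eq_integral do rewrite /g indicE [X in _ * X * _]indicE /= (negbTE xI) mulr0 mul0r; rewrite integral0.
Qed.

End tonelli.

End half_line_substitution.

(** * Quartic moments and the Gamma function *)

Section quartic_moments.
Context {R : realType}.
Local Notation leb := (@lebesgue_measure R).
Local Notation I0 := (`[0%R, +oo[%classic : set R).
Local Notation J0 := (`]0%R, +oo[%classic : set R).

Definition quartic_moment m : R := \int[leb]_(r in I0) (r ^+ m * expR (- r ^+ 4)).
Local Notation M := quartic_moment.

Lemma osc00 m a : osc m a 0 0 = \int[leb]_(r in I0) (r ^+ m * expR (- (a * r ^+ 4))) :> R.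
Proof. by apply: eq_Rintegral => r _; rewrite mul0r addr0 cos0 mulr1. Qed.

Lemma quartic_momentE m : M m = osc m 1 0 0.
Proof. by rewrite osc00; apply: eq_Rintegral => r _; rewrite mul1r. Qed.

Lemma quartic_moment_ge0 m : 0 <= M m.
Proof.
apply: Rintegral_ge0 => r; rewrite /= in_itv/= andbT => r0.
by rewrite mulr_ge0 ?exprn_ge0 ?expR_ge0.
Qed.

(** The functional equation of Gamma at (m + 1) / 4. *)
Lemma quartic_momentS m : m.+1%:R * M m = 4 * M (m + 4).
Proof.
rewrite !quartic_momentE; have := @osc_parts R m 1 0 0 ltr01.
by rewrite mulr0 mul0r subr0 mulr1.
Qed.

Lemma fin_quartic m (a : R) : 0 < a ->
  (\int[leb]_(r in I0) (r ^+ m * expR (- (a * r ^+ 4)))%:E)%E =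
  (\int[leb]_(r in I0) (r ^+ m * expR (- (a * r ^+ 4))))%:E.
Proof.
by move=> a0; rewrite /Rintegral fineK// integrable_fin_num//; exact: integrable_quartic.
Qed.

Lemma osc_scaling m (a : R) : 0 < a -> osc m a 0 0 = a `^ (- (m.+1%:R / 4)) * M m.
Proof.
move=> a0; rewrite osc00; pose c := a `^ (- 4^-1).
have c0 : 0 < c by rewrite powR_gt0.
have c4 : a * c ^+ 4 = 1.
  rewrite /c -powR_mulrn ?powR_ge0// -powRrM mulNr mulVf// powRN powRr1 ?mulfV ?gt_eqF// ltW//.
have cm : c ^+ m.+1 = a `^ (- (m.+1%:R / 4)).
  by rewrite /c -powR_mulrn ?powR_ge0// -powRrM; congr powR; ring.
apply: EFin_inj; rewrite -fin_quartic// (ge0_integral_scale c0); last 2 first.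
- by apply/measurable_EFinP; apply: continuous_measurable_fun; exact: continuous_quartic.
- by move=> r r0; rewrite lee_fin mulr_ge0 ?exprn_ge0 ?expR_ge0.
rewrite -cm exprS -mulrA EFinM; congr (_ * _)%E.
rewrite EFinM quartic_momentE osc00 -fin_quartic// -ge0_integralZl//; last 3 first.
- by apply/measurable_EFinP; apply: measurable_funTS; apply: continuous_measurable_fun; exact: continuous_quartic.
- by move=> r /I0P r0; rewrite lee_fin mulr_ge0 ?exprn_ge0 ?expR_ge0.
- by rewrite lee_fin exprn_ge0// ltW.
apply: eq_integral => r _; rewrite -EFinM; congr EFin.
by rewrite !exprMn mulrA c4 mul1r mulrA.
Qed.

Lemma osc_closed m (a l : R) : 0 < a ->
  osc m a 0 l = M m * (a ^+ 2 + l ^+ 2) `^ (- (m.+1%:R / 8)) *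
    cos (m.+1%:R / 4 * atan (l / a)).
Proof.
move=> a0; rewrite osc_polar// osc_scaling//; congr (_ * _).
rewrite mulrC mulrA [RHS]mulrC; congr (_ * _).
have a20 : 0 < a ^+ 2 by rewrite exprn_gt0.
have -> : a ^+ 2 + l ^+ 2 = (1 + (l / a) ^+ 2) * a ^+ 2 by field; rewrite gt_eqF.
rewrite powRM ?addr_ge0 ?sqr_ge0//; congr (_ * _).
by rewrite -powR_mulrn ?ltW// -powRrM; congr powR; field.
Qed.

(** Substitute y = r^4 in Euler's integral. *)
Lemma Gamma_quartic m : Gamma (m.+1%:R / 4) = 4 * M m :> R.
Proof.
pose f (y : R) := y `^ (m.+1%:R / 4 - 1) * expR (- y).
have cf : {in J0, continuous f}.
  move=> y /set_mem; rewrite /= in_itv/= andbT => y0; apply: cvgM.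
    have dp := is_derive1_powR (m.+1%:R / 4 - 1) y0.
    have : {for y, continuous (fun x : R => x `^ (m.+1%:R / 4 - 1))}.
      by apply: differentiable_continuous; apply/derivable1_diffP; exact: (@ex_derive _ _ _ _ _ _ _ dp).
    exact.
  by apply: continuous_comp; [exact: opp_continuous|exact: continuous_expR].
have f0 (r : R) : 0 < r -> 0 <= f r by move=> r0; rewrite mulr_ge0 ?powR_ge0 ?expR_ge0.
rewrite /Gamma /Rintegral (@ge0_integral_power_substitution R 3 f cf f0).
have -> : (\int[leb]_(r in J0) (f (r ^+ 4) * (4%:R * r ^+ 3))%:E =
   \int[leb]_(r in J0) (4 * (r ^+ m * expR (- r ^+ 4)))%:E)%E.
  apply: eq_integral => r /set_mem; rewrite /= in_itv/= andbT => r0; congr EFin.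
  rewrite /f -powR_mulrn ?ltW// -powRrM.
  have -> : 4%:R * (m.+1%:R / 4 - 1) = m%:R - 3 :> R by rewrite -natr1; field.
  rewrite powRD; last by rewrite (gt_eqF r0) implybT.
  rewrite powR_mulrn ?ltW// powRN -[3]/(3%:R) powR_mulrn ?ltW// -[4%:R]/(4%N%:R) powR_mulrn ?ltW//.
  by field; rewrite gt_eqF.
have mJ : measurable_fun J0 (fun r : R => 4 * (r ^+ m * expR (- r ^+ 4))).
  apply: measurable_funTS; apply: continuous_measurable_fun => r; apply: cvgM; first exact: cvg_cst.
  have := @continuous_quartic R m 1 r; under eq_fun do rewrite mul1r; exact.
rewrite integral_J0I0// -[fine _]/(Rintegral leb I0 _) RintegralZl//.
have := @integrable_quartic R m 1 ltr01.
by congr (integrable _ _ _); apply/funext => r; rewrite /= mul1r.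
Qed.

Lemma quartic_moment3 : M 3 = 4^-1.
Proof.
pose F (r : R) := - 4^-1 * expR (- (1 * r ^+ 4)).
have dF (x : R) : is_derive x 1 F (x ^+ 3 * expR (- (1 * x ^+ 4))).
  have d1 := is_derive_quartic 1 x.
  by rewrite /F; apply: is_derive_eq; rewrite /GRing.scale /=; field.
rewrite quartic_momentE osc00.
rewrite (integral_derive0y (continuous_quartic (R := R) (m := 3) (a := 1)) dF (integrable_quartic 3 ltr01) (l := 0)).
  by rewrite /F expr0n mulr0 oppr0 expR0; field.
have [C hC] := @quartic_decay R 0 0 1 ltr01.
apply: (@cvg_gauss_bound R F (4^-1 * C)) => r r0.
rewrite /F normrM normrN (ger0_norm (expR_ge0 _)) ger0_norm// -mulrA ler_wpM2l//.
by have := hC r r0; rewrite mul0r add0r expr0 mul1r.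
Qed.

(** Write the product as a double integral in (q, r) and substitute r = q w. *)
Lemma quartic_moment_mul i j : (M i * M j)%:E =
  (\int[leb]_(q in I0) \int[leb]_(w in I0)
    (q ^+ (i + j).+1 * w ^+ j * expR (- ((1 + w ^+ 4) * q ^+ 4)))%:E)%E.
Proof.
pose f (q w : R) := q ^+ (i + j).+1 * w ^+ j * expR (- ((1 + w ^+ 4) * q ^+ 4)).
have cM m : continuous (fun r : R => r ^+ m * expR (- r ^+ 4)).
  by have := @continuous_quartic R m 1; under eq_fun do rewrite mul1r.
have mM m (D : set R) : measurable_fun D (fun r : R => (r ^+ m * expR (- r ^+ 4))%:E).
  by apply/measurable_EFinP; apply: measurable_funTS; exact: continuous_measurable_fun.
have eM m : (M m)%:E = (\int[leb]_(r in I0) (r ^+ m * expR (- r ^+ 4))%:E)%E.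
  have := @fin_quartic m 1 ltr01.
  under eq_integral do rewrite mul1r.
  by under [X in _ = X%:E -> _]eq_Rintegral do rewrite mul1r.
rewrite EFinM [X in (X * _)%E]eM -integralZr; last 2 first.
- exact: measurable_I0.
- have := @integrable_quartic R i 1 ltr01.
  by congr (integrable _ _ _); apply/funext => r; rewrite /= mul1r.
have mf : measurable_fun setT (fun p : measurableTypeR R * measurableTypeR R => f p.1 p.2).
  apply: measurable_funM; first apply: measurable_funM.
  - by apply: measurable_funX; exact: measurable_fst.
  - by apply: measurable_funX; exact: measurable_snd.
  apply: measurableT_comp => //; apply: measurableT_comp => //; apply: measurable_funM.
    by apply: measurable_funD => //; apply: measurable_funX; exact: measurable_snd.
  by apply: measurable_funX; exact: measurable_fst.
have f0 q w : 0 <= q -> 0 <= w -> 0 <= f q w.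
  by move=> q0 w0; rewrite !mulr_ge0 ?expR_ge0 ?exprn_ge0.
have mF : measurable_fun J0 (fun q => \int[leb]_(w in I0) (f q w)%:E)%E.
  by apply: measurable_funS (measurable_integral_I0 mf f0); [exact: measurable_I0|move=> q; rewrite /= !in_itv/= !andbT; exact: ltW].
rewrite -integral_itv_obnd_cbnd; last by apply: emeasurable_funM.
rewrite -[RHS]integral_itv_obnd_cbnd//.
apply: eq_integral => q /set_mem; rewrite /= in_itv/= andbT => q0.
rewrite eM (ge0_integral_scale q0)//; last first.
  by move=> r r0; rewrite lee_fin mulr_ge0 ?exprn_ge0 ?expR_ge0.
rewrite muleA -EFinM -ge0_integralZl//; last 3 first.
- exact: measurable_funTS (measurableT_comp (mM j setT) (mulrl_measurable _)).
- by move=> r /I0P r0; rewrite lee_fin !mulr_ge0 ?exprn_ge0 ?expR_ge0// mulr_ge0// ltW.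
- by rewrite lee_fin !mulr_ge0 ?exprn_ge0 ?expR_ge0// ltW.
apply: eq_integral => w _; rewrite -EFinM; congr EFin; rewrite /f.
have -> : - ((1 + w ^+ 4) * q ^+ 4) = - q ^+ 4 + - (q * w) ^+ 4 by ring.
by rewrite expRD exprMn (exprS q (i + j)) (exprD q i j); ring.
Qed.

(** The primitive comes from the factorization of 1 + w^4 into
    1 + sqrt(2) w + w^2 and 1 - sqrt(2) w + w^2. *)
Lemma integral_atan_quartic :
  (\int[leb]_(w in I0) ((1 + w ^+ 2) / (4 * (1 + w ^+ 4)))%:E)%E = (pi / (4 * Num.sqrt 2))%:E.
Proof.
pose s : R := Num.sqrt 2.
have s2 : s ^+ 2 = 2 by rewrite sqr_sqrtr.
have s0 : 0 < s by rewrite sqrtr_gt0.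
have w4 (w : R) : 0 < 1 + w ^+ 4 by rewrite ltr_wpDr// exprn_even_ge0.
pose F (w : R) := (4 * s)^-1 * (atan (1 + s * w) + atan (-1 + s * w)).
have dF (w : R) : is_derive w 1 F ((1 + w ^+ 2) / (4 * (1 + w ^+ 4))).
  have d1 := is_derive_affine_comp (is_derive1_atan (1 + s * w)).
  have d2 := is_derive_affine_comp (is_derive1_atan (-1 + s * w)).
  rewrite /F; apply: is_derive_eq; rewrite /GRing.scale /=.
  have e1 : 1 + (1 + s * w) ^+ 2 = 2 * (1 + s * w + w ^+ 2) by rewrite sqrrD exprMn s2; ring.
  have e2 : 1 + (-1 + s * w) ^+ 2 = 2 * (1 - s * w + w ^+ 2) by rewrite sqrrD exprMn s2; ring.
  have p1 : 0 < 1 + s * w + w ^+ 2.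
    by rewrite -(pmulr_rgt0 _ (ltr0n R 2 : 0 < 2%:R)) -e1 ltr_wpDr ?sqr_ge0.
  have p2 : 0 < 1 - s * w + w ^+ 2.
    by rewrite -(pmulr_rgt0 _ (ltr0n R 2 : 0 < 2%:R)) -e2 ltr_wpDr ?sqr_ge0.
  have e3 : 1 + w ^+ 4 = (1 + s * w + w ^+ 2) * (1 - s * w + w ^+ 2).
    rewrite (_ : _ * _ = 1 + 2 * w ^+ 2 + w ^+ 4 - s ^+ 2 * w ^+ 2); last by ring.
    by rewrite s2; ring.
  rewrite e1 e2 e3; field.
  by rewrite !gt_eqF.
have cf : continuous (fun w : R => (1 + w ^+ 2) / (4 * (1 + w ^+ 4))).
  move=> w; apply: cvgM.
    by apply: cvgD; [exact: cvg_cst|exact: exprn_continuous].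
  apply: cvgV; first by rewrite mulf_neq0// gt_eqF.
  by apply: cvgM; [exact: cvg_cst|apply: cvgD; [exact: cvg_cst|exact: exprn_continuous]].
rewrite (@ge0_continuous_FTC2y _ _ F _ (pi / (4 * s))).
- by rewrite /F mulr0 !addr0 atanN addrN mulr0 sube0.
- by move=> w _; rewrite divr_ge0// ?addr_ge0 ?sqr_ge0// mulr_ge0// ltW.
- exact: continuous_subspaceT.
- have -> : pi / (4 * s) = (4 * s)^-1 * (pi / 2 + pi / 2) by rewrite -splitr mulrC.
  apply: cvgM; first exact: cvg_cst.
  have aff c : c + s * w @[w --> +oo] --> +oo.
    apply/cvgryPge => A; near=> w; rewrite -lerBlDl -ler_pdivrMl//.

  apply: cvgD.
    by apply: (@cvg_comp _ _ _ (fun w => 1 + s * w) (@atan R) _ _ _ (aff 1)); exact: cvgy_atan.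
  by apply: (@cvg_comp _ _ _ (fun w => -1 + s * w) (@atan R) _ _ _ (aff (-1))); exact: cvgy_atan.
- by move=> w _; exact: ex_derive.
- by apply: cvg_at_right_filter; exact: (derive_continuous dF).
- by move=> w _; rewrite derive1E derive_val.
Unshelve. all: by end_near. Qed.

(** The reflection formula for Gamma at 1/4. *)
Lemma quartic_reflection : M 0 * M 2 = pi / (8 * Num.sqrt 2).
Proof.
have mf j : measurable_fun setT (fun p : measurableTypeR R * measurableTypeR R =>
    p.1 ^+ 3 * p.2 ^+ j * expR (- ((1 + p.2 ^+ 4) * p.1 ^+ 4))).
  apply: measurable_funM; first apply: measurable_funM.
  - by apply: measurable_funX; exact: measurable_fst.
  - by apply: measurable_funX; exact: measurable_snd.
  apply: measurableT_comp => //; apply: measurableT_comp => //; apply: measurable_funM.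
    by apply: measurable_funD => //; apply: measurable_funX; exact: measurable_snd.
  by apply: measurable_funX; exact: measurable_fst.
have w4 (w : R) : 0 < 1 + w ^+ 4 by rewrite ltr_wpDr// exprn_even_ge0.
have E j : (\int[leb]_(q in I0) \int[leb]_(w in I0)
    (q ^+ 3 * w ^+ j * expR (- ((1 + w ^+ 4) * q ^+ 4)))%:E =
    \int[leb]_(w in I0) (w ^+ j / (4 * (1 + w ^+ 4)))%:E)%E.
  rewrite (tonelli_I0 (mf j)); last by move=> x y x0 y0; rewrite !mulr_ge0 ?exprn_ge0 ?expR_ge0.
  apply: eq_integral => w /set_mem/I0P w0.
  under eq_integral do rewrite mulrAC [_ * w ^+ j]mulrC EFinM.
  rewrite ge0_integralZl; last 4 first.
  - exact: measurable_I0.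
  - by apply/measurable_EFinP; apply: measurable_funTS; apply: continuous_measurable_fun; exact: continuous_quartic.
  - by move=> r /I0P r0; rewrite lee_fin mulr_ge0 ?exprn_ge0 ?expR_ge0.
  - by rewrite lee_fin exprn_ge0.
  rewrite fin_quartic// -osc00 osc_scaling// quartic_moment3 -EFinM divff// powRN powRr1 ?ltW//.
  by rewrite [4 * _]mulrC invfM.
have cw j : measurable_fun I0 (fun w : R => (w ^+ j / (4 * (1 + w ^+ 4)))%:E).
  apply/measurable_EFinP; apply: measurable_funTS; apply: continuous_measurable_fun.
  move=> w; apply: cvgM; first exact: exprn_continuous.
  apply: cvgV; first by rewrite mulf_neq0// gt_eqF.
  by apply: cvgM; [exact: cvg_cst|apply: cvgD; [exact: cvg_cst|exact: exprn_continuous]].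
have : (M 0 * M 2 + M 2 * M 0)%:E = (pi / (4 * Num.sqrt 2))%:E.
  have n0 j w : I0 w -> (0 <= (w ^+ j / (4 * (1 + w ^+ 4)))%:E)%E.
    by move=> /I0P w0; rewrite lee_fin divr_ge0 ?exprn_ge0// mulr_ge0// ltW.
  rewrite EFinD !quartic_moment_mul !E -integral_atan_quartic.
  rewrite -(ge0_integralD leb (measurable_I0 (R:=R)) (n0 2) (cw 2) (n0 0) (cw 0)).
  by apply: eq_integral => w _; rewrite -EFinD -mulrDl expr0 addrC.
move=> [H]; have s0 : Num.sqrt 2 != 0 :> R by rewrite gt_eqF// sqrtr_gt0.
have : M 0 * M 2 = (pi / (4 * Num.sqrt 2)) / 2 by rewrite -H; field.
by move=> ->; field.
Qed.

End quartic_moments.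

(** * Subordination and monotonicity *)

Section subordination.
Context {R : realType}.
Local Notation leb := (@lebesgue_measure R).
Local Notation I0 := (`[0%R, +oo[%classic : set R).
Local Notation J0 := (`]0%R, +oo[%classic : set R).

Definition gauss_primitive (x : R) : R := \int[leb]_(t in `]-oo, x]) gauss_fun t.
Local Notation E := gauss_primitive.

Lemma is_derive_gauss_primitive (x : R) : is_derive x 1 E (gauss_fun x).
Proof.
have [] := @continuous_FTC1 R gauss_fun -oo%O x (x + 1).
- by rewrite ltrDl.
- by apply: integrableS integrableT_gauss => //; exact: measurable_itv.
- by rewrite ltNyr.
- exact: continuous_gauss_fun.
by move=> d1 d2; apply: DeriveDef => //; rewrite -derive1E d2.
Qed.

Lemma gauss_primitiveE (x : R) : E x = \int[leb]_t (gauss_fun t * \1_`]-oo, x] t).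
Proof.
rewrite /E Rintegral_mkcond; apply: eq_Rintegral => t _; rewrite patchE indicE.
by case: ifPn; rewrite ?mulr1 ?mulr0.
Qed.

Lemma cvg_gauss_primitive (u : nat -> R) (g : R -> R) : measurable_fun setT g ->
  (forall t, gauss_fun t * \1_`]-oo, u n] t @[n --> \oo] --> g t) ->
  E (u n) @[n --> \oo] --> \int[leb]_t g t.
Proof.
move=> mg ug; under eq_fun do rewrite gauss_primitiveE.
apply: (@dominated_cvg_Rintegral _ _ _ leb setT _ g gauss_fun measurableT _ _ _ _).2.
- move=> n; apply: measurable_funM; first exact: measurable_gauss_fun.
  by apply: measurable_indic; exact: measurable_itv.
- by move=> t _; exact: ug.
- exact: integrableT_gauss.
- move=> n t _; rewrite normrM (ger0_norm (gauss_fun_ge0 _)) ler_piMr ?gauss_fun_ge0//.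
  by rewrite indicE; case: (_ \in _); rewrite ?normr1 ?normr0.
Qed.

Lemma cvg_gauss_primitive_y (u : nat -> R) : u n @[n --> \oo] --> +oo ->
  E (u n) @[n --> \oo] --> Num.sqrt pi.
Proof.
move=> uy; have -> : Num.sqrt pi = \int[leb]_t (gauss_fun t) :> R.
  by rewrite /Rintegral integralT_gauss.
apply: cvg_gauss_primitive; first exact: measurable_gauss_fun.
move=> t; apply: cvg_near_cst; near=> n; rewrite indicE mem_set ?mulr1//= in_itv/=.
by near: n; move/cvgryPge : uy; exact.
Unshelve. all: by end_near. Qed.

Lemma cvg_gauss_primitive_Ny (u : nat -> R) : u n @[n --> \oo] --> -oo ->
  E (u n) @[n --> \oo] --> 0.
Proof.
move=> uy; have -> : 0 = \int[leb]_t (0 : R) :> R by rewrite Rintegral_cst// mul0r.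
apply: cvg_gauss_primitive; first exact: measurable_cst.
move=> t; apply: cvg_near_cst; near=> n; rewrite indicE memNset ?mulr0//= in_itv/=.
apply/negP; rewrite -ltNge; near: n; move/cvgrNyPlt : uy; exact.
Unshelve. all: by end_near. Qed.

(** The integrand is half the derivative of
    exp(-2b) E(v - b/v) + exp(2b) E(v + b/v), where E is a primitive of
    exp(-x^2). *)
Lemma subordination (b : R) : 0 < b ->
  (\int[leb]_(v in J0) (expR (- v ^+ 2 - b ^+ 2 / v ^+ 2))%:E =
   (Num.sqrt pi / 2 * expR (- (2 * b)))%:E)%E.
Proof.
move=> b0; pose f (v : R) := expR (- v ^+ 2 - b ^+ 2 / v ^+ 2).
pose F (v : R) := 2^-1 * (expR (- (2 * b)) * E (v - b / v) + expR (2 * b) * E (v + b / v)).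
have dF (v : R) : 0 < v -> is_derive v 1 F (f v).
  move=> v0; have vN0 : v != 0 by rewrite gt_eqF.
  have dm : is_derive v 1 (fun x : R => x - b / x) (1 + b / v ^+ 2).
    have d := is_deriveV vN0 (is_derive_id v 1).
    by apply: is_derive_eq; rewrite /GRing.scale /=; field.
  have dp : is_derive v 1 (fun x : R => x + b / x) (1 - b / v ^+ 2).
    have d := is_deriveV vN0 (is_derive_id v 1).
    by apply: is_derive_eq; rewrite /GRing.scale /=; field.
  have d1 := @is_derive1_comp R E _ v _ _ (is_derive_gauss_primitive _) dm.
  have d2 := @is_derive1_comp R E _ v _ _ (is_derive_gauss_primitive _) dp.
  have e1 : gauss_fun (v - b / v) = expR (2 * b) * f v.
    by rewrite /gauss_fun /f -expRD; congr expR; field.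
  have e2 : gauss_fun (v + b / v) = expR (- (2 * b)) * f v.
    by rewrite /gauss_fun /f -expRD; congr expR; field.
  have e3 : expR (- (2 * b)) * expR (2 * b) = 1 by rewrite -expRD addNr expR0.
  rewrite e1 in d1; rewrite e2 in d2.
  have d3 : is_derive v 1 F (2^-1 * (expR (- (2 * b)) * (expR (2 * b) * f v * (1 + b / v ^+ 2)) +
      expR (2 * b) * (expR (- (2 * b)) * f v * (1 - b / v ^+ 2)))).
    by apply: is_derive_eq; rewrite /GRing.scale /=.
  apply: (@is_derive_eq _ _ _ _ _ _ _ _ d3).
  transitivity (expR (- (2 * b)) * expR (2 * b) * f v); first by field.
  by rewrite e3 mul1r.
have cf : {in J0, continuous f}.
  move=> v /set_mem; rewrite /= in_itv/= andbT => v0.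
  apply: continuous_comp; last exact: continuous_expR.
  apply: cvgB; first by apply: cvgN; exact: exprn_continuous.
  apply: cvgM; first exact: cvg_cst.
  by apply: cvgV; [rewrite expf_neq0// gt_eqF|exact: exprn_continuous].
have h := @cvg_itv_J0 R 0 f cf (fun v _ => expR_ge0 _).
have nS : (n.+1%:R : R) @[n --> \oo] --> +oo.
  by have := @cvgr_idn R; rewrite -(cvg_shiftS (fun n => n%:R : R)).
apply: (cvg_unique _ h) => //=.
have E1 : \forall n \near \oo, (\int[leb]_(r in `[(n.+1%:R^-1 ^+ 1)%R, (n.+1%:R ^+ 1)%R]) (f r)%:E)%E =
    (F n.+1%:R - F n.+1%:R^-1)%:E.
  near=> n; rewrite !expr1.
  have n0 : 0 < n.+1%:R^-1 :> R by rewrite invr_gt0 ltr0n.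
  have nn : n.+1%:R^-1 < n.+1%:R :> R.
    rewrite (@lt_trans _ _ 1)// ?invf_lt1 ?ltr0n// ltr1n ltnS; near: n; exact: nbhs_infty_gt.
  have pos (x : R) : n.+1%:R^-1 <= x -> 0 < x by exact: lt_le_trans.
  have cF (x : R) : 0 < x -> {for x, continuous F}.
    move=> x0; have d := dF _ x0.
    by apply: differentiable_continuous; apply/derivable1_diffP; exact: (@ex_derive _ _ _ _ _ _ _ d).
  rewrite (@continuous_FTC2 _ _ F)//.
  - apply: continuous_in_subspaceT => x; rewrite inE /= in_itv/= => /andP[x1 _].
    by apply: cf; rewrite inE /= in_itv/= andbT pos.
  - split.
    + move=> x; rewrite in_itv/= => /andP[x1 _]; have d := dF x (pos _ (ltW x1)).
      exact: (@ex_derive _ _ _ _ _ _ _ d).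
    + by apply: cvg_at_right_filter; apply: cF; rewrite pos.
    + by apply: cvg_at_left_filter; apply: cF; rewrite pos// ltW.
  - move=> x; rewrite in_itv/= => /andP[x1 _]; have d := dF x (pos _ (ltW x1)).
    by rewrite derive1E (@derive_val _ _ _ _ _ _ _ d).
suff hF : (F n.+1%:R - F n.+1%:R^-1)%:E @[n --> \oo] --> (Num.sqrt pi / 2 * expR (- (2 * b)))%:E.
  by apply: cvg_trans hF; apply: near_eq_cvg; near=> n; apply/esym; near: n.
apply: cvg_EFin; first exact: nearW.
have invn : n.+1%:R^-1 @[n --> \oo] --> (0 : R) by apply/gtr0_cvgV0 => //; exact: nearW.
have bn : b * n.+1%:R @[n --> \oo] --> +oo.
  apply/cvgryPge => A; have /cvgryPge/(_ (b^-1 * A)) := nS.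
  by apply: filterS => n; rewrite ler_pdivrMl.
have L1 : E (n.+1%:R - b / n.+1%:R) @[n --> \oo] --> Num.sqrt pi.
  apply: cvg_gauss_primitive_y; apply/cvgryPge => A.
  have /cvgryPge/(_ (A + b)) := nS; apply: filterS => n; rewrite -lerBrDr => /le_trans; apply.
  by rewrite lerD2l lerN2 ler_pdivrMr ?ltr0n// ler_peMr ?ler1n// ltW.
have L2 : E (n.+1%:R + b / n.+1%:R) @[n --> \oo] --> Num.sqrt pi.
  apply: cvg_gauss_primitive_y; apply/cvgryPge => A.
  have /cvgryPge/(_ A) := nS; apply: filterS => n /le_trans; apply.
  by rewrite lerDl divr_ge0// ltW.
have L3 : E (n.+1%:R^-1 - b / n.+1%:R^-1) @[n --> \oo] --> 0.
  apply: cvg_gauss_primitive_Ny; apply/cvgrNyPle => A.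
  have /cvgryPge/(_ (1 - A)) := bn; apply: filterS => n; rewrite invrK => h1.
  have : n.+1%:R^-1 <= 1 :> R by rewrite invf_le1 ?ltr0n ?ler1n.
  by move: (n.+1%:R^-1) (b * n.+1%:R) h1 => x y; lra.
have L4 : E (n.+1%:R^-1 + b / n.+1%:R^-1) @[n --> \oo] --> Num.sqrt pi.
  apply: cvg_gauss_primitive_y; apply/cvgryPge => A.
  have /cvgryPge/(_ A) := bn; apply: filterS => n /le_trans; apply.
  by rewrite invrK lerDr.
have -> : Num.sqrt pi / 2 * expR (- (2 * b)) =
   2^-1 * (expR (- (2 * b)) * Num.sqrt pi + expR (2 * b) * Num.sqrt pi) -
   2^-1 * (expR (- (2 * b)) * 0 + expR (2 * b) * Num.sqrt pi) by field.
by apply: cvgB; (apply: cvgM; [exact: cvg_cst|apply: cvgD; (apply: cvgM; [exact: cvg_cst|by []])]).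
Unshelve. all: by end_near. Qed.

End subordination.

Lemma integral_gt0 {R : realType} {d} {T : measurableType d} (mu : {measure set T -> \bar R})
    (D : set T) (f : T -> R) : measurable D -> measurable_fun D f ->
  mu D != 0%E -> (forall x, D x -> 0 < f x) -> (0 < \int[mu]_(x in D) (f x)%:E)%E.
Proof.
move=> mD mf muD f0; rewrite lt_def integral_ge0 ?andbT; last first.
  by move=> x Dx; rewrite lee_fin ltW// f0.
apply/eqP => f00.
have [] := ae_eq_integral_abs mu mD (proj2 (measurable_EFinP _ _) mf) => + _.
have -> : (\int[mu]_(x in D) `|(EFin \o f) x| = \int[mu]_(x in D) (f x)%:E)%E.
  by apply: eq_integral => x /set_mem Dx /=; rewrite ger0_norm// ltW// f0.
move=> /(_ f00) [N [mN N0 DN]]; move/negP: muD; apply.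
rewrite eq_le measure_ge0 andbT -N0; apply: le_measure; rewrite ?inE//.
move=> x Dx; apply: DN => /= /(_ Dx)[/eqP].
by rewrite gt_eqF// f0.
Qed.

Section oscillatory_gauss.
Context {R : realType}.
Local Notation leb := (@lebesgue_measure R).
Local Notation I0 := (`[0%R, +oo[%classic : set R).
Local Notation J0 := (`]0%R, +oo[%classic : set R).

Definition osc_gauss (l : R) : R :=
  \int[leb]_(r in I0) ((1 - cos (l * r ^+ 4)) * expR (- r ^+ 2)).

Lemma continuous_osc_gauss_fun l :
  continuous (fun r : R => (1 - cos (l * r ^+ 4)) * expR (- r ^+ 2)).
Proof.
move=> r; apply: cvgM; last exact: continuous_gauss_fun.
apply: cvgB; first exact: cvg_cst.
apply: continuous_comp; last exact: continuous_cos.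
by apply: cvgM; [exact: cvg_cst|exact: exprn_continuous].
Qed.

Lemma onemcos_ge0 (x : R) : 0 <= 1 - cos x.
Proof. by rewrite subr_ge0 cos_le1. Qed.

Lemma onemcos_le2 (x : R) : `|1 - cos x| <= 2.
Proof. by rewrite ger0_norm ?onemcos_ge0//; have := cos_geN1 x; lra. Qed.

Lemma integrable_osc_gauss l :
  leb.-integrable I0 (EFin \o (fun r => (1 - cos (l * r ^+ 4)) * expR (- r ^+ 2))).
Proof.
have cf := @continuous_osc_gauss_fun l.
apply: (@gauss_dominated R _ 2 cf) => r r0.
by rewrite normrM (ger0_norm (expR_ge0 _)) ler_wpM2r ?expR_ge0// onemcos_le2.
Qed.

Lemma fin_osc_gauss l :
  (\int[leb]_(r in I0) ((1 - cos (l * r ^+ 4)) * expR (- r ^+ 2))%:E)%E = (osc_gauss l)%:E.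
Proof.
by rewrite /osc_gauss /Rintegral fineK// integrable_fin_num//; exact: integrable_osc_gauss.
Qed.

Lemma osc_gauss0 : osc_gauss 0 = 0.
Proof.
rewrite /osc_gauss; under eq_Rintegral do rewrite mul0r cos0 subrr mul0r.
by rewrite Rintegral_cst ?mul0r//; exact: measurable_I0.
Qed.

Lemma osc0_onemcos (a l : R) : 0 < a ->
  (\int[leb]_(r in I0) ((1 - cos (l * r ^+ 4)) * expR (- (a * r ^+ 4)))%:E =
   (osc 0 a 0 0 - osc 0 a 0 l)%:E)%E.
Proof.
move=> a0; rewrite /osc -RintegralB//; last 2 first.
- exact: integrable_oscf.
- exact: integrable_oscf.
rewrite /Rintegral fineK.
  by apply: eq_integral => r _; congr EFin; rewrite expr0 !mul1r mul0r addr0 cos0 add0r; ring.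
apply: integrable_fin_num => //; apply: integrable_sub => //; exact: integrable_oscf.
Qed.

(** exp(-r^2) is a mixture of the functions exp(-a r^4). *)
Lemma osc_gauss_mixture l : (osc_gauss l)%:E =
  ((2 / Num.sqrt pi)%:E * \int[leb]_(v in J0)
    (expR (- v ^+ 2) * (osc 0 (4 * v ^+ 2)^-1 0 0 - osc 0 (4 * v ^+ 2)^-1 0 l))%:E)%E /\
  measurable_fun J0 (fun v : R => expR (- v ^+ 2) * (osc 0 (4 * v ^+ 2)^-1 0 0 - osc 0 (4 * v ^+ 2)^-1 0 l)).
Proof.
have sp : 0 < Num.sqrt pi :> R by rewrite sqrtr_gt0 pi_gt0.
pose f (v r : R) := (1 - cos (l * r ^+ 4)) * expR (- v ^+ 2 - (4 * v ^+ 2)^-1 * r ^+ 4).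
have mf : measurable_fun setT (fun p : measurableTypeR R * measurableTypeR R => f p.1 p.2).
  apply: measurable_funM.
    apply: measurable_funB => //; apply: measurableT_comp; first by apply: continuous_measurable_fun; exact: continuous_cos.
    by apply: measurable_funM => //; apply: measurable_funX; exact: measurable_snd.
  apply: measurableT_comp => //; apply: measurable_funB.
    by apply: measurableT_comp => //; apply: measurable_funX; exact: measurable_fst.
  apply: measurable_funM; last by apply: measurable_funX; exact: measurable_snd.
  have -> : (fun x : measurableTypeR R * measurableTypeR R => (4 * x.1 ^+ 2)^-1) = (fun x => (4 * x.1 ^+ 2) `^ (- 1)).
    by apply/funext => x; rewrite powRN powRr1// mulr_ge0// sqr_ge0.
  apply: (measurableT_comp (measurable_powR (-1))).
  by apply: measurable_funM => //; apply: measurable_funX; exact: measurable_fst.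
have f0 v r : 0 <= v -> 0 <= r -> 0 <= f v r.
  by move=> _ _; rewrite mulr_ge0 ?onemcos_ge0 ?expR_ge0.
have mF := measurable_integral_I0 mf f0.
have JI : J0 `<=` I0 by move=> v; rewrite /= !in_itv/= !andbT; exact: ltW.
have mFJ : measurable_fun J0 (fun v => \int[leb]_(r in I0) (f v r)%:E)%E.
  by apply: measurable_funS mF => //; exact: measurable_I0.
have inner (v : R) : 0 < v -> (\int[leb]_(r in I0) (f v r)%:E =
    (expR (- v ^+ 2) * (osc 0 (4 * v ^+ 2)^-1 0 0 - osc 0 (4 * v ^+ 2)^-1 0 l))%:E)%E.
  move=> v0; have a0 : 0 < (4 * v ^+ 2)^-1 by rewrite invr_gt0 mulr_gt0// exprn_gt0.
  rewrite EFinM -osc0_onemcos// -ge0_integralZl//; last first.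
  - apply/measurable_EFinP; apply: measurable_funM.
      apply: measurable_funTS; apply: continuous_measurable_fun => r.
      apply: cvgB; first exact: cvg_cst.
      apply: continuous_comp; last exact: continuous_cos.
      by apply: cvgM; [exact: cvg_cst|exact: exprn_continuous].
    apply: measurable_funTS; apply: continuous_measurable_fun.
    have := @continuous_quartic R 0 (4 * v ^+ 2)^-1.
    by under eq_fun do rewrite expr0 mul1r.
  by apply: eq_integral => r _; rewrite -EFinM /f expRD; congr EFin; ring.
split; last first.
  apply/measurable_EFinP; apply: eq_measurable_fun mFJ => v /set_mem.
  by rewrite /= in_itv/= andbT => v0; rewrite inner.
have outer (r : R) : 0 <= r -> (((1 - cos (l * r ^+ 4)) * expR (- r ^+ 2))%:E =
    (2 / Num.sqrt pi)%:E * \int[leb]_(v in I0) (f v r)%:E)%E.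
  rewrite le_eqVlt => /predU1P[<-|r0].
    under eq_integral do rewrite /f expr0n mulr0 cos0 subrr mul0r.
    by rewrite integral0 mule0 expr0n mulr0 cos0 subrr mul0r.
  have mfr : measurable_fun J0 (fun v => f v r).
    by apply: measurable_funTS; exact: (measurableT_comp mf (measurable_pair2 r)).
  rewrite -integral_J0I0//.
  have b0 : 0 < r ^+ 2 / 2 by rewrite divr_gt0// exprn_gt0.
  have -> : (\int[leb]_(v in J0) (f v r)%:E = (1 - cos (l * r ^+ 4))%:E *
      \int[leb]_(v in J0) (expR (- v ^+ 2 - (r ^+ 2 / 2) ^+ 2 / v ^+ 2))%:E)%E.
    rewrite -ge0_integralZl//; last first.
      apply/measurable_EFinP; apply: open_continuous_measurable_fun; first exact: interval_open.
      move=> v /set_mem; rewrite /= in_itv/= andbT => v0.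
      apply: continuous_comp; last exact: continuous_expR.
      apply: cvgB; first by apply: cvgN; exact: exprn_continuous.
      apply: cvgM; first exact: cvg_cst.
      by apply: cvgV; [rewrite expf_neq0// gt_eqF|exact: exprn_continuous].
    apply: eq_integral => v /set_mem; rewrite /= in_itv/= andbT => v0.
    by rewrite -EFinM /f; congr (_ * expR (_ - _))%:E; field; rewrite gt_eqF.
  rewrite subordination// -!EFinM; congr EFin; rewrite (_ : 2 * (r ^+ 2 / 2) = r ^+ 2); last by field.
  by field; rewrite gt_eqF.
rewrite -fin_osc_gauss.
transitivity (\int[leb]_(r in I0) ((2 / Num.sqrt pi)%:E * \int[leb]_(v in I0) (f v r)%:E))%E.
  by apply: eq_integral => r /set_mem/I0P; exact: outer.
rewrite ge0_integralZl//; last 2 first.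
- have mg : measurable_fun setT (fun p : measurableTypeR R * measurableTypeR R => f p.2 p.1).
    by apply: (measurableT_comp mf (_ : measurable_fun setT (fun p => (p.2, p.1)))); exact: measurable_swap.
  exact: (@measurable_integral_I0 _ (fun r v => f v r) mg (fun r v r0 v0 => f0 v r v0 r0)).
- by move=> r /I0P r0; apply: integral_ge0 => v /I0P v0; rewrite lee_fin f0.
congr (_ * _)%E; rewrite -(tonelli_I0 mf f0) -integral_itv_obnd_cbnd//.
by apply: eq_integral => v /set_mem; rewrite /= in_itv/= andbT; exact: inner.
Qed.

(** In the closed form the power of a^2 + l^2 decreases, and so does the
    cosine, since the angle atan(l / a) / 4 stays below pi / 8. *)
Lemma osc0_decreasing (a l1 l2 : R) : 0 < a -> 0 <= l1 -> l1 < l2 ->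
  osc 0 a 0 l2 < osc 0 a 0 l1.
Proof.
move=> a0 l10 l12.
have M0 : 0 < quartic_moment 0 :> R.
  rewrite lt_def quartic_moment_ge0 andbT; apply/eqP => M00.
  have := @quartic_reflection R; rewrite M00 mul0r => /esym/eqP.
  by rewrite gt_eqF// divr_gt0 ?pi_gt0// mulr_gt0// sqrtr_gt0.
have l20 : 0 < l2 by exact: le_lt_trans l12.
have at1 : 0 <= atan (l1 / a) by rewrite -atan0 le_atan// divr_ge0// ltW.
have at12 : atan (l1 / a) < atan (l2 / a) by rewrite lt_atan// ltr_pM2r ?invr_gt0.
have at2 := atan_ltpi2 (l2 / a).
have pi0 := pi_gt0 R.
have c2 : 0 < cos (1%:R / 4 * atan (l2 / a)).
  by apply: cos_gt0_pihalf; rewrite !mul1r; apply/andP; split; lra.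
rewrite !osc_closed//; apply: (@le_lt_trans _ _ (quartic_moment 0 * (a ^+ 2 + l1 ^+ 2) `^ (- (1%:R / 8)) *
    cos (1%:R / 4 * atan (l2 / a)))).
  apply: ler_wpM2r; first exact: ltW.
  apply: ler_wpM2l; first exact: ltW.
  rewrite !powRN lef_pV2 ?posrE ?powR_gt0//; last 2 first.
  - by rewrite ltr_wpDr ?sqr_ge0// exprn_gt0.
  - by rewrite ltr_wpDr ?sqr_ge0// exprn_gt0.
  rewrite ge0_ler_powR// ?nnegrE ?addr_ge0 ?sqr_ge0// lerD2l ler_pXn2r ?nnegrE// ltW//.
rewrite ltr_pM2l; last by rewrite mulr_gt0// powR_gt0// ltr_wpDr ?sqr_ge0// exprn_gt0.
rewrite ltr_cos ?in_itv//=; lra.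
Qed.

Lemma osc_gauss_increasing (l1 l2 : R) : 0 <= l1 -> l1 < l2 -> osc_gauss l1 < osc_gauss l2.
Proof.
move=> l10 l12.
pose h l (v : R) := expR (- v ^+ 2) * (osc 0 (4 * v ^+ 2)^-1 0 0 - osc 0 (4 * v ^+ 2)^-1 0 l).
have [e1 m1] := osc_gauss_mixture l1; have [e2 m2] := osc_gauss_mixture l2.
have a0 (v : R) : J0 v -> 0 < (4 * v ^+ 2)^-1.
  by rewrite /= in_itv/= andbT => v0; rewrite invr_gt0 mulr_gt0// exprn_gt0.
have dec v : J0 v -> 0 < h l2 v - h l1 v.
  move=> /a0 v0; rewrite -mulrBr mulr_gt0 ?expR_gt0//.
  by have := osc0_decreasing v0 l10 l12; lra.
have h0 v : J0 v -> 0 <= h l1 v.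
  move=> /a0 v0; rewrite mulr_ge0 ?expR_ge0// subr_ge0.
  move: l10; rewrite le_eqVlt => /predU1P[<-//|l10].
  by apply: ltW; exact: osc0_decreasing.
rewrite -lte_fin e1 e2 -[X in (_ < _ * X)%E]/(\int[leb]_(v in J0) (h l2 v)%:E)%E.
have -> : (\int[leb]_(v in J0) (h l2 v)%:E =
   \int[leb]_(v in J0) (h l1 v)%:E + \int[leb]_(v in J0) (h l2 v - h l1 v)%:E)%E.
  rewrite -ge0_integralD//; last 3 first.
  - exact/measurable_EFinP.
  - by move=> v /dec; rewrite lee_fin; exact: ltW.
  - by apply/measurable_EFinP; exact: measurable_funB.
  by apply: eq_integral => v _; rewrite -EFinD addrC subrK.
have c0 : (0 < (2 / Num.sqrt pi : R)%:E)%E by rewrite lte_fin divr_gt0// sqrtr_gt0 pi_gt0.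
rewrite lte_pmul2l// lteDl.
  apply: integral_gt0 => //; first exact: measurable_funB.
  by apply/eqP => J00; have := @lebesgue_measure_itv R `]0, +oo[; rewrite J00 /= ltry.
have : (osc_gauss l1)%:E \is a fin_num by [].
rewrite e1; case: (\int[leb]_(v in J0) _)%E => // .
  by rewrite gt0_muley.
by rewrite gt0_muleNy.
Qed.

Lemma cvg_osc_gauss0 (u : nat -> R) : u n @[n --> \oo] --> 0 -> osc_gauss (u n) @[n --> \oo] --> 0.
Proof.
move=> u0; rewrite -[X in _ --> X]osc_gauss0.
apply: (@dominated_cvg_Rintegral _ _ _ leb I0 _ _ (fun r => 2 * gauss_fun r) (measurable_I0 (R:=R)) _ _ _ _).2.
- by move=> n; apply: measurable_funTS; apply: continuous_measurable_fun; exact: continuous_osc_gauss_fun.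
- move=> r _; apply: cvgM; last exact: cvg_cst.
  apply: cvgB; first exact: cvg_cst.
  apply: continuous_cvg; first exact: continuous_cos.
  by apply: cvgM => //; exact: cvg_cst.
- apply: integrable_mull => //.
  by apply: integrableS integrableT_gauss => //; exact: measurable_I0.
- by move=> n r _; rewrite normrM (ger0_norm (expR_ge0 _)) ler_wpM2r ?expR_ge0// onemcos_le2.
Qed.

End oscillatory_gauss.

(** * Power series: Kummer's transformation of the Bessel functions *)

Section kummer.
Context {R : realType}.

Lemma series_normr_le (f g : nat -> R) m n : (forall k, `|f k| <= g k) -> (m <= n)%N ->
  `|series f n - series f m| <= series g n - series g m.
Proof.
move=> fg mn; rewrite !sub_series_geq//.
by apply: le_trans (ler_norm_sum _ _ _) _; apply: ler_sum => k _; exact: fg.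
Qed.

Lemma cvg_series_normr_le (f g : nat -> R) (s : R) m : (forall k, `|f k| <= g k) ->
  cvgn (series g) -> series f n @[n --> \oo] --> s ->
  `|s - series f m| <= limn (series g) - series g m.
Proof.
move=> fg cg fs.
have g0 k : 0 <= g k by exact: le_trans (fg k).
have c1 : `|series f n - series f m| @[n --> \oo] --> `|s - series f m|.
  by apply: cvg_norm; apply: cvgB => //; exact: cvg_cst.
apply: (ler_cvg_to c1 (cvg_cst (limn (series g) - series g m))).
near=> n; apply: le_trans (series_normr_le (m := m) (n := n) fg _) _.
  by near: n; exact: nbhs_infty_ge.
rewrite lerD2r; apply: nondecreasing_cvgn_le => //.
by apply/nondecreasing_seqP => k; rewrite seriesSr lerDl.
Unshelve. all: by end_near. Qed.

Lemma cvg_seriesMl (u : nat -> R) (k l : R) : series u n @[n --> \oo] --> l ->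
  series (fun n => k * u n) n @[n --> \oo] --> k * l.
Proof.
move=> ul; have -> : series (fun n => k * u n) = (fun n => k * series u n).
  by apply/funext => n; rewrite /series /= big_distrr.
by apply: cvgM => //; exact: cvg_cst.
Qed.

(** Dominated convergence for series. *)
Lemma tannery (f : nat -> nat -> R) (h g : nat -> R) (S : nat -> R) : cvgn (series g) ->
  (forall n k, `|f n k| <= g k) -> (forall k, f n k @[n --> \oo] --> h k) ->
  (forall n, series (f n) m @[m --> \oo] --> S n) ->
  cvgn (series h) /\ S n @[n --> \oo] --> limn (series h).
Proof.
move=> cg fg fh fS.
have hg k : `|h k| <= g k.
  by apply: (ler_cvg_to (cvg_norm (fh k)) (cvg_cst (g k))); exact: nearW.
have ch : cvgn (series h).
  apply: normed_cvg; apply: (series_le_cvg _ _ hg cg) => k; first exact: normr_ge0.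
  exact: le_trans (hg k).
split => //; apply/cvgrPdist_lt => e e0.
have [N _ hN] : \forall N \near \oo, limn (series g) - series g N < e / 3.
  move/cvgrPdist_lt : cg => /(_ (e / 3)); rewrite divr_gt0// => /(_ isT).
  by apply: filterS => N; exact: le_lt_trans (ler_norm _).
have /= gN := hN N (leqnn N).
have cN : series (f n) N @[n --> \oo] --> series h N.
  elim: N {hN gN} => [|N IH]; first by rewrite /series /=; under eq_fun do rewrite big_nil; rewrite big_nil; exact: cvg_cst.
  by rewrite seriesSr; under eq_fun do rewrite seriesSr; exact: cvgD.
move/cvgrPdist_lt : cN => /(_ (e / 3)); rewrite divr_gt0// => /(_ isT).
apply: filterS => n h1.
have h2 := cvg_series_normr_le N (fg n) cg (fS n).
have h3 := cvg_series_normr_le N hg cg ch.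
rewrite (_ : limn (series h) - S n = (limn (series h) - series h N) +
  (series h N - series (f n) N) - (S n - series (f n) N)); last by ring.
apply: le_lt_trans (ler_normB _ _) _; apply: le_lt_trans (lerD (ler_normD _ _) h2) _.
by move: h1 h3 gN; set A := `|_|; set B := `|_|; set D := limn _ - _; lra.
Qed.

Lemma cos_add_npihalf (x : R) n : cos (x + n%:R * (pi / 2)) =
  cos x * ((~~ odd n)%:R * (-1) ^+ n./2) - sin x * ((odd n)%:R * (-1) ^+ n.-1./2).
Proof.
elim/ltn_ind: n => -[|[|n]] IH.
- by rewrite mul0r addr0 /= expr0 mul0r mulr0 subr0 !mulr1.
- by rewrite mul1r cosDpihalf /= expr0 mul0r mulr0 sub0r !mulr1.
have -> : x + n.+2%:R * (pi / 2) = (x + n%:R * (pi / 2)) + pi.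
  by rewrite -(addn2 n) natrD mulrDl; lra.
rewrite cosDpi IH// /= negbK.
case: n IH => [|n] _ /=; first by rewrite expr0 expr1; ring.
by rewrite !negbK !exprS; move: ((-1) ^+ _) ((-1) ^+ _) => u v; ring.
Qed.

Lemma cvg_series_cosD (phi z : R) :
  series (fun p => z ^+ p / p`!%:R * cos (phi + p%:R * (pi / 2))) n @[n --> \oo] --> cos (phi + z).
Proof.
rewrite cosD; have -> : (fun p => z ^+ p / p`!%:R * cos (phi + p%:R * (pi / 2))) =
    cos phi *: cos_coeff z + (- sin phi) *: sin_coeff z.
  apply/funext => p; rewrite cos_add_npihalf /cos_coeff /sin_coeff /= !fctE /GRing.scale /=.
  rewrite -exprnP; move: (_^-1) ((-1) ^+ _) ((-1) ^+ _) ((~~ odd p)%:R) ((odd p)%:R) => F u v x y.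
  by ring.
rewrite seriesD !seriesZ; apply: cvgD.
  by apply: cvgZr; rewrite unlock; exact: is_cvg_series_cos_coeff.
by rewrite -mulNr; apply: cvgZr; rewrite unlock; exact: is_cvg_series_sin_coeff.
Qed.

Variable a : R.
Hypothesis a0 : 0 < a.

(** The sum of b_j z^(2j) is the modified Bessel function of order a - 1/2,
    divided by its leading term. *)
Fixpoint bessel_coeff (j : nat) : R :=
  if j is j'.+1 then bessel_coeff j' / ((2 * j'%:R + 2) * (2 * j'%:R + 1 + 2 * a)) else 1.
Arguments bessel_coeff : simpl never.
Local Notation b := bessel_coeff.

(** 1 / (m - n)!, with the value 0 that 1 / Gamma takes at its poles, so that
    the recurrence holds for all m and n. *)
Definition ifac (m n : nat) : R := if (n <= m)%N then (m - n)`!%:R^-1 else 0.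

Lemma ifacSS m n : ifac m.+1 n.+1 = ifac m n.
Proof. by rewrite /ifac ltnS subSS. Qed.

Lemma mul_ifac m n : (m%:R + 1 - n%:R) * ifac m.+1 n = ifac m n.
Proof.
rewrite /ifac; case: (ltngtP n m.+1) => [nm|nm|->].
- rewrite ltnS in nm; rewrite nm subSn// factS natrM -natr1 natrB//.
  have : (m%:R - n%:R + 1 : R) != 0 by rewrite -natrB// natr1 pnatr_eq0.
  have : ((m - n)`!%:R : R) != 0 by rewrite pnatr_eq0 -lt0n fact_gt0.
  by rewrite (addrAC m%:R) => h1 h2; rewrite invfM mulrA mulfV// mul1r.
- by rewrite mulr0 leqNgt (ltn_trans _ nm).
- by rewrite ltnn -natr1 subrr mul0r.
Qed.

Lemma bessel_den_gt0 j : 0 < (2 * j%:R + 2) * (2 * j%:R + 1 + 2 * a).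
Proof.
have x0 : 0 <= (j%:R : R) by [].
have a1 : 0 < a by exact: a0.
by apply: mulr_gt0; move: (j%:R : R) x0 => x x0; lra.
Qed.

Lemma bessel_coeffS j : b j.+1 * ((2 * j%:R + 2) * (2 * j%:R + 1 + 2 * a)) = b j.
Proof. by rewrite /bessel_coeff -/bessel_coeff divfK// gt_eqF// bessel_den_gt0. Qed.

Lemma bessel_coeff_gt0 j : 0 < b j.
Proof.
by elim: j => // j IH; rewrite /bessel_coeff -/bessel_coeff divr_gt0// bessel_den_gt0.
Qed.

(** The coefficients of exp(z) sum_j b_j z^(2j). *)
Definition kummer_coeff (m : nat) : R := \sum_(0 <= j < m.+1) b j * ifac m (2 * j).
Local Notation c := kummer_coeff.

Lemma kummer_coeff_pad m N : (m < N)%N -> c m = \sum_(0 <= j < N) b j * ifac m (2 * j).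
Proof.
move=> mN; rewrite (big_cat_nat (n := m.+1))//=.
have -> : \sum_(m.+1 <= j < N) b j * ifac m (2 * j) = 0; last by rewrite addr0.
rewrite big_nat_cond big1// => j /andP[/andP[mj _] _].
rewrite /ifac leqNgt (_ : (m < 2 * j)%N) ?mulr0//.
by rewrite (leq_trans mj)// leq_pmull.
Qed.

(** The recursion of the coefficients of 1F1(a; 2a; 2z): this is Kummer's
    identity. It follows from the recursion of b_j by comparing the terms with
    shifted index. *)
Lemma kummer_coeffS m :
  (m%:R + 1) * (m%:R + 2 * a) * c m.+1 = 2 * (m%:R + a) * c m.
Proof.
apply/eqP; rewrite -subr_eq0; apply/eqP.
rewrite (@kummer_coeff_pad m m.+2)// /c !big_distrr/= -sumrB.
transitivity (\sum_(0 <= j < m.+2) (b j * ((2 * j)%:R * ((2 * j)%:R + 2 * a - 1)) * ifac m.+1 (2 * j) -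
   b j * ifac m.+1 (2 * j).+2)).
  apply: eq_bigr => j _.
  have -> : ifac m.+1 (2 * j).+2 = (m%:R - (2 * j)%:R) * ifac m (2 * j).
    case: (m) => [|k]; last by rewrite !ifacSS -mul_ifac -natr1.
    rewrite /ifac /=; case: j => [|j]; first by rewrite muln0 subr0 mul0r.
    by rewrite mulr0.
  by rewrite -(mul_ifac m (2 * j)); ring.
rewrite sumrB big_nat_recl// muln0 mul0r mulr0 mul0r add0r.
rewrite [X in _ - X]big_nat_recr//= [X in _ - (_ + X)](_ : _ = 0); last first.
  rewrite /ifac leqNgt ltnS (_ : (m < (2 * m.+1).+1)%N) ?mulr0//.
  by rewrite ltnS (leq_trans (leqnSn m))// leq_pmull.
rewrite addr0 -sumrB big1// => j _.
have <- : (2 * j).+2 = (2 * j.+1)%N by rewrite mulnS.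
rewrite -(bessel_coeffS j) -mulrBl (_ : _ - _ = 0) ?mul0r//.
have -> : (2 * j).+2%:R = 2 * j%:R + 2 :> R by rewrite -addn2 natrD natrM.
by ring.
Qed.

Lemma abs_bessel_series (z : R) : cvgn (series (fun j => b j * (z ^+ 2) ^+ j)).
Proof.
have z20 := sqr_ge0 z.
apply: (@series_le_cvg _ _ (exp_coeff (z ^+ 2))) => [j|j|j|].
- by rewrite mulr_ge0 ?(exprn_ge0 _ z20)//; exact: ltW (bessel_coeff_gt0 j).
- by rewrite /exp_coeff /= divr_ge0 ?(exprn_ge0 _ z20).
- rewrite /exp_coeff /= mulrC ler_wpM2l ?(exprn_ge0 _ z20)//.
  elim: j => [|j IH]; first by rewrite fact0 invr1.
  have d0 := bessel_den_gt0 j.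
  rewrite factS natrM invfM [leRHS]mulrC /bessel_coeff -/bessel_coeff; apply: ler_pM => //.
  - exact: ltW (bessel_coeff_gt0 j).
  - by rewrite invr_ge0 ltW.
  - rewrite lef_pV2 ?posrE ?ltr0n// -natr1.
    have a1 : 0 < a by exact: a0.
    by have : 0 <= j%:R :> R by []; move: (j%:R : R) => x x0; nra.
- exact: is_cvg_series_exp_coeff.
Qed.

Section kummer_product.
Variables phi z : R.
Local Notation A := (fun j : nat => (-1) ^+ j * b j * (z ^+ 2) ^+ j).
Local Notation G := (series (fun p => z ^+ p / p`!%:R * cos (phi + p%:R * (pi / 2)))).

Lemma normr_bessel_term j : `|A j| = b j * (z ^+ 2) ^+ j.
Proof.
rewrite !normrM normrX normrN1 expr1n mul1r (ger0_norm (ltW (bessel_coeff_gt0 j))).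
by rewrite ger0_norm// exprn_ge0// sqr_ge0.
Qed.

Lemma cvg_bessel_series : cvgn (series A).
Proof.
apply: normed_cvg; rewrite (_ : [normed series A] = series (fun j => b j * (z ^+ 2) ^+ j)).
  exact: abs_bessel_series.
by congr series; apply/funext => j; exact: normr_bessel_term.
Qed.

Lemma kummer_partial n :
  \sum_(0 <= m < n) c m * z ^+ m * cos (phi + m%:R * (pi / 2)) =
  \sum_(0 <= j < n) A j * G (n - 2 * j)%N.
Proof.
transitivity (\sum_(0 <= j < n) \sum_(0 <= m < n)
    b j * ifac m (2 * j) * z ^+ m * cos (phi + m%:R * (pi / 2))).
  rewrite exchange_big /=; apply: eq_big_nat => m /andP[_ mn].
  by rewrite (kummer_coeff_pad mn) mulr_suml mulr_suml.
apply: eq_bigr => j _; rewrite /series /= big_distrr /=.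
have [jn|jn] := leqP (2 * j) n; last first.
  rewrite (eqP (ltnW jn : n - 2 * j == 0)%N) [RHS]big_geq// big_nat_cond big1//.
  move=> m /andP[/andP[_ mn] _]; rewrite /ifac leqNgt (ltn_trans mn jn) /=.
  by rewrite mulr0 !mul0r.
rewrite (big_cat_nat (n := (2 * j)%N))//=.
have -> : \sum_(0 <= m < 2 * j) b j * ifac m (2 * j) * z ^+ m * cos (phi + m%:R * (pi / 2)) = 0.
  rewrite big_nat_cond big1// => m /andP[/andP[_ mn] _].
  by rewrite /ifac leqNgt mn /= mulr0 !mul0r.
rewrite add0r -{1}(add0n (2 * j)%N) big_addn; apply: eq_bigr => p _.
rewrite /ifac leq_addl addnK.
have -> : phi + (p + 2 * j)%:R * (pi / 2) = (phi + p%:R * (pi / 2)) + j%:R * pi.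
  by rewrite natrD natrM; field.
have -> (x : R) : cos (x + j%:R * pi) = (-1) ^+ j * cos x.
  elim: j {jn} => [|j IH]; first by rewrite mul0r addr0 expr0 mul1r.
  by rewrite -natr1 mulrDl mul1r addrA cosDpi IH exprS mulN1r mulNr.
rewrite exprD exprM; move: (_^-1) (cos _) ((-1) ^+ _) => F u v.
by ring.
Qed.

(** Cauchy product with the series of cos(phi + z). *)
Lemma kummer_product :
  series (fun m => c m * z ^+ m * cos (phi + m%:R * (pi / 2))) n @[n --> \oo] -->
  limn (series A) * cos (phi + z).
Proof.
have cG := @cvg_series_cosD phi z.
have [B GB] : exists B : R, forall n, `|G n| <= B.
  have [B [_ hB]] := cvg_seq_bounded (cvgP _ cG).
  by exists (B + 1) => n; apply: hB => //; rewrite ltrDl.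
pose f n j := if (j < n)%N then A j * G (n - 2 * j)%N else 0.
have cg : cvgn (series (fun j => `|B| * (b j * (z ^+ 2) ^+ j))).
  by have h := @cvg_seriesMl _ `|B| _ (@abs_bessel_series z); apply: cvgP h.
have fg n k : `|f n k| <= `|B| * (b k * (z ^+ 2) ^+ k).
  rewrite /f; case: ifP => _; last first.
    by rewrite normr0 -normr_bessel_term mulr_ge0.
  rewrite normrM normr_bessel_term mulrC; apply: ler_wpM2r.
    by rewrite -normr_bessel_term.
  exact: le_trans (GB _) (ler_norm _).
have fh k : f n k @[n --> \oo] --> A k * cos (phi + z).
  have h : A k * G (n - 2 * k)%N @[n --> \oo] --> A k * cos (phi + z).
    apply: cvgM; first exact: cvg_cst.
    apply: (cvg_comp _ _ _ cG); apply: cvg_subnr.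
  apply: cvg_trans h; apply: near_eq_cvg; near=> n.
  by rewrite /f ifT//; near: n; exact: nbhs_infty_gt.
have fS n : series (f n) m @[m --> \oo] --> \sum_(0 <= j < n) A j * G (n - 2 * j)%N.
  apply: cvg_near_cst; near=> m.
  rewrite {1}/series /= (big_cat_nat (n := n))//=; last by near: m; exact: nbhs_infty_ge.
  have -> : \sum_(n <= j < m) f n j = 0.
    by rewrite big_nat_cond big1// => j /andP[/andP[nj _] _]; rewrite /f ltnNge nj.
  by rewrite addr0; apply: eq_big_nat => j /andP[_ jn]; rewrite /f jn.
have [_ h] := tannery cg fg fh fS.
have E : limn (series (fun k => A k * cos (phi + z))) = limn (series A) * cos (phi + z).
  apply: cvg_lim => //; rewrite mulrC; under eq_fun do rewrite mulrC.
  exact: cvg_seriesMl cvg_bessel_series.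
rewrite -E; apply: cvg_trans h; apply: near_eq_cvg; apply: nearW => n.
by rewrite -kummer_partial.
Unshelve. all: by end_near. Qed.

End kummer_product.

End kummer.

(** * Expansion of the oscillatory Gaussian integral *)

Section gauss_cos.
Context {R : realType}.
Local Notation leb := (@lebesgue_measure R).
Local Notation I0 := (`[0%R, +oo[%classic : set R).
Local Notation M := quartic_moment.

Lemma normr_exp_series_le (x : R) n : `|series (exp_coeff x) n| <= expR `|x|.
Proof.
apply: (@le_trans _ _ (series (exp_coeff `|x|) n)).
  apply: le_trans (ler_norm_sum _ _ _) _; apply: ler_sum => k _.
  by rewrite /exp_coeff /= normrM normrX normfV normr_nat.
apply: nondecreasing_cvgn_le; last exact: is_cvg_series_exp_coeff.
by apply/nondecreasing_seqP => k; rewrite seriesSr lerDl /exp_coeff /= divr_ge0 ?exprn_ge0.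
Qed.

Lemma cvg_exp_series (x : R) : series (exp_coeff x) n @[n --> \oo] --> expR x.
Proof. exact: is_cvg_series_exp_coeff. Qed.

Let exp_oscf s n a l (r : R) := series (exp_coeff (s * r ^+ 2)) n *
  (expR (- (a * r ^+ 4)) * cos (0 + l * r ^+ 4)).

Lemma exp_osc (s : R) n a l : 0 < a -> leb.-integrable I0 (EFin \o exp_oscf s n a l) /\
  \int[leb]_(r in I0) exp_oscf s n a l r =
  series (fun k => s ^+ k / k`!%:R * osc (2 * k) a 0 l) n.
Proof.
move=> a0; have mI := @measurable_I0 R.
elim: n => [|n [IH1 IH2]].
  have E : exp_oscf s 0 a l = cst 0.
    by apply/funext => r; rewrite /exp_oscf /series /= big_nil mul0r.
  rewrite E /series /= big_nil; split; first exact: integrable0.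
  by rewrite Rintegral_cst// mul0r.
pose g (r : R) := s ^+ n / n`!%:R * (r ^+ (2 * n) * expR (- (a * r ^+ 4)) * cos (0 + l * r ^+ 4)).
have ig : leb.-integrable I0 (EFin \o g) by apply: integrable_mull => //; exact: integrable_oscf.
have E : exp_oscf s n.+1 a l = (fun r => exp_oscf s n a l r + g r).
  apply/funext => r; rewrite /exp_oscf seriesSr mulrDl; congr (_ + _).
  by rewrite /exp_coeff /= /g exprMn exprM; ring.
rewrite E; split; first exact: integrable_add.
by rewrite RintegralD// IH2 seriesSr RintegralZl//; exact: integrable_oscf.
Qed.

(** The partial sums are dominated by exp(r^2 - a r^4). *)
Lemma cvg_exp_osc (s a l : R) : `|s| <= 1 -> 0 < a ->
  series (fun k => s ^+ k / k`!%:R * osc (2 * k) a 0 l) n @[n --> \oo] -->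
  \int[leb]_(r in I0) (expR (s * r ^+ 2) * (expR (- (a * r ^+ 4)) * cos (0 + l * r ^+ 4))).
Proof.
move=> s1 a0.
have c1 (r : R) : {for r, continuous (fun r : R => expR (1 * r ^+ 2 - a * r ^+ 4))}.
  apply: continuous_comp; last exact: continuous_expR.
  by apply: cvgB; (apply: cvgM; [exact: cvg_cst|exact: exprn_continuous]).
have ig : leb.-integrable I0 (EFin \o (fun r => expR (1 * r ^+ 2 - a * r ^+ 4))).
  apply: (@quartic_integrable R _ 0 1 a a0 c1) => r r0.
  by rewrite expr0 [leRHS]mul1r ger0_norm ?expR_ge0.
have e n := (@exp_osc s n a l a0).2.
rewrite (_ : series _ = (fun n => \int[leb]_(r in I0) exp_oscf s n a l r)); last first.
  by apply/funext => n; rewrite e.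
apply: (@dominated_cvg_Rintegral _ _ _ leb I0 _ _ (fun r => expR (1 * r ^+ 2 - a * r ^+ 4)) (measurable_I0 (R:=R)) _ _ _ _).2.
- move=> n; have := (@exp_osc s n a l a0).1 => /measurable_int.
  by move/measurable_EFinP.
- by move=> r _; apply: cvgM; [exact: cvg_exp_series|exact: cvg_cst].
- exact: ig.
- move=> n r _; rewrite normrM expRD mul1r; apply: ler_pM => //.
    apply: le_trans (normr_exp_series_le _ _) _; rewrite ler_expR normrM.
    by rewrite (ger0_norm (sqr_ge0 r)) ler_piMl ?sqr_ge0.
  by rewrite normrM (ger0_norm (expR_ge0 _)) ler_piMr ?expR_ge0// normr_cos_le1.
Qed.

(** In the closed form, (a^2 + l^2) is at least l^2; the bound does not depend
    on a. *)
Lemma osc_le m (a l : R) : 0 < a -> 0 < l -> `|osc m a 0 l| <= osc m l 0 0.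
Proof.
move=> a0 l0; rewrite osc_closed// osc_scaling// normrM.
apply: (@le_trans _ _ (`|M m * (a ^+ 2 + l ^+ 2) `^ (- (m.+1%:R / 8))|)).
  by rewrite ler_piMr// normr_cos_le1.
rewrite ger0_norm ?mulr_ge0 ?quartic_moment_ge0 ?powR_ge0// mulrC.
apply: ler_wpM2r; first exact: quartic_moment_ge0.
have -> : l `^ (- (m.+1%:R / 4)) = (l ^+ 2) `^ (- (m.+1%:R / 8)).
  by rewrite -powR_mulrn ?ltW// -powRrM; congr powR; field.
rewrite !powRN lef_pV2 ?posrE ?powR_gt0 ?exprn_gt0//; last by rewrite ltr_wpDr ?sqr_ge0 ?exprn_gt0.
by rewrite ge0_ler_powR ?nnegrE ?addr_ge0 ?sqr_ge0 ?divr_ge0// lerDr sqr_ge0.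
Qed.

Definition gauss_cos (l : R) : R := \int[leb]_(r in I0) (cos (l * r ^+ 4) * expR (- r ^+ 2)).

Lemma continuous_cos_quartic_gauss l : continuous (fun r : R => cos (l * r ^+ 4) * expR (- r ^+ 2)).
Proof.
move=> r; apply: cvgM; last exact: continuous_gauss_fun.
apply: continuous_comp; last exact: continuous_cos.
by apply: cvgM; [exact: cvg_cst|exact: exprn_continuous].
Qed.

Lemma osc_gaussE l : osc_gauss l = Num.sqrt pi / 2 - gauss_cos l.
Proof.
have mI := @measurable_I0 R.
have -> : Num.sqrt pi / 2 = \int[leb]_(r in I0) (expR (- r ^+ 2)) :> R.
  by rewrite /Rintegral integral0y_gauss.
have cf := @continuous_cos_quartic_gauss l.
rewrite /gauss_cos -RintegralB//; last 2 first.
- by apply: integrableS integrableT_gauss.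
- apply: (@gauss_dominated R _ 1 cf) => r _.
  by rewrite normrM (ger0_norm (expR_ge0 _)) ler_wpM2r ?expR_ge0// normr_cos_le1.
by apply: eq_Rintegral => r _; ring.
Qed.

(** The limit as a tends to 0 of the closed form, where the angle atan(l / a)
    becomes pi / 2. *)
Definition gauss_cos_term l k : R := (- 1) ^+ k / k`!%:R *
  (M (2 * k) * (l ^+ 2) `^ (- ((2 * k).+1%:R / 8)) * cos ((2 * k).+1%:R / 4 * (pi / 2))).

(** Expand exp(-r^2) against exp(-a r^4), integrate termwise and let a tend
    to 0: the bound by the moments of exp(-l r^4) is uniform in a. *)
Lemma cvg_gauss_cos l : 0 < l -> series (gauss_cos_term l) n @[n --> \oo] --> gauss_cos l.
Proof.
move=> l0; pose al n : R := n.+1%:R^-1.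
have al0 n : 0 < al n by rewrite invr_gt0 ltr0n.
have nS : (n.+1%:R : R) @[n --> \oo] --> +oo.
  by have := @cvgr_idn R; rewrite -(cvg_shiftS (fun n => n%:R : R)).
have alc : al n @[n --> \oo] --> (0 : R) by apply/gtr0_cvgV0 => //; exact: nearW.
pose f n k := (-1) ^+ k / k`!%:R * osc (2 * k) (al n) 0 l.
pose g k := 1 ^+ k / k`!%:R * osc (2 * k) l 0 0.
have cg : cvgn (series g).
  by have h := @cvg_exp_osc 1 l 0 _ l0; apply: cvgP; apply: h; rewrite normr1.
have fg n k : `|f n k| <= g k.
  rewrite /f /g !normrM normrX normrN1 normfV normr_nat.
  by apply: ler_wpM2l; [rewrite expr1n divr_ge0|exact: osc_le].
have fh k : f n k @[n --> \oo] --> gauss_cos_term l k.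
  rewrite /f /gauss_cos_term; under eq_fun do rewrite osc_closed//.
  apply: cvgM; first exact: cvg_cst.
  apply: cvgM; last first.
    apply: continuous_cvg; first exact: continuous_cos.
    apply: cvgM; first exact: cvg_cst.
    apply: (cvg_comp (fun n => l / al n) atan _ (@cvgy_atan R)).
    have hy : l / al n @[n --> \oo] --> +oo.
      apply/cvgryPge => A; have /cvgryPge/(_ (l^-1 * A)) := nS.
      by apply: filterS => n; rewrite ler_pdivrMl// /al invrK.
    exact: hy.
  apply: cvgM; first exact: cvg_cst.
  have l20 : 0 < l ^+ 2 by rewrite exprn_gt0.
  have dp := is_derive1_powR (- ((2 * k).+1%:R / 8)) l20.
  have cp : {for l ^+ 2, continuous (fun x : R => x `^ (- ((2 * k).+1%:R / 8)))}.
    by apply: differentiable_continuous; apply/derivable1_diffP; exact: (@ex_derive _ _ _ _ _ _ _ dp).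
  apply: (continuous_cvg _ cp); rewrite -[X in _ --> X]add0r; apply: cvgD; last exact: cvg_cst.
  by rewrite -[X in _ --> X](mul0r (0 : R)); under eq_fun do rewrite expr2; exact: cvgM.
have N1 : `|-1 : R| <= 1 by rewrite normrN1.
have fS n := @cvg_exp_osc (-1) (al n) l N1 (al0 n).
have [ch hS] := tannery cg fg fh fS.
rewrite -(cvg_unique _ hS (_ : _ --> gauss_cos l))//.
apply: (@dominated_cvg_Rintegral _ _ _ leb I0 _ _ gauss_fun (measurable_I0 (R:=R)) _ _ _ _).2.
- move=> n; apply: measurable_funTS; apply: continuous_measurable_fun => r.
  apply: cvgM.
    apply: continuous_comp; last exact: continuous_expR.
    by apply: cvgM; [exact: cvg_cst|exact: exprn_continuous].
  by have := @continuous_oscf R 0 (al n) 0 l; under eq_fun do rewrite expr0 mul1r; apply.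
- move=> r _; rewrite [X in _ --> X]mulrC mulN1r; apply: cvgM; first exact: cvg_cst.
  rewrite -[X in _ --> X]mul1r add0r; apply: cvgM; last exact: cvg_cst.
  rewrite -(expR0 R); apply: continuous_cvg; first exact: continuous_expR.
  rewrite -oppr0 -(mul0r (r ^+ 4)); apply: cvgN; apply: cvgM => //; exact: cvg_cst.
- by apply: integrableS integrableT_gauss => //; exact: measurable_I0.
- move=> n r _; rewrite normrM (ger0_norm (expR_ge0 _)) mulN1r ler_piMr ?expR_ge0//.
  rewrite normrM mulr_ile1 ?normr_cos_le1// ger0_norm ?expR_ge0// -[leRHS](expR0 R) ler_expR.
  by rewrite oppr_le0 mulr_ge0 ?(ltW (al0 n))// exprn_even_ge0.
Qed.

(** For l >= 1 every term of the series is at most l^(-1/4) times a term of a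
    convergent series that does not depend on l. *)
Lemma gauss_cos_decay : exists K : R, forall l, 1 <= l -> `|gauss_cos l| <= (l ^+ 2) `^ (- 8^-1) * K.
Proof.
pose g k := 1 ^+ k / k`!%:R * osc (2 * k) 1 0 0 : R.
have N1 : `|1 : R| <= 1 by rewrite normr1.
have h := @cvg_exp_osc 1 1 0 N1 ltr01; rewrite -[series _]/(series g) in h.
set K := (X in _ --> X) in h; exists K => l l1.
have l0 : 0 < l by exact: lt_le_trans l1.
have l20 : 0 < l ^+ 2 by rewrite exprn_gt0.
have lg k : `|gauss_cos_term l k| <= (l ^+ 2) `^ (- 8^-1) * g k.
  rewrite /gauss_cos_term /g !normrM normrX normrN1 normfV normr_nat -quartic_momentE [leRHS]mulrCA.
  apply: ler_wpM2l; first by rewrite expr1n divr_ge0.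
  rewrite -[leRHS]mulr1; apply: ler_pM => //; last exact: normr_cos_le1.
  rewrite ger0_norm ?quartic_moment_ge0// mulrC; apply: ler_wpM2r; first exact: quartic_moment_ge0.
  rewrite ger0_norm ?powR_ge0// ler_powR ?exprn_ege1//.
  by rewrite lerN2 mulrC -[leLHS]mulr1 ler_wpM2l// ler1n.
have h2 := @cvg_seriesMl R _ ((l ^+ 2) `^ (- 8^-1)) _ h.
have := @cvg_series_normr_le R _ _ _ 0 lg (cvgP _ h2) (cvg_gauss_cos l0).
by rewrite /series /= !big_nil !subr0 (cvg_lim _ h2).
Qed.

Lemma cvg_gauss_cosy : gauss_cos l @[l --> +oo] --> 0.
Proof.
have [K hK] := gauss_cos_decay; apply/cvgrPdist_lt => e e0.
pose A := `|K| / e + 1.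
have A1 : 1 <= A by rewrite lerDr divr_ge0// ltW.
near=> l; rewrite sub0r normrN.
have l1 : 1 <= l by near: l; apply: nbhs_pinfty_ge; rewrite num_real.
have lA : A ^+ 4 <= l by near: l; apply: nbhs_pinfty_ge; rewrite num_real.
have A0 : 0 < A by exact: lt_le_trans A1.
have q0 : 0 <= (l ^+ 2) `^ (- 8^-1) by exact: powR_ge0.
apply: le_lt_trans (hK l l1) _; apply: (@le_lt_trans _ _ ((l ^+ 2) `^ (- 8^-1) * `|K|)).
  by apply: ler_wpM2l => //; exact: ler_norm.
apply: (@le_lt_trans _ _ (A^-1 * `|K|)).
  have l0 : 0 < l by exact: lt_le_trans l1.
  apply: ler_wpM2r => //; rewrite powRN lef_pV2 ?posrE ?powR_gt0 ?exprn_gt0//.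
  apply: (@le_trans _ _ (((A ^+ 4) ^+ 2) `^ 8^-1)).
    by have A00 := ltW A0; rewrite -exprM -powR_mulrn// -powRrM mulfV ?powRr1// pnatr_eq0.
  rewrite ge0_ler_powR ?nnegrE ?sqr_ge0//.
  by rewrite ler_pXn2r ?nnegrE// ?exprn_ge0// ltW.
rewrite mulrC ltr_pdivrMr// /A mulrDr mulr1 mulrCA mulfV ?gt_eqF// mulr1 ltrDl.
exact: e0.
Unshelve. all: by end_near. Qed.

End gauss_cos.

(** * The formula with Bessel functions *)

Section bessel_formula.
Context {R : realType}.
Local Notation leb := (@lebesgue_measure R).
Local Notation M := (@quartic_moment R).

(** The right-hand side does not depend on j: the recursion of b_j inverts
    that of the quartic moments. *)
Lemma bessel_coeff_moment (m0 : nat) (a : R) j : (0 < m0)%N -> 2 * a = (m0%:R - 1) / 2 -> 0 < a ->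
  M m0 = bessel_coeff a j * 4 ^+ j * j`!%:R * M (4 * j + m0).
Proof.
move=> m00 aE a0; elim: j => [|j IH].
  by rewrite muln0 add0n fact0 expr0 /bessel_coeff !mul1r.
rewrite {1}IH -(bessel_coeffS a0 j) aE exprS factS natrM.
rewrite (_ : 4 * j.+1 + m0 = 4 * j + m0 + 4)%N; last by rewrite mulnS; lia.
have := @quartic_momentS R (4 * j + m0); rewrite -[(4 * j + m0).+1]addn1 natrD natrD natrM.
have -> : j.+1%:R = j%:R + 1 :> R by rewrite -natr1.
move: (M (4 * j + m0)) (M (4 * j + m0 + 4)) (bessel_coeff a j.+1) (j`!%:R) (4 ^+ j) (j%:R) (m0%:R)
  => A B C D E F G h.
transitivity (C * (F + 1) * E * D * ((4 * F + G + 1) * A)); first by field.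
by rewrite h; ring.
Qed.

(** Rewrite Gamma at multiples of 1/4 as quartic moments. *)
Lemma besselJ_series (m0 : nat) (a nu z : R) : (0 < m0)%N -> 2 * a = (m0%:R - 1) / 2 -> 0 < a ->
  nu = (m0%:R + 1) / 4 - 1 -> 0 < M m0 -> 0 < z ->
  4 * M m0 * besselJ nu z =
  (z / 2) `^ nu * limn (series (fun j => (-1) ^+ j * bessel_coeff a j * (z ^+ 2) ^+ j)).
Proof.
move=> m00 aE a0 nuE M0 z0.
have h := @cvg_seriesMl R _ ((z / 2) `^ nu / (4 * M m0)) _ (@cvg_bessel_series R a a0 z).
rewrite /besselJ.
have -> : (fun m : nat => (-1) ^+ m / (m`!%:R * Gamma (m%:R + nu + 1)) * (z / 2) `^ (2 * m%:R + nu)) =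
  (fun j => (z / 2) `^ nu / (4 * M m0) * ((-1) ^+ j * bessel_coeff a j * (z ^+ 2) ^+ j)).
  apply/funext => j.
  have -> : j%:R + nu + 1 = (4 * j + m0).+1%:R / 4.
    by rewrite nuE -[(4 * j + m0).+1]addn1 natrD natrD natrM; field.
  rewrite Gamma_quartic; have E := bessel_coeff_moment j m00 aE a0.
  have z20 : 0 < z / 2 by rewrite divr_gt0.
  rewrite powRD; last by rewrite (gt_eqF z20) implybT.
  have -> : (z / 2) `^ (2 * j%:R) = (z ^+ 2) ^+ j / 4 ^+ j.
    by rewrite -natrM powR_mulrn ?ltW// exprM -exprVn -exprMn; congr (_ ^+ j); field.
  have N1 : 4 ^+ j != 0 :> R by rewrite expf_neq0.
  have N2 : j`!%:R != 0 :> R by rewrite pnatr_eq0 -lt0n fact_gt0.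
  have N3 : M (4 * j + m0) != 0.
    by apply/eqP => h0; move: M0; rewrite E h0 mulr0 ltxx.
  have N4 : bessel_coeff a j != 0 by rewrite gt_eqF// bessel_coeff_gt0.
  rewrite E; move: (M _) (bessel_coeff a j) (j`!%:R) (4 ^+ j) ((z ^+ 2) ^+ j) ((-1) ^+ j) N1 N2 N3 N4.
  by move=> *; field; apply/and4P.
rewrite (cvg_lim _ h)//; field.
by rewrite gt_eqF.
Qed.

(** Both sides satisfy the same recursion in m; p = 0 and p = 1 are the even
    and the odd terms of the series. *)
Lemma kummer_moment (p : nat) (a : R) m : (p <= 1)%N -> a = 4^-1 + p%:R / 2 ->
  M (4 * m + 2 * p) / (2 * m + p)`!%:R = M (2 * p) * kummer_coeff a m * 8^-1 ^+ m.
Proof.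
move=> p1 aE; have a0 : 0 < a by rewrite aE ltr_wpDr ?divr_ge0.
elim: m => [|m IH].
  rewrite muln0 add0n expr0 mulr1 /kummer_coeff big_nat1 /ifac /bessel_coeff muln0 add0n subn0 !mul1r.
  by rewrite fact0 invr1 mulr1; case: p p1 {aE} => [|[|//]] _; rewrite ?fact0 invr1 mulr1.
have m0 : 0 <= m%:R :> R by [].
have K := kummer_coeffS a0 m.
have S : (4 * m%:R + 2 * p%:R + 1) * M (4 * m + 2 * p) = 4 * M (4 * m + 2 * p + 4).
  by rewrite -quartic_momentS -[(4 * m + 2 * p).+1]addn1 natrD natrD natrM natrM.
rewrite (_ : 4 * m.+1 + 2 * p = 4 * m + 2 * p + 4)%N; last by rewrite mulnS; lia.
rewrite (_ : 2 * m.+1 + p = (2 * m + p).+2)%N; last by rewrite mulnS.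
rewrite factS factS natrM natrM.
have -> : (2 * m + p).+2%:R = 2 * m%:R + p%:R + 2 :> R by rewrite -addn2 natrD natrD natrM.
have -> : (2 * m + p).+1%:R = 2 * m%:R + p%:R + 1 :> R by rewrite -addn1 natrD natrD natrM.
rewrite exprS.
have N2 : (2 * m + p)`!%:R != 0 :> R by rewrite pnatr_eq0 -lt0n fact_gt0.
move: (M (4 * m + 2 * p)) (M (4 * m + 2 * p + 4)) (M (2 * p)) (kummer_coeff a m.+1) (kummer_coeff a m) ((_)`!%:R) (8^-1 ^+ m)
  IH K S N2 => A B C D E F G IH K S N2.
have p01 : (p%:R : R) = 0 \/ (p%:R : R) = 1 by case: p p1 {aE IH S} => [|[|//]] _; [left|right].
have -> : B = (4 * m%:R + 2 * p%:R + 1) * A / 4 by rewrite S; field.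
have -> : A = C * E * G * F by rewrite -IH divfK.
have d0 : 0 < (m%:R + 1) * (m%:R + 2 * a) by rewrite mulr_gt0//; lra.
have -> : D = 2 * (m%:R + a) * E / ((m%:R + 1) * (m%:R + 2 * a)).
  by rewrite -K mulrC mulKf// gt_eqF.
move: m0 p01 aE N2 d0; move: (m%:R) (p%:R) => x y x0 p01 aE N2 d0.
by case: p01 aE d0 => -> -> d0; field; rewrite N2 /=; apply/and3P; split => //; rewrite gt_eqF//; lra.
Qed.

Lemma series_even_odd (u : nat -> R) n :
  series u (2 * n)%N = series (fun m => u (2 * m)%N) n + series (fun m => u (2 * m + 1)%N) n.
Proof.
elim: n => [|n IH]; first by rewrite /series /= muln0 !big_nil addr0.
by rewrite mulnS !seriesSr IH addn1; ring.
Qed.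

(** Split the series into even and odd terms, apply Kummer's identity to each
    with z = 1 / (8 l), and evaluate the constants by the reflection
    formula. *)
Lemma gauss_cos_bessel (l : R) : 0 < l ->
  gauss_cos l = pi / (4 * Num.sqrt 2) * l `^ (- 2^-1) *
   (cos (pi / 8 + (8 * l)^-1) * besselJ (- 4^-1) (8 * l)^-1 -
    cos (3 * pi / 8 + (8 * l)^-1) * besselJ 4^-1 (8 * l)^-1).
Proof.
move=> l0; set z := (8 * l)^-1.
have z0 : 0 < z by rewrite invr_gt0 mulr_gt0.
have lz j : l `^ (- j%:R) = (8 * z) ^+ j.
  by rewrite powRN powR_mulrn ?ltW// /z invfM mulrA mulfV// mul1r exprVn.
have a1 : 0 < 4^-1 :> R by [].
have a3 : 0 < 3 / 4 :> R by [].
have pw (x : R) : (l ^+ 2) `^ (- (x / 8)) = l `^ (- (x / 4)).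
  by rewrite -powR_mulrn ?ltW// -powRrM; congr powR; field.
have lN : l != 0 by rewrite gt_eqF.
have ev m : gauss_cos_term l (2 * m) = M 0 * l `^ (- 4^-1) *
    (kummer_coeff 4^-1 m * z ^+ m * cos (pi / 8 + m%:R * (pi / 2))).
  rewrite /gauss_cos_term exprM sqrrN expr1n expr1n mul1r pw.
  have -> : (2 * (2 * m)).+1%:R / 4 = 4^-1 + m%:R :> R by rewrite -natr1 !natrM; field.
  rewrite (_ : (4^-1 + m%:R) * (pi / 2) = pi / 8 + m%:R * (pi / 2)); last by field.
  rewrite opprD powRD ?lN ?implybT// lz exprMn.
  have := @kummer_moment 0 4^-1 m isT; rewrite mul0r addr0 => /(_ erefl).
  rewrite !muln0 !addn0 (_ : 2 * (2 * m) = 4 * m)%N; last by lia.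
  move: (M (4 * m)) (M 0) (kummer_coeff _ _) (cos _) (z ^+ m) (l `^ _) => A B C D E F h.
  transitivity (A / (2 * m)`!%:R * (F * 8 ^+ m * E * D)); first by ring.
  rewrite h exprVn; have : 8 ^+ m != 0 :> R by rewrite expf_neq0.
  by move: (8 ^+ m) => w wN; field.
have od m : gauss_cos_term l (2 * m + 1) = - (M 2 * l `^ (- (3 / 4))) *
    (kummer_coeff (3 / 4) m * z ^+ m * cos (3 * pi / 8 + m%:R * (pi / 2))).
  rewrite /gauss_cos_term exprD expr1 exprM sqrrN expr1n expr1n mul1r pw.
  have -> : (2 * (2 * m + 1)).+1%:R / 4 = 3 / 4 + m%:R :> R by rewrite -natr1 natrM natrD natrM; field.
  rewrite (_ : (3 / 4 + m%:R) * (pi / 2) = 3 * pi / 8 + m%:R * (pi / 2)); last by field.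
  rewrite opprD powRD ?lN ?implybT// lz exprMn.
  have e1 : 3 / 4 = 4^-1 + 1%:R / 2 :> R by field.
  have := @kummer_moment 1 (3 / 4) m isT e1.
  rewrite !muln1 (_ : 2 * (2 * m + 1) = 4 * m + 2)%N; last by lia.
  move: (M (4 * m + 2)) (M 2) (kummer_coeff _ _) (cos _) (z ^+ m) (l `^ _) => A B C D E F h.
  transitivity (- (A / (2 * m + 1)`!%:R * (F * 8 ^+ m * E * D))); first by ring.
  rewrite h exprVn; have : 8 ^+ m != 0 :> R by rewrite expf_neq0.
  by move: (8 ^+ m) => w wN; field.
have c1 := @cvg_seriesMl R _ (M 0 * l `^ (- 4^-1)) _ (@kummer_product R _ a1 (pi / 8) z).
have c3 := @cvg_seriesMl R _ (- (M 2 * l `^ (- (3 / 4)))) _ (@kummer_product R _ a3 (3 * pi / 8) z).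
have c2 : series (gauss_cos_term l) (2 * n)%N @[n --> \oo] --> gauss_cos l.
  apply: (cvg_comp (fun n => 2 * n)%N (series (gauss_cos_term l)) _ (cvg_gauss_cos l0)).
  apply/cvgnyPge => A; near=> n; rewrite (@leq_trans n)// ?leq_pmull//; near: n; exact: nbhs_infty_ge.

have -> : gauss_cos l = M 0 * l `^ (- 4^-1) *
   (limn (series (fun j => (-1) ^+ j * bessel_coeff 4^-1 j * (z ^+ 2) ^+ j)) * cos (pi / 8 + z)) +
  - (M 2 * l `^ (- (3 / 4))) *
   (limn (series (fun j => (-1) ^+ j * bessel_coeff (3 / 4) j * (z ^+ 2) ^+ j)) * cos (3 * pi / 8 + z)).
  apply: (cvg_unique _ c2) => //; rewrite -(funext ev) in c1; rewrite -(funext od) in c3.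
  have -> : (fun n => series (gauss_cos_term l) (2 * n)%N) =
     (fun n => series (fun m => gauss_cos_term l (2 * m)%N) n +
               series (fun m => gauss_cos_term l (2 * m + 1)%N) n).
    by apply/funext => n; exact: series_even_odd.
  exact: cvgD c1 c3.
have M02 := @quartic_reflection R.
have s2 : 0 < Num.sqrt 2 :> R by rewrite sqrtr_gt0.
have M02N : M 0 * M 2 != 0 by rewrite M02 gt_eqF// divr_gt0 ?pi_gt0// mulr_gt0.
have M0 : 0 < M 0.
  by rewrite lt_def quartic_moment_ge0 andbT; apply: contraNneq M02N => ->; rewrite mul0r.
have M2 : 0 < M 2.
  by rewrite lt_def quartic_moment_ge0 andbT; apply: contraNneq M02N => ->; rewrite mulr0.
have M4 : 4 * M 4 = M 0 by have := @quartic_momentS R 0; rewrite mul1r.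
have J1 : 4 * M 2 * besselJ (- 4^-1) z = (z / 2) `^ (- 4^-1) *
    limn (series (fun j => (-1) ^+ j * bessel_coeff 4^-1 j * (z ^+ 2) ^+ j)).
  by apply: besselJ_series => //; field.
have J3 : 4 * M 4 * besselJ 4^-1 z = (z / 2) `^ 4^-1 *
    limn (series (fun j => (-1) ^+ j * bessel_coeff (3 / 4) j * (z ^+ 2) ^+ j)).
  apply: besselJ_series => //; [by field|by field|].
  by have : 0 < 4 * M 4 by [rewrite M4]; rewrite pmulr_rgt0.
have y0 : 0 < l `^ (- 4^-1) by rewrite powR_gt0.
have z2 : (z / 2) `^ 4^-1 = l `^ (- 4^-1) / 2.
  have -> : z / 2 = l^-1 * 2^-1 `^ 4%:R.
    by rewrite powR_mulrn// /z; field; rewrite lN.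
  rewrite powRM ?powR_ge0 ?invr_ge0 ?(ltW l0)//.
  rewrite -[in X in _ * X]powRrM mulfV ?pnatr_eq0// powRr1//; congr (_ * _).
  by rewrite -[l^-1]powR_inv1 ?(ltW l0)// -powRrM mulN1r.
have z2' : (z / 2) `^ (- 4^-1) = 2 / l `^ (- 4^-1).
  by rewrite powRN z2 invf_div.
rewrite M4 z2 in J3; rewrite z2' in J1.
have -> : l `^ (- 2^-1) = l `^ (- 4^-1) * l `^ (- 4^-1).
  by rewrite -powRD ?lN ?implybT//; congr powR; field.
have -> : l `^ (- (3 / 4)) = l `^ (- 4^-1) * l `^ (- 4^-1) * l `^ (- 4^-1).
  by rewrite -!powRD ?lN ?implybT//; congr powR; field.
have -> : pi / (4 * Num.sqrt 2) = 2 * (M 0 * M 2) by rewrite M02; field; rewrite gt_eqF.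
move: J1 J3; move: (limn _) (limn _) (besselJ _ _) (besselJ _ _) (l `^ _) y0 => L3 L1 j3 j1 y y0 J1 J3.
have yN : y != 0 by rewrite gt_eqF.
have -> : L1 = y / 2 * (4 * M 2 * j1) by rewrite J1; field.
have -> : L3 = 2 / y * (M 0 * j3) by rewrite J3; field.
by field.
Unshelve. all: by end_near. Qed.

Lemma bessel_exprE (C2 eps t : R) : 0 < eps -> 0 < t ->
  bessel_expr C2 eps t = 8 * C2 / Num.sqrt pi * osc_gauss (t * eps ^+ 2).
Proof.
move=> e0 t0; rewrite /bessel_expr gt_eqF// osc_gaussE.
have l0 : 0 < t * eps ^+ 2 by rewrite mulr_gt0// exprn_gt0.
have -> : 8 * t * eps ^+ 2 = 8 * (t * eps ^+ 2) by rewrite mulrA.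
have -> : Num.sqrt t * eps = Num.sqrt (t * eps ^+ 2).
  by rewrite sqrtrM ?ltW// sqrtr_sqr gtr0_norm.
rewrite gauss_cos_bessel//; move: (t * eps ^+ 2) l0 => l l0.
have -> : l `^ (- 2^-1) = (Num.sqrt l)^-1 by rewrite powRN powR12_sqrt// ltW.
have -> : cos (3 * pi / 8 + (8 * l)^-1) = sin (8^-1 * (pi - l^-1)) :> R.
  rewrite -cosBpihalf -cosN; congr cos; rewrite invfM; field.
  by rewrite gt_eqF.
have -> : pi / 8 + (8 * l)^-1 = 8^-1 * (pi + l^-1) :> R by rewrite invfM; ring.
have s20 : 0 < Num.sqrt 2 :> R by rewrite sqrtr_gt0.
have s2 : Num.sqrt 2 ^+ 2 = 2 :> R by rewrite sqr_sqrtr.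
have p0 : 0 < Num.sqrt pi :> R by rewrite sqrtr_gt0 pi_gt0.
have p2 : Num.sqrt pi ^+ 2 = pi :> R by rewrite sqr_sqrtr// pi_ge0.
have sl : 0 < Num.sqrt l by rewrite sqrtr_gt0.
rewrite sqrtrM// -[in pi / (4 * _)]p2.
move: (cos _) (sin _) (besselJ _ _) (besselJ _ _) => c s j1 j3.
apply/eqP; rewrite -subr_eq0; apply/eqP.
transitivity (C2 * Num.sqrt pi * (s * j3 - c * j1) / Num.sqrt l * (Num.sqrt 2 ^+ 2 - 2) / Num.sqrt 2).
  by field; rewrite !gt_eqF.
by rewrite s2 subrr mulr0 mul0r.
Qed.

End bessel_formula.

Section bessel_expr_theory.
Context {R : realType}.
Variables (C2 eps : R).
Hypotheses (C20 : 0 < C2) (eps0 : 0 < eps).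

Lemma bessel_expr_osc_gauss (t : R) : 0 <= t ->
  bessel_expr C2 eps t = 8 * C2 / Num.sqrt pi * osc_gauss (t * eps ^+ 2).
Proof.
rewrite le_eqVlt => /predU1P[<-|]; last exact: bessel_exprE.
by rewrite /bessel_expr eqxx mul0r osc_gauss0 mulr0.
Qed.

Let K0 : 0 < 8 * C2 / Num.sqrt pi.
Proof. by rewrite divr_gt0 ?mulr_gt0// sqrtr_gt0 pi_gt0. Qed.

Lemma bessel_expr_increasing : {in `[0, +oo[ &, {homo bessel_expr C2 eps : t1 t2 / t1 < t2}}.
Proof.
move=> t1 t2; rewrite !in_itv/= !andbT => t10 t20 t12.
rewrite !bessel_expr_osc_gauss// ltr_pM2l// osc_gauss_increasing//.
  by rewrite mulr_ge0// sqr_ge0.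
by rewrite ltr_pM2r// exprn_gt0.
Qed.

Lemma cvg_bessel_expr0 : bessel_expr C2 eps t @[t --> 0^'+] --> 0.
Proof.
apply/cvg_at_rightP => u [u0 uc].
have -> : (fun n => bessel_expr C2 eps (u n)) = (fun n => 8 * C2 / Num.sqrt pi * osc_gauss (u n * eps ^+ 2)).
  by apply/funext => n; rewrite bessel_expr_osc_gauss// ltW.
rewrite -[X in _ --> X](mulr0 (8 * C2 / Num.sqrt pi)); apply: cvgM; first exact: cvg_cst.
apply: cvg_osc_gauss0; rewrite -(mul0r (eps ^+ 2)); apply: cvgM => //; exact: cvg_cst.
Qed.

Lemma cvg_bessel_expry : bessel_expr C2 eps t @[t --> +oo] --> 4 * C2.
Proof.
have h : 8 * C2 / Num.sqrt pi * (Num.sqrt pi / 2 - gauss_cos (t * eps ^+ 2)) @[t --> +oo] --> 4 * C2.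
  have -> : 4 * C2 = 8 * C2 / Num.sqrt pi * (Num.sqrt pi / 2 - 0).
    by field; rewrite gt_eqF// sqrtr_gt0 pi_gt0.
  apply: cvgM; first exact: cvg_cst.
  apply: cvgB; first exact: cvg_cst.
  apply: (cvg_comp (fun t => t * eps ^+ 2) _ _ (@cvg_gauss_cosy R)).
  have e20 : 0 < eps ^+ 2 by rewrite exprn_gt0.
  apply/cvgryPge => A; have := nbhs_pinfty_ge (num_real (A / eps ^+ 2)).
  by apply: filterS => t; rewrite ler_pdivrMr.
apply: cvg_trans h; apply: near_eq_cvg; have := nbhs_pinfty_ge (num_real (0 : R)).
by apply: filterS => t t0; rewrite bessel_expr_osc_gauss// osc_gaussE.
Qed.

End bessel_expr_theory.

(** * Polar coordinates *)

Section euclidean_norm.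
Context {R : realType} {d : nat}.
Implicit Types x : d.-tuple R.
Local Notation leb := (@lebesgue_measure R).
Local Notation I0 := (`[0%R, +oo[%classic : set R).
Local Notation J0 := (`]0%R, +oo[%classic : set R).

Lemma dot_ge0 x : 0 <= dot x x.
Proof. by apply: sumr_ge0 => i _; rewrite -expr2 sqr_ge0. Qed.

Lemma enorm_ge0 x : 0 <= enorm x.
Proof. exact: sqrtr_ge0. Qed.

Lemma sqr_enorm x : enorm x ^+ 2 = \sum_(i < d) tnth x i ^+ 2.
Proof. by rewrite sqr_sqrtr ?dot_ge0//; apply: eq_bigr => i _; rewrite expr2. Qed.

Lemma measurable_dot (a : d.-tuple R) : measurable_fun setT (dot a).
Proof.
apply: measurable_sum => i; apply: measurable_funM => //; exact: measurable_tnth.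
Qed.

Lemma measurable_sqr_enorm : measurable_fun setT (fun x : d.-tuple R => enorm x ^+ 2).
Proof.
under eq_fun do rewrite sqr_enorm.
by apply: measurable_sum => i; apply: measurable_funX; exact: measurable_tnth.
Qed.

Lemma measurable_enorm : measurable_fun setT (@enorm R d).
Proof.
have -> : @enorm R d = (fun x => (enorm x ^+ 2) `^ 2^-1).
  by apply/funext => x; rewrite powR12_sqrt ?sqr_ge0// sqrtr_sqr ger0_norm// enorm_ge0.
exact: (measurableT_comp (measurable_powR 2^-1)) measurable_sqr_enorm.
Qed.

Lemma measurable_japanese : measurable_fun setT (@japanese R d).
Proof.
have -> : @japanese R d = (fun x => (1 + enorm x ^+ 2) `^ 2^-1).
  by apply/funext => x; rewrite powR12_sqrt// addr_ge0// sqr_ge0.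
apply: (measurableT_comp (measurable_powR 2^-1)).
by apply: measurable_funD => //; exact: measurable_sqr_enorm.
Qed.

Lemma normr_tnth_le x i : `|tnth x i| <= enorm x.
Proof.
rewrite -sqrtr_sqr ler_sqrt ?dot_ge0//.
by rewrite /dot (bigD1 i)//= expr2 lerDl sumr_ge0// => j _; rewrite -expr2 sqr_ge0.
Qed.

Lemma enorm_scale (c : R) x : 0 <= c -> enorm (vaffine [tuple 0 | _ < d] c x) = c * enorm x.
Proof.
move=> c0; rewrite -{2}(ger0_norm c0) -sqrtr_sqr /enorm -sqrtrM ?sqr_ge0//; congr Num.sqrt.
rewrite /dot mulr_sumr; apply: eq_bigr => i _; rewrite !tnth_mktuple; ring.
Qed.

End euclidean_norm.

Section polar.
Context {R : realType} {d : nat}.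
Local Notation D := d.+1.
Local Notation leb := (@lebesgue_measure R).
Local Notation I0 := (`[0%R, +oo[%classic : set R).
Local Notation J0 := (`]0%R, +oo[%classic : set R).
Local Notation mu := (@lebesgue_Rd R D).

Let rho (x : D.-tuple R) : R := enorm x ^+ D.

Lemma measurable_enormX : measurable_fun [set: D.-tuple R] (rho : _ -> measurableTypeR R).
Proof. by apply: measurable_funX; exact: measurable_enorm. Qed.

Let ball (u : R) : set (D.-tuple R) := [set x | rho x < u].

Let measurable_ball (u : R) : measurable (ball u).
Proof.
have := measurable_enormX measurableT (measurable_itv `]-oo, u[); rewrite setTI.
by congr measurable; apply/seteqP; split => x; rewrite /= in_itv.
Qed.

Lemma measure_enorm_ball (u : R) : 0 < u -> mu (ball u) = (u%:E * mu (ball 1))%E.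
Proof.
move=> u0; pose c := u `^ (D%:R^-1).
have c0 : 0 < c by rewrite powR_gt0.
have cD : c ^+ D = u by rewrite -powR_mulrn ?powR_ge0// -powRrM mulVf ?pnatr_eq0// powRr1// ltW.
rewrite -(setIT (ball u)) -(setIT (ball 1)) -!integral_indic//.
rewrite (@ge0_integral_vaffine R D [tuple 0 | _ < D] c)//; last first.
  by apply/measurable_EFinP; exact: measurable_indic.
rewrite cD; congr (_ * _)%E; apply: eq_integral => x _; rewrite !indicE; congr (_%:R%:E); congr nat_of_bool.
apply/idP/idP; rewrite !inE /= /ball /= /rho enorm_scale ?ltW// exprMn cD.
  by rewrite -{2}(mulr1 u) ltr_pM2l.
by rewrite -{2}(mulr1 u) ltr_pM2l.
Qed.

Lemma unit_ball_lty : (mu (ball 1) < +oo)%E.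
Proof.
pose F (i : 'I_D) (r : R) : R := \1_(`[-1, 1]%classic : set R) r.
have iF i : leb.-integrable setT (EFin \o F i).
  by apply: integrable_indic_itv.
have [h _] := integral_prod iF.
rewrite -(setIT (ball 1)) -integral_indic//.
apply: le_lt_trans ((integrableP _ _ _ h).2).
apply: ge0_le_integral => //.
- by apply/measurable_EFinP; exact: measurable_indic.
- by apply: measurableT_comp => //; exact: measurable_int h.
move=> x _; rewrite lee_fin ger0_norm; last by apply: prodr_ge0 => i _.
rewrite [in leLHS]indicE; case: (boolP (_ \in _)) => [|_]; last by apply: prodr_ge0 => i _.
rewrite inE /= => rx.
have x1 : enorm x < 1.
  by rewrite ltNge; apply/negP => /(exprn_ege1 D); rewrite leNgt; apply/negP; rewrite negbK.
rewrite big1// => i _; rewrite /F indicE mem_set//= in_itv/=.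
by rewrite -ler_norml (le_trans (normr_tnth_le x i))// ltW.
Qed.

Lemma unit_ball_gt0 : (0 < mu (ball 1))%E.
Proof.
pose a : R := D.+1%:R^-1.
have a0 : 0 < a by rewrite invr_gt0 ltr0n.
have a1 : a <= 1 by rewrite invf_le1 ?ltr0n ?ler1n.
pose F (i : 'I_D) (r : R) : R := \1_(`[0, a]%classic : set R) r.
have iF i : leb.-integrable setT (EFin \o F i).
  by apply: integrable_indic_itv.
have [h1 h2] := integral_prod iF.
have E : (\int[mu]_x (\prod_(i < D) F i (tnth x i))%:E = (\prod_(i < D) \int[leb]_r F i r)%:E)%E.
  by rewrite -h2 /Rintegral fineK// integrable_fin_num.
have h : (0 < (\prod_(i < D) \int[leb]_r F i r)%R%:E)%E.
  rewrite lte_fin; apply: prodr_gt0 => i _.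
  rewrite /F /Rintegral integral_indic// setIT.
  by have := @lebesgue_measure_itv R `[0, a] => /= ->; rewrite lte_fin a0 /= subr0.
apply: lt_le_trans h _; rewrite -E -(setIT (ball 1)) -integral_indic//.
apply: ge0_le_integral => //.
- by move=> x _; rewrite lee_fin; apply: prodr_ge0.
- exact: measurable_int h1.
- by apply/measurable_EFinP; exact: measurable_indic.
move=> x _; rewrite lee_fin.
have [xa|/existsNP[i xi]] := pselect (forall i : 'I_D, (0 <= tnth x i <= a)).
  rewrite [leRHS]indicE mem_set; last first.
    rewrite /ball /= /rho exprn_ilt1 ?enorm_ge0// -(@ltr_pXn2r _ 2)// ?nnegrE ?enorm_ge0//.
    rewrite expr1n sqr_enorm; apply: (@le_lt_trans _ _ (\sum_(i < D) a)).
      apply: ler_sum => i _; have /andP[h0 h3] := xa i.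
      by rewrite expr2 (le_trans (ler_pM h0 h0 h3 h3))// ler_piMl// ltW.
    by rewrite sumr_const card_ord -(mulr_natl a) /a ltr_pdivrMr ?ltr0n// mul1r ltr_nat.
  by rewrite big1// => i _; rewrite /F indicE mem_set//= in_itv/= xa.
by rewrite (bigD1 i)//= {1}/F indicE memNset ?mul0r//= in_itv/=.
Qed.

Let V := fine (mu (ball 1)).

Let V_gt0 : 0 < V.
Proof. by rewrite fine_gt0// unit_ball_gt0 unit_ball_lty. Qed.

Let pf : {measure set (measurableTypeR R) -> \bar R} :=
  measure_function_pushforward__canonical__measure_function_Measure mu measurable_enormX.

(** The image of Lebesgue measure under |x|^d is a multiple of Lebesgue
    measure on the half line: the two agree on the intervals starting at 0,
    by scaling. *)
Lemma pushforward_enormX (A : set (measurableTypeR R)) : measurable A -> A `<=` I0 ->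
  pf A = (V%:E * leb A)%E.
Proof.
move=> mA AI; have V0 := ltW V_gt0.
have mI : measurable (I0 : set (measurableTypeR R)) by exact: measurable_itv.
pose m1 : {measure set (measurableTypeR R) -> \bar R} := mrestr pf mI.
pose m2 : {measure set (measurableTypeR R) -> \bar R} := mrestr (mscale (NngNum V0) leb) mI.
suff : m1 A = m2 A by rewrite /= /mrestr (setIidl AI).
have m2E (b : R) : m2 `]-oo, b[%classic = (V * Num.max b 0)%:E.
  rewrite /= /mrestr /mscale/=.
  have -> : `]-oo, b[%classic `&` I0 = `[0, b[%classic.
    apply/seteqP; split => x /=; rewrite !in_itv/= ?andbT; first by move=> [-> ->].
    by move=> /andP[-> ->].
  have := @lebesgue_measure_itv R `[0, b[ => /= ->; rewrite lte_fin.
  by case: ltP => b0; rewrite /= ?mule0 ?mulr0// oppr0 adde0 EFinM.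
have ray (b : R) : m1 `]-oo, b[%classic = m2 `]-oo, b[%classic.
  rewrite m2E.
  have -> : m1 `]-oo, b[%classic = mu (ball b).
    rewrite -[LHS]/(mu (rho @^-1` (`]-oo, b[%classic `&` I0))); congr (mu _); apply/seteqP; split => x /=; rewrite !in_itv/= ?andbT; first by case.
    by move=> xb; split => //; rewrite exprn_ge0// enorm_ge0.
  have [b0|b0] := ltP 0 b.
    rewrite measure_enorm_ball// mulrC EFinM fineK// ge0_fin_numE// unit_ball_lty//.
  rewrite mulr0 (_ : ball b = set0) ?measure0// -subset0 => x /=.
  by rewrite /ball /= ltNge (le_trans b0)// exprn_ge0// enorm_ge0.
pose g (n : nat) : set (measurableTypeR R) := `]-oo, n%:R[%classic.
have sI : setI_closed (@RGenInftyO.G R).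
  move=> _ _ [x ->] [y ->]; exists (Num.min x y).
  by apply/seteqP; split => z /=; rewrite !in_itv/= lt_min => /andP.
have Gg n : @RGenInftyO.G R (g n) by exists n%:R.
have gT : \bigcup_n g n = setT.
  rewrite -subTset => x _; exists (Num.truncn `|x|).+1 => //=; rewrite /g /= in_itv/=.
  by rewrite (le_lt_trans (ler_norm x))// truncnS_gt.
have m12 B : @RGenInftyO.G R B -> m1 B = m2 B by move=> [x ->]; exact: ray.
have g_fin n : (m1 (g n) < +oo)%E by rewrite ray m2E ltry.
exact: (measure_unique _ _ (@RGenInftyO.measurableE R) sI Gg gT m1 m2 m12 g_fin A mA).
Qed.

(** Substitute u = r^d in the integral against the image measure. The weight
    |x|^(1-d) cancels the Jacobian. *)
Lemma polar_coordinates : exists2 c : R, 0 < c & forall G : R -> R, continuous G ->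
  (forall r, 0 <= r -> 0 <= G r) ->
  (\int[mu]_x (enorm x `^ (1 - D%:R) * G (enorm x))%:E =
   c%:E * \int[leb]_(r in I0) (G r)%:E)%E.
Proof.
exists (V * D%:R); first by rewrite mulr_gt0 ?V_gt0// ltr0n.
move=> G cG G0; have V0 := ltW V_gt0.
pose H (u : R) := u `^ ((1 - D%:R) / D%:R) * G (u `^ D%:R^-1).
have mH (A : set (measurableTypeR R)) : measurable_fun A (H : measurableTypeR R -> R).
  apply: measurable_funTS; apply: measurable_funM; first exact: measurable_powR.
  by apply: measurableT_comp; [exact: continuous_measurable_fun|exact: measurable_powR].
have H0 u : 0 <= H u by rewrite mulr_ge0 ?powR_ge0// G0// powR_ge0.
have HX (r : R) : 0 <= r -> H (r ^+ D) = r `^ (1 - D%:R) * G r.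
  move=> r0; rewrite /H -powR_mulrn// -!powRrM mulrCA mulfV ?pnatr_eq0// mulr1.
  by rewrite powRr1.
have mI : measurable (I0 : set (measurableTypeR R)) by exact: measurable_itv.
transitivity (\int[mu]_x (H (rho x))%:E)%E.
  by apply: eq_integral => x _; rewrite HX// enorm_ge0.
have -> : (\int[mu]_x (H (rho x))%:E = \int[pf]_(u in I0) (H u)%:E)%E.
  have h := @ge0_integral_pushforward _ _ _ _ R _ measurable_enormX mu I0 (EFin \o H) mI.
  rewrite [RHS]h//; last 2 first.
  - by apply/measurable_EFinP.
  - by move=> u _; rewrite lee_fin.
  rewrite (_ : _ @^-1` _ = setT)//.
  by apply/seteqP; split => // x _; rewrite /= in_itv/= andbT exprn_ge0// enorm_ge0.
have -> : (\int[pf]_(u in I0) (H u)%:E = \int[mscale (NngNum V0) leb]_(u in I0) (H u)%:E)%E.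
  by apply: eq_measure_integral => A mA AI; exact: pushforward_enormX.
rewrite ge0_integral_mscale//; last 2 first.
- by apply/measurable_EFinP.
- by move=> u _; rewrite lee_fin.
rewrite /= EFinM -muleA; congr (_ * _)%E.
have E : (\int[leb]_(u in I0) (H u)%:E =
    \int[leb]_(r in J0) (H (r ^+ d.+1) * (d.+1%:R * r ^+ d))%:E)%E.
  rewrite -integral_J0I0; last exact: mH.
  apply: ge0_integral_power_substitution => // u.
  move/set_mem; rewrite /= in_itv/= andbT => u0.
  have cp p : {for u, continuous (fun x : R => x `^ p)}.
    have dp := is_derive1_powR p u0.
    by apply: differentiable_continuous; apply/derivable1_diffP; exact: (@ex_derive _ _ _ _ _ _ _ dp).
  by apply: cvgM; [exact: cp|apply: continuous_comp; [exact: cp|exact: cG]].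
etransitivity; first exact: E.
rewrite -(@integral_J0I0 R G); last by apply: measurable_funTS; exact: continuous_measurable_fun.
rewrite -ge0_integralZl//; last 2 first.
- by apply/measurable_EFinP; apply: measurable_funTS; exact: continuous_measurable_fun.
- by move=> r; rewrite /= in_itv/= andbT => r0; rewrite lee_fin G0// ltW.
apply: eq_integral => r /set_mem; rewrite /= in_itv/= andbT => r0.
rewrite HX ?ltW// -EFinM; congr EFin.
rewrite -(powR_mulrn d) ?ltW// mulrAC mulrCA -powRD ?(gt_eqF r0) ?implybT//.
have -> : 1 - D%:R + d%:R = 0 :> R by rewrite -[D%:R]natr1; ring.
by rewrite powRr0 mulr1.
Qed.

End polar.

(** * The Fourier transform of integrable functions *)

Section gauss_characteristic.
Context {R : realType}.
Local Notation leb := (@lebesgue_measure R).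

Lemma integrableT_oneDsqrV : leb.-integrable setT (EFin \o (fun x : R => (1 + x ^+ 2)^-1)).
Proof.
have m1 : measurable_fun setT (fun x : measurableTypeR R => (1 + x ^+ 2)^-1).
  apply: continuous_measurable_fun; exact: (@continuous_oneDsqrV R).
apply/integrableP; split; first exact/measurable_EFinP.
have p0 (x : R) : 0 <= (1 + x ^+ 2)^-1 by rewrite invr_ge0 addr_ge0 ?sqr_ge0.
under eq_integral => x _ do rewrite /= ger0_norm//.
rewrite ge0_symfun_integralT//=.
- rewrite (_ : [set x | _] = `[0, +oo[%classic); last first.
    by apply/seteqP; split => x/=; rewrite in_itv/= andbT.
  by rewrite integral0y_oneDsqr -EFinM ltry.
- exact: (@continuous_oneDsqrV R).
- by move=> x /=; rewrite sqrrN.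
Qed.

Lemma gauss_fun_le (x : R) : gauss_fun x <= (1 + x ^+ 2)^-1.
Proof.
have x0 : 0 < 1 + x ^+ 2 by rewrite ltr_pwDl ?sqr_ge0.
by rewrite /gauss_fun expRN lef_pV2 ?posrE ?expR_gt0// expR_ge1Dx.
Qed.

Lemma normr_gauss_fun_le (x : R) : `|x| * gauss_fun x <= 4 * (1 + x ^+ 2)^-1.
Proof.
have x0 : 0 < 1 + x ^+ 2 by rewrite ltr_pwDl ?sqr_ge0.
rewrite /gauss_fun expRN ler_pdivlMr// mulrAC ler_pdivrMr ?expR_gt0//.
apply: (@le_trans _ _ (4 * (1 + x ^+ 2 / 2) ^+ 2)).
  rewrite -(real_normK (num_real x)); move: `|x| (normr_ge0 x) => y y0.
  have := sqr_ge0 (y - 1); have := sqr_ge0 (y ^+ 2 - y).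
  have := sqr_ge0 y; have : 0 <= y ^+ 4 by rewrite exprn_ge0.
  move=> h1 h2 h3 h4.
  have -> : 4 * (1 + y ^+ 2 / 2) ^+ 2 = 4 + 4 * y ^+ 2 + y ^+ 4 by field.
  have -> : y * (1 + y ^+ 2) = y + y ^+ 3 by ring.
  have e1 : (y - 1) ^+ 2 = y ^+ 2 - 2 * y + 1 by ring.
  have e2 : (y ^+ 2 - y) ^+ 2 = y ^+ 4 - 2 * y ^+ 3 + y ^+ 2 by ring.
  by rewrite e1 in h4; rewrite e2 in h3; lra.
have -> : expR (x ^+ 2) = expR (x ^+ 2 / 2) ^+ 2.
  by rewrite [RHS]expr2 -expRD; congr expR; field.
by rewrite ler_pM2l// ler_pXn2r ?nnegrE ?expR_ge0 ?expR_ge1Dx// addr_ge0// divr_ge0// sqr_ge0.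
Qed.

Lemma integral_deriveT (F f : R -> R) (C : R) : continuous f ->
  (forall x : R, is_derive x 1 F (f x)) -> leb.-integrable setT (EFin \o f) ->
  (forall x, `|F x| <= C * (1 + x ^+ 2)^-1) -> \int[leb]_x f x = 0.
Proof.
move=> cf dF fi FC; have mf := continuous_measurable_fun cf.
pose I n : set R := `[- n.+1%:R, n.+1%:R]%classic.
have h : \int[leb]_(x in I n) f x @[n --> \oo] --> \int[leb]_x f x.
  have E n : \int[leb]_(x in I n) f x = \int[leb]_x ((f \_ (I n)) x).
    by rewrite -Rintegral_mkcond.
  under eq_fun do rewrite E.
  apply: (@dominated_cvg_Rintegral _ _ _ leb setT _ f (fun r => `|f r|) measurableT _ _ _ _).2.
  - move=> n; apply: (measurable_restrictT _ _).1 => //; first exact: measurable_itv.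
    exact: measurable_funTS.
  - move=> x _; apply: cvg_near_cst; near=> n.
    rewrite patchE mem_set//= /I /= in_itv/= -ler_norml.
    rewrite (le_trans (ltW (truncnS_gt _)))// ler_nat ltnS; near: n.
    exact: nbhs_infty_ge.
  - by have := integrable_abse fi.
  - by move=> n r _; rewrite patchE; case: ifPn => //; rewrite normr0.
have F0 (s : R) : `|s| = 1 -> F (s * n.+1%:R) @[n --> \oo] --> 0.
  move=> s1; apply/norm_cvg0P.
  apply: (@squeeze_cvgr _ _ _ _ (fun=> 0) (fun n => `|C| * n.+1%:R^-1)).
  - apply: nearW => n; rewrite normr_ge0 /= (le_trans (FC _))//.
    apply: (@le_trans _ _ (`|C| * (1 + (s * n.+1%:R) ^+ 2)^-1)).
      by apply: ler_wpM2r; [rewrite invr_ge0 addr_ge0 ?sqr_ge0|exact: ler_norm].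
    apply: ler_wpM2l => //; rewrite exprMn -(real_normK (num_real s)) s1 expr1n mul1r.
    have n0 : 0 < n.+1%:R :> R by rewrite ltr0n.
    have n1 : 0 < 1 + n.+1%:R ^+ 2 :> R by rewrite ltr_pwDl ?sqr_ge0.
    rewrite lef_pV2 ?posrE// (@le_trans _ _ (n.+1%:R ^+ 2)) ?lerDr//.
    by rewrite expr2 ler_peMr ?ler1n// ltW.
  - exact: cvg_cst.
  - rewrite -[X in _ --> X](mulr0 `|C|); apply: cvgM; first exact: cvg_cst.
    by apply/gtr0_cvgV0; [exact: nearW|rewrite (cvg_shiftS (fun n => n%:R : R)); exact: cvgr_idn].
have E n : \int[leb]_(x in I n) f x = F (1 * n.+1%:R) - F (-1 * n.+1%:R).
  rewrite mul1r mulN1r (integral_derive _ cf dF)// -subr_gt0 opprK.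
  by rewrite -natrD ltr0n.
rewrite (funext E) in h; apply: (cvg_unique _ h) => //.
have F1 := F0 1 (normr1 _); have F2 := F0 (-1) (normrN1 _).
by have := cvgB F1 F2; rewrite subrr; exact.
Unshelve. all: by end_near. Qed.

Let c p (xi : R) : R := \int[leb]_x (cos (p + xi * x) * gauss_fun x).

Let continuous_cos_gauss p (xi : R) : continuous (fun x : R => cos (p + xi * x) * gauss_fun x).
Proof.
move=> x; apply: cvgM; last exact: continuous_gauss_fun.
apply: continuous_comp; last exact: continuous_cos.
by apply: cvgD; [exact: cvg_cst|apply: cvgM; [exact: cvg_cst|exact: cvg_id]].
Qed.

Lemma integrable_cos_gauss p (xi : R) :
  leb.-integrable setT (EFin \o (fun x : R => cos (p + xi * x) * gauss_fun x)).
Proof.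
apply: (bounded_integrable measurableT _ integrableT_gauss).
  exact: continuous_measurable_fun (continuous_cos_gauss (p:=p) (xi:=xi)).
by move=> x _; rewrite normrM (ger0_norm (gauss_fun_ge0 _)) ler_piMl ?gauss_fun_ge0 ?normr_cos_le1.
Qed.

Let continuous_xcos_gauss p (xi : R) : continuous (fun x : R => x * (cos (p + xi * x) * gauss_fun x)).
Proof. by move=> x; apply: cvgM; [exact: cvg_id|exact: continuous_cos_gauss]. Qed.

Let integrable_x_gauss : leb.-integrable setT (EFin \o (fun x : R => `|x| * gauss_fun x)).
Proof.
apply: (bounded_integrable measurableT _ (integrable_mull 4 measurableT integrableT_oneDsqrV)).
  by apply: measurable_funM; [exact: continuous_measurable_fun (@norm_continuous R R^o)|exact: measurable_gauss_fun].
by move=> x _; rewrite ger0_norm ?mulr_ge0 ?gauss_fun_ge0// normr_gauss_fun_le.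
Qed.

Let integrable_xcos_gauss p (xi : R) :
  leb.-integrable setT (EFin \o (fun x : R => x * (cos (p + xi * x) * gauss_fun x))).
Proof.
apply: (bounded_integrable measurableT _ integrable_x_gauss).
  exact: continuous_measurable_fun (continuous_xcos_gauss (p:=p) (xi:=xi)).
move=> x _; rewrite 2!normrM (ger0_norm (gauss_fun_ge0 _)) ler_wpM2l//.
by rewrite ler_piMl ?gauss_fun_ge0 ?normr_cos_le1.
Qed.

Let is_derive_c p (xi : R) :
  is_derive xi 1 (c p) (\int[leb]_x (x * (cos (p + pi / 2 + xi * x) * gauss_fun x))).
Proof.
pose f xi (x : R) := cos (p + xi * x) * gauss_fun x.
have df (y x : R) : is_derive y 1 (f ^~ x) (x * (cos (p + pi / 2 + y * x) * gauss_fun x)).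
  rewrite /f; have d := is_derive_cos_affine p x y.
  under eq_fun => z do rewrite (mulrC z).
  by apply: is_derive_eq; rewrite /GRing.scale /= addrAC cosDpihalf [y * _]mulrC; ring.
have Il : `]xi - 1, xi + 1[%classic xi by rewrite /= in_itv/=; lra.
have H1 : forall y, `]xi - 1, xi + 1[%classic y -> leb.-integrable setT (EFin \o f y).
  by move=> y _; exact: integrable_cos_gauss.
have H2 : forall y x, `]xi - 1, xi + 1[%classic y -> setT x -> derivable (f ^~ x) y 1.
  by move=> y x _ _; exact: ex_derive.
pose G (x : R) := `|x| * gauss_fun x.
have G0 x : 0 <= G x by rewrite mulr_ge0 ?gauss_fun_ge0.
have H4 : forall y x, `]xi - 1, xi + 1[%classic y -> setT x -> `|partial1of2 f y x| <= G x.
  move=> y x _ _; rewrite partial1of2E derive_val /G 2!normrM (ger0_norm (gauss_fun_ge0 _)) ler_wpM2l//.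
  by rewrite ler_piMl ?gauss_fun_ge0 ?normr_cos_le1.
have D := @derivable_under_integral R _ _ leb f setT measurableT xi _ _ Il H1 H2 G G0 integrable_x_gauss H4.
have E := @differentiation_under_integral R _ _ leb f setT measurableT xi _ _ Il H1 H2 G G0 integrable_x_gauss H4.
apply: DeriveDef; first exact: D.
rewrite -derive1E E; apply: eq_Rintegral => x _.
by rewrite partial1of2E derive_val.
Qed.

(** By integration by parts, the derivative of the integral with respect to
    xi is - xi / 2 times the integral. *)
Lemma integral_cos_gauss p (xi : R) :
  \int[leb]_x (cos (p + xi * x) * gauss_fun x) = cos p * (Num.sqrt pi * expR (- (xi ^+ 2 / 4))).
Proof.
have parts (y : R) : 2 * \int[leb]_x (x * (cos (p + pi / 2 + y * x) * gauss_fun x)) = - y * c p y.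
  pose F (x : R) := cos (p + pi / 2 + y * x) * gauss_fun x.
  pose f (x : R) := - y * (cos (p + y * x) * gauss_fun x) - 2 * (x * (cos (p + pi / 2 + y * x) * gauss_fun x)).
  have dg (x : R) : is_derive x 1 (@gauss_fun R) (- (2 * x) * gauss_fun x).
    have d2 : is_derive x 1 (fun x : R => - x ^+ 2) (- (2 * x)).
      by apply: is_derive_eq; rewrite /GRing.scale /=; ring.
    have := @is_derive1_comp R expR (fun x => - x ^+ 2) x _ _ (is_derive_expR _) d2.
    by rewrite mulrC.
  have dF (x : R) : is_derive x 1 F (f x).
    have d1 := is_derive_cos_affine (p + pi / 2) y x; have d2 := dg x.
    rewrite /F; apply: is_derive_eq; rewrite /GRing.scale /= /f.
    have -> : sin (p + pi / 2 + y * x) = cos (p + y * x) by rewrite addrAC sinDpihalf.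
    by ring.
  have cf : continuous f.
    by move=> x; apply: cvgB; (apply: cvgM; first exact: cvg_cst);
      [exact: continuous_cos_gauss|exact: continuous_xcos_gauss].
  have i1 := integrable_mull (- y) measurableT (integrable_cos_gauss p y).
  have i2 := integrable_mull 2 measurableT (integrable_xcos_gauss (p + pi / 2) y).
  have fi : leb.-integrable setT (EFin \o f) by exact: integrable_sub.
  have F1 x : `|F x| <= 1 * (1 + x ^+ 2)^-1.
    rewrite /F normrM (ger0_norm (gauss_fun_ge0 _)) mul1r (le_trans _ (gauss_fun_le x))//.
    by rewrite ler_piMl ?gauss_fun_ge0 ?normr_cos_le1.
  have := integral_deriveT cf dF fi F1.
  rewrite /f RintegralB// !RintegralZl//; last exact: integrable_cos_gauss.
  by move/eqP; rewrite subr_eq0 => /eqP <-.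
pose Y (y : R) := expR (y ^+ 2 / 4) * c p y.
have dY (y : R) : is_derive y 1 Y 0.
  have d1 := is_derive_c p y.
  have d2 : is_derive y 1 (fun y : R => y ^+ 2 / 4) (y / 2).
    have d3 := @is_deriveX R R id 2 y 1 1 (is_derive_id y 1).
    have : is_derive y 1 (fun y : R => y * y * 4^-1) (y / 2).
      by apply: is_derive_eq; rewrite /GRing.scale /=; field.
    by under eq_fun do rewrite -expr2.
  have d3 := @is_derive1_comp R expR (fun y => y ^+ 2 / 4) y _ _ (is_derive_expR _) d2.
  rewrite /Y; apply: is_derive_eq; rewrite /GRing.scale /=.
  have := parts y; move: (\int[leb]_x _) (c p y) (expR _) => A B e AB.
  have -> : A = - y * B / 2 by rewrite -AB; field.
  by field.
have Y0 : Y 0 = cos p * Num.sqrt pi.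
  rewrite /Y expr0n mul0r expR0 mul1r /c.
  under eq_Rintegral do rewrite mul0r addr0.
  by rewrite RintegralZl// ?integrableT_gauss// /Rintegral integralT_gauss.
have : Y xi = Y 0 by exact: is_derive_0_is_cst.
rewrite Y0 /Y -[\int[leb]_x _]/(c p xi) => h.
by rewrite mulrA -h expRN mulrAC mulfV ?mul1r// gt_eqF// expR_gt0.
Qed.

Lemma cintegral_cis_gauss (xi : R) :
  cintegral leb setT (fun x : R => cis (xi * x) * (gauss_fun x)%:C) =
  (Num.sqrt pi * expR (- (xi ^+ 2 / 4)))%:C.
Proof.
have e0 := integral_cos_gauss 0 xi; have e1 := integral_cos_gauss (- (pi / 2)) xi.
rewrite cos0 mul1r in e0; rewrite cosN cos_pihalf mul0r in e1.
apply: complexP => /=.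
  by rewrite -[RHS]e0; apply: eq_Rintegral => x _; rewrite mulr0 subr0 add0r.
rewrite -[RHS]e1; apply: eq_Rintegral => x _; rewrite mulr0 add0r.
by congr (_ * _); rewrite addrC cosBpihalf.
Qed.

End gauss_characteristic.

Section parametric_integral.
Context {R : realType} {d1 d2 : measure_display}
  {T1 : measurableType d1} {T2 : measurableType d2}.
Variable (m2 : {sigma_finite_measure set T2 -> \bar R}).

Lemma measurable_Rintegral_param (f : T1 * T2 -> R) : measurable_fun setT f ->
  measurable_fun setT (fun x => \int[m2]_y f (x, y)).
Proof.
move=> mf; have mF := (measurable_EFinP setT f).2 mf.
have -> : (fun x => \int[m2]_y f (x, y)) =
    fine \o (fun x => \int[m2]_y ((EFin \o f)^\+ (x, y)) - \int[m2]_y ((EFin \o f)^\- (x, y)))%E.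
  apply/funext => x; rewrite /Rintegral /= integralE; congr (fine (_ - _)%E).
    by apply: eq_integral => y _; rewrite !funeposE.
  by apply: eq_integral => y _; rewrite !funenegE.
apply: (measurableT_comp (fine_measurable measurableT)).
apply: emeasurable_funB.
  apply: (@measurable_fun_fubini_tonelli_F _ _ T1 T2 R m2 (EFin \o f)^\+%E).
    exact: measurable_funepos.
  by move=> p; exact: funepos_ge0.
apply: (@measurable_fun_fubini_tonelli_F _ _ T1 T2 R m2 (EFin \o f)^\-%E).
  exact: measurable_funeneg.
by move=> p; exact: funeneg_ge0.
Qed.

Lemma cmeasurable_cintegral_param (f : T1 * T2 -> R[i]) : cmeasurable f ->
  cmeasurable (fun x => cintegral m2 setT (fun y => f (x, y))).
Proof.
move=> [f1 f2]; split.
  exact: (measurable_Rintegral_param f1).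
exact: (measurable_Rintegral_param f2).
Qed.

End parametric_integral.

Section fourier_integrable.
Context {R : realType} {d : nat}.
Local Notation mu := (@lebesgue_Rd R d).
Local Notation X := (d.-tuple R).
Local Notation c0 := (@fourier_cst R d).
Implicit Types (f g phi psi : X -> R[i]) (x xi : X).

Lemma dotC x xi : dot x xi = dot xi x.
Proof. by apply: eq_bigr => i _; rewrite mulrC. Qed.

Lemma measurable_dot2 : measurable_fun setT (fun p : X * X => dot p.1 p.2).
Proof.
apply: measurable_sum => i; apply: measurable_funM.
  exact: (measurableT_comp (measurable_tnth i) measurable_fst).
exact: (measurableT_comp (measurable_tnth i) measurable_snd).
Qed.

Definition vneg x : X := [tuple - tnth x i | i < d].

Lemma dot_vneg x xi : dot (vneg x) xi = - dot x xi.
Proof. by rewrite /dot -sumrN; apply: eq_bigr => i _; rewrite tnth_mktuple mulNr. Qed.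

Lemma measurable_vneg : measurable_fun setT vneg.
Proof.
apply/measurable_fun_tnthP => i; rewrite /comp; under eq_fun do rewrite tnth_mktuple.
by apply: measurableT_comp => //; exact: measurable_tnth.
Qed.

Lemma inv_fourierE f x : inv_fourier f x = fourier f (vneg x).
Proof.
by rewrite /inv_fourier /fourier; congr (_ * _); apply: eq_cintegral => xi; rewrite dot_vneg opprK.
Qed.

Lemma cmeasurable_fourier f : cmeasurable f -> cmeasurable (fourier f).
Proof.
move=> mf; apply: cmeasurableM; first exact: cmeasurable_cst.
have m1 : cmeasurable (fun p : X * X => cis (- dot p.1 p.2) * f p.2).
  apply: cmeasurableM.
    by apply: cmeasurable_cis; apply: measurableT_comp => //; exact: measurable_dot2.
  exact: cmeasurable_comp measurable_snd mf.
exact: (cmeasurable_cintegral_param (sf_lebesgue_Rd d) m1).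
Qed.

Lemma cmeasurable_inv_fourier f : cmeasurable f -> cmeasurable (inv_fourier f).
Proof.
move=> mf; rewrite (funext (inv_fourierE f)).
by apply: (cmeasurable_comp measurable_vneg); exact: cmeasurable_fourier.
Qed.

Lemma cintegrable_kernel f xi : cintegrable mu f ->
  cintegrable mu (fun x => cis (- dot xi x) * f x).
Proof.
move=> fi; apply: cis_cintegrableM => //.
by apply: measurableT_comp => //; exact: measurable_dot.
Qed.

Lemma cabs_fourier_le f xi : cintegrable mu f ->
  cabs (fourier f xi) <= c0 * \int[mu]_x cabs (f x).
Proof.
move=> fi; have c00 : 0 <= c0 by exact/ltW/fourier_cst_gt0.
rewrite cabsM cabs_real (ger0_norm c00); apply: ler_wpM2l => //.
apply: le_trans (cabs_cintegral_le (cintegrable_kernel xi fi)) _.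
by under eq_Rintegral do rewrite cabs_cisM.
Qed.

Lemma cabs_inv_fourier_le f x : cintegrable mu f ->
  cabs (inv_fourier f x) <= c0 * \int[mu]_x cabs (f x).
Proof. by move=> fi; rewrite inv_fourierE cabs_fourier_le. Qed.

Lemma fourier_linear (a : R[i]) f g xi : cintegrable mu f -> cintegrable mu g ->
  fourier (fun x => a * f x + g x) xi = a * fourier f xi + fourier g xi.
Proof.
move=> fi gi; rewrite /fourier mulrCA -mulrDr; congr (_ * _).
rewrite -cintegralZ; last exact: cintegrable_kernel.
rewrite -cintegralD; last 2 first.
- by apply: cintegrableZ; exact: cintegrable_kernel.
- exact: cintegrable_kernel.
by apply: eq_cintegral => x; rewrite mulrDr mulrCA.
Qed.

Lemma inv_fourier_linear (a : R[i]) f g x : cintegrable mu f -> cintegrable mu g ->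
  inv_fourier (fun x => a * f x + g x) x = a * inv_fourier f x + inv_fourier g x.
Proof. by move=> fi gi; rewrite !inv_fourierE fourier_linear. Qed.

Lemma cintegrable_mul_fourier f g : cintegrable mu f -> cintegrable mu g ->
  cintegrable mu (fun x => f x * fourier g x).
Proof.
move=> fi gi; under eq_fun do rewrite mulrC.
apply: (bounded_cintegrableM (B := c0 * \int[mu]_x cabs (g x)) _ _ fi).
  by apply: cmeasurable_fourier; exact: cintegrable_measurable gi.
by move=> x; exact: cabs_fourier_le.
Qed.

(** Both sides are the integral of exp(-i x.y) f(x) g(y), by Fubini. *)
Lemma multiplication_formula f g : cintegrable mu f -> cintegrable mu g ->
  cintegral mu setT (fun x => f x * fourier g x) =
  cintegral mu setT (fun x => fourier f x * g x).
Proof.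
move=> fi gi; pose F (p : X * X) := cis (- dot p.1 p.2) * (f p.1 * g p.2).
pose m := @sf_lebesgue_Rd R d.
have iF : cintegrable (m \x m)%E F.
  apply: cis_cintegrableM; first by apply: measurableT_comp => //; exact: measurable_dot2.
  exact: cintegrable_tensor.
have i1 x : cintegrable m (fun y => F (x, y)).
  exact: (cintegrable_kernel x (cintegrableZ (f x) gi)).
have i2 y : cintegrable m (fun x => F (x, y)).
  have := cintegrable_kernel y (cintegrableZ (g y) fi).
  by under eq_fun do rewrite (mulrC (g y)) dotC.
have c0N : c0%:C != 0 :> R[i] by rewrite -cabs_eq0 cabs_real normr_eq0 gt_eqF// fourier_cst_gt0.
have E g' x : cintegral mu setT (fun y => cis (- dot x y) * g' y) = c0%:C^-1 * fourier g' x.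
  by rewrite /fourier mulrA mulVf// mul1r.
have := cfubini iF i1 i2.
have -> : cintegral m setT (fun x => cintegral m setT (fun y => F (x, y))) =
   c0%:C^-1 * cintegral mu setT (fun x => f x * fourier g x).
  rewrite -cintegralZ; last exact: cintegrable_mul_fourier.
  apply: eq_cintegral => x; rewrite mulrCA -E -cintegralZ; last exact: cintegrable_kernel.
  by apply: eq_cintegral => y; rewrite /F /= mulrCA.
have -> : cintegral m setT (fun y => cintegral m setT (fun x => F (x, y))) =
   c0%:C^-1 * cintegral mu setT (fun y => fourier f y * g y).
  have ii : cintegrable mu (fun y => fourier f y * g y).
    have := cintegrable_mul_fourier gi fi.
    by under eq_fun do rewrite mulrC.
  rewrite -cintegralZ//.
  apply: eq_cintegral => y; rewrite mulrA -E mulrC -cintegralZ; last exact: cintegrable_kernel.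
  by apply: eq_cintegral => x; rewrite /F /= (dotC x) [RHS]mulrCA; congr (_ * _); rewrite mulrC.
by move/(mulfI _); apply; rewrite invr_eq0.
Qed.

End fourier_integrable.

(** * Schwartz functions *)

Section complex_derivative.
Context {R : realType}.
Implicit Types (f g : R -> R[i]) (a b r : R).

Lemma cderivable_is_derive g r : cderivable g r ->
  is_derive r 1 (fun t => complex.Re (g t)) (complex.Re (cderive g r)) /\
  is_derive r 1 (fun t => complex.Im (g t)) (complex.Im (cderive g r)).
Proof. by move=> [h1 h2]; rewrite /= !derive1E; split; apply: DeriveDef. Qed.

Lemma is_derive_cderivable g r (z : R[i]) :
  is_derive r 1 (fun t => complex.Re (g t)) (complex.Re z) ->
  is_derive r 1 (fun t => complex.Im (g t)) (complex.Im z) ->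
  cderivable g r /\ cderive g r = z.
Proof.
move=> h1 h2; split; first by split; exact: ex_derive.
by apply: complexP; rewrite /= derive1E derive_val.
Qed.

Lemma cderive_linear (z : R[i]) f g r : cderivable f r -> cderivable g r ->
  cderivable (fun t => z * f t + g t) r /\
  cderive (fun t => z * f t + g t) r = z * cderive f r + cderive g r.
Proof.
move=> /cderivable_is_derive[f1 f2] /cderivable_is_derive[g1 g2].
apply: is_derive_cderivable.
  have -> : (fun t => complex.Re (z * f t + g t)) = (fun t =>
      complex.Re z * complex.Re (f t) - complex.Im z * complex.Im (f t) + complex.Re (g t)).
    by apply/funext => t; rewrite !ReImE.
  by apply: is_derive_eq; rewrite !ReImE /GRing.scale /=; ring.
have -> : (fun t => complex.Im (z * f t + g t)) = (fun t =>
    complex.Re z * complex.Im (f t) + complex.Im z * complex.Re (f t) + complex.Im (g t)).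
  by apply/funext => t; rewrite !ReImE.
by apply: is_derive_eq; rewrite !ReImE /GRing.scale /=; ring.
Qed.

Lemma real_mean_value_bound (f df : R -> R) (B a b : R) :
  (forall r, is_derive r 1 f (df r)) -> (forall r, `|r - a| <= `|b - a| -> `|df r| <= B) ->
  `|f b - f a| <= B * `|b - a|.
Proof.
move=> dF dB; have cf := derive_continuous dF.
have key (u v : R) : u <= v -> (forall r, u <= r <= v -> `|df r| <= B) -> `|f v - f u| <= B * (v - u).
  move=> uv h; have [r ruv ->] := MVT_segment uv (fun x _ => dF x) (continuous_subspaceT cf).
  rewrite normrM (ger0_norm (_ : 0 <= v - u)) ?subr_ge0// ler_wpM2r ?subr_ge0// h//.
have [ab|/ltW ba] := leP a b.
  rewrite (ger0_norm (_ : 0 <= b - a)) ?subr_ge0//; apply: key => // r /andP[ar rb].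
  by apply: dB; rewrite !ger0_norm ?subr_ge0// lerD2r.
rewrite distrC (distrC b) (ger0_norm (_ : 0 <= a - b)) ?subr_ge0//; apply: key => // r /andP[br ra].
by apply: dB; rewrite distrC (distrC b) !ger0_norm ?subr_ge0// lerD2l lerN2.
Qed.

Lemma mean_value_bound g (B a b : R) : (forall r, cderivable g r) ->
  (forall r, `|r - a| <= `|b - a| -> cabs (cderive g r) <= B) ->
  cabs (g b - g a) <= 2 * B * `|b - a|.
Proof.
move=> dg gB; apply: le_trans (cabs_le_ReIm _) _.
have h1 : `|complex.Re (g b) - complex.Re (g a)| <= B * `|b - a|.
  apply: (real_mean_value_bound (f := fun t => complex.Re (g t)) (df := fun t => complex.Re (cderive g t))).
    by move=> r; exact: (cderivable_is_derive (dg r)).1.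
  by move=> r /gB; exact: le_trans (Re_le_cabs _).
have h2 : `|complex.Im (g b) - complex.Im (g a)| <= B * `|b - a|.
  apply: (real_mean_value_bound (f := fun t => complex.Im (g t)) (df := fun t => complex.Im (cderive g t))).
    by move=> r; exact: (cderivable_is_derive (dg r)).2.
  by move=> r /gB; exact: le_trans (Im_le_cabs _).
by rewrite ReD ImD ReN ImN -mulrA mulr_natl mulr2n lerD.
Qed.

Lemma difference_quotient g r : cderivable g r ->
  cabs (n.+1%:R%:C * (g (r + n.+1%:R^-1) - g r) - cderive g r) @[n --> \oo] --> 0.
Proof.
move=> [h1 h2].
have S (f : R -> R) : derivable f r 1 ->
    n.+1%:R * (f (r + n.+1%:R^-1) - f r) @[n --> \oo] --> derive1 f r.
  rewrite derive1E => /cvgr_dnbhsP h; have := h (fun n => n.+1%:R^-1).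
  have -> : (fun n => n.+1%:R * (f (r + n.+1%:R^-1) - f r)) =
    (fun n => (n.+1%:R^-1)^-1 *: (f (n.+1%:R^-1 *: 1 + r) - f r)).
    apply/funext => n; rewrite invrK; congr (_ * (f _ - _)).
    by rewrite [RHS]addrC; congr (_ + _); rewrite /GRing.scale /= mulr1.
  apply; split; first by move=> n; rewrite invr_eq0 pnatr_eq0.
  by apply/gtr0_cvgV0; [exact: nearW|rewrite (cvg_shiftS (fun n => n%:R : R)); exact: cvgr_idn].
have h3 := S _ h1; have h4 := S _ h2.
apply: (@squeeze_cvgr _ _ _ _ (fun=> 0) (fun n =>
  `|n.+1%:R * (complex.Re (g (r + n.+1%:R^-1)) - complex.Re (g r)) - derive1 (fun t => complex.Re (g t)) r| +
  `|n.+1%:R * (complex.Im (g (r + n.+1%:R^-1)) - complex.Im (g r)) - derive1 (fun t => complex.Im (g t)) r|)).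
- apply: nearW => n; rewrite cabs_ge0 /=; apply: le_trans (cabs_le_ReIm _) _.
  by rewrite !ReImE /= !mul0r subr0 addr0.
- exact: cvg_cst.
- rewrite -[X in _ --> X]addr0; apply: cvgD.
    by apply/norm_cvg0P/subr_cvg0.
  by apply/norm_cvg0P/subr_cvg0.
Qed.

End complex_derivative.

Section schwartz_theory.
Context {R : realType} {d : nat}.
Local Notation mu := (@lebesgue_Rd R d).
Local Notation X := (d.-tuple R).
Implicit Types (f g phi psi : X -> R[i]) (x y : X) (i j : 'I_d).

Lemma tnth_update x i r j : tnth (update x i r) j = if j == i then r else tnth x j.
Proof. by rewrite tnth_mktuple. Qed.

Lemma update_update x i r s : update (update x i r) i s = update x i s.
Proof. by apply: eq_from_tnth => j; rewrite !tnth_update; case: eqP. Qed.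

Lemma update_id x i : update x i (tnth x i) = x.
Proof. by apply: eq_from_tnth => j; rewrite tnth_update; case: eqP => [->|]. Qed.

Lemma has_partial_update i f : (forall x, has_partial i f x) -> forall x r,
  cderivable (fun r => f (update x i r)) r /\
  cderive (fun r => f (update x i r)) r = partial i f (update x i r).
Proof.
move=> h x r; have := h (update x i r); rewrite /has_partial /partial tnth_update eqxx.
by under eq_fun do rewrite update_update.
Qed.

Lemma partial_linear (a : R[i]) i f g :
  (forall x, has_partial i f x) -> (forall x, has_partial i g x) ->
  (forall x, has_partial i (fun x => a * f x + g x) x) /\
  partial i (fun x => a * f x + g x) = (fun x => a * partial i f x + partial i g x).
Proof.
move=> hf hg; split; first by move=> x; exact: (cderive_linear a (hf x) (hg x)).1.
by apply/funext => x; exact: (cderive_linear a (hf x) (hg x)).2.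
Qed.

Lemma schwartz_partial i phi : schwartz phi -> schwartz (partial i phi).
Proof.
have E l : iter_partial l (partial i phi) = iter_partial (rcons l i) phi.
  by rewrite /iter_partial foldr_rcons.
move=> [h1 h2]; split; first by move=> l j x; rewrite E; exact: h1.
move=> N; have [B hB] := h2 N.+1; exists B => l k x lN kN; rewrite E; apply: hB.
  by rewrite size_rcons.
exact: leqW.
Qed.

Lemma schwartz_linear (a : R[i]) phi psi : schwartz phi -> schwartz psi ->
  schwartz (fun x => a * phi x + psi x).
Proof.
move=> [h1 h2] [k1 k2].
have E l : iter_partial l (fun x => a * phi x + psi x) =
    (fun x => a * iter_partial l phi x + iter_partial l psi x).
  elim: l => //= i l ->.
  exact: (partial_linear a (h1 l i) (k1 l i)).2.
split; first by move=> l i x; rewrite E; exact: (partial_linear a (h1 l i) (k1 l i)).1.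
move=> N; have [B hB] := h2 N; have [C hC] := k2 N; exists (cabs a * B + C) => l k x lN kN.
have p0 : 0 <= (1 + enorm x) ^+ k by rewrite exprn_ge0// addr_ge0// enorm_ge0.
rewrite E; apply: le_trans (ler_wpM2l p0 (cabsD _ _)) _.
rewrite mulrDr lerD//; last exact: hC.
by rewrite cabsM mulrCA ler_wpM2l ?cabs_ge0// hB.
Qed.

(** An integrable majorant of all Schwartz functions, up to constants. *)
Definition decay x : R := \prod_(i < d) (1 + tnth x i ^+ 2)^-1.

Lemma decay_gt0 x : 0 < decay x.
Proof. by apply: prodr_gt0 => i _; rewrite invr_gt0 ltr_pwDl ?sqr_ge0. Qed.

Lemma integrable_decay : mu.-integrable setT (EFin \o decay).
Proof. exact: (integral_prod (fun i : 'I_d => @integrableT_oneDsqrV R)).1. Qed.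

Lemma decay_enorm x : 1 <= (1 + enorm x) ^+ (2 * d) * decay x.
Proof.
rewrite /decay prodfV ler_pdivlMr; last by apply: prodr_gt0 => i _; rewrite ltr_pwDl ?sqr_ge0.
rewrite mul1r exprM -[leRHS](_ : \prod_(i < d) (1 + enorm x) ^+ 2 = _); last first.
  by rewrite prodr_const card_ord.
apply: ler_prod => i _; rewrite addr_ge0 ?sqr_ge0//=.
rewrite sqrrD expr1n mul1r -addrA lerD2l.
have h := normr_tnth_le x i.
rewrite -(real_normK (num_real (tnth x i))) ler_wpDl ?mulrn_wge0 ?enorm_ge0//.
by rewrite ler_pXn2r ?nnegrE ?enorm_ge0.
Qed.

Lemma schwartz_decay phi (B : R) x : schwartz_bound (2 * d) phi B ->
  cabs (phi x) <= B * decay x.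
Proof.
move=> /(_ [::] (2 * d)%N x (leq0n _) (leqnn _)) /= h.
apply: (@le_trans _ _ (cabs (phi x) * ((1 + enorm x) ^+ (2 * d) * decay x))).
  by rewrite ler_peMr ?cabs_ge0 ?decay_enorm.
by rewrite mulrA [cabs _ * _]mulrC ler_wpM2r// ltW// decay_gt0.
Qed.

Lemma schwartz_bounded phi : schwartz phi -> exists B : R, forall x, cabs (phi x) <= B.
Proof.
move=> [_ /(_ 0%N)[B hB]]; exists B => x.
by have := hB [::] 0%N x (leqnn _) (leqnn _); rewrite expr0 mul1r.
Qed.

(** Change the coordinates one at a time. *)
Lemma schwartz_lipschitz phi : schwartz phi -> exists2 B : R, 0 <= B &
  forall x y, cabs (phi y - phi x) <= B * \sum_(i < d) `|tnth y i - tnth x i|.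
Proof.
move=> [h1 /(_ 1%N)[B hB]].
have pB i x : cabs (partial i phi x) <= B.
  by have := hB [:: i] 0%N x (leqnn _) (leq0n _); rewrite expr0 mul1r.
have B0 i : 0 <= B by exact: le_trans (cabs_ge0 _) (pB i [tuple 0 | _ < d]).
have [d0|d0] := posnP d.
  exists 0 => // x y; rewrite (_ : y = x) ?subrr ?cabs0 ?mul0r//.
  by apply: eq_from_tnth => i; move: (ltn_ord i); rewrite {2}d0.
exists (2 * B); first by rewrite mulr_ge0// (B0 (Ordinal d0)).
move=> x y; pose mix m : X := [tuple if (i < m)%N then tnth y i else tnth x i | i < d].
have step m (i : 'I_d) : nat_of_ord i = m ->
    cabs (phi (mix m.+1) - phi (mix m)) <= 2 * B * `|tnth y i - tnth x i|.
  move=> im; have e1 : mix m.+1 = update (mix m) i (tnth y i).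
    apply: eq_from_tnth => j; rewrite tnth_update !tnth_mktuple ltnS leq_eqVlt.
    case: (eqVneq j i) => [->|ji]; first by rewrite im eqxx.
    by rewrite -im (negbTE (ji : nat_of_ord j != i)).
  have e2 : mix m = update (mix m) i (tnth x i).
    apply: eq_from_tnth => j; rewrite tnth_update !tnth_mktuple.
    by case: (eqVneq j i) => [->|//]; rewrite im ltnn.
  rewrite e1 {2}e2.
  apply: (@mean_value_bound _ (fun r => phi (update (mix m) i r))) => r.
    exact: (has_partial_update (h1 [::] i) (mix m) r).1.
  by rewrite (has_partial_update (h1 [::] i) (mix m) r).2.
have tele m : (m <= d)%N ->
    cabs (phi (mix m) - phi x) <= 2 * B * \sum_(i < d | (i < m)%N) `|tnth y i - tnth x i|.
  elim: m => [_|m IH md].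
    rewrite (_ : mix 0 = x) ?subrr ?cabs0; last by apply: eq_from_tnth => i; rewrite tnth_mktuple.
    by rewrite big_pred0 ?mulr0.
  have -> : phi (mix m.+1) - phi x = (phi (mix m.+1) - phi (mix m)) + (phi (mix m) - phi x).
    by rewrite addrA subrK.
  apply: le_trans (cabsD _ _) _.
  rewrite (bigD1 (Ordinal md))//= mulrDr lerD//; first exact: step.
  rewrite (le_trans (IH (ltnW md)))// le_eqVlt; apply/orP; left; apply/eqP.
  congr (_ * _); apply: eq_bigl => i; rewrite [in RHS]ltnS -[i == _]/(nat_of_ord i == m).
  by case: ltngtP.
have := tele d (leqnn _); rewrite (_ : mix d = y); last first.
  by apply: eq_from_tnth => i; rewrite tnth_mktuple ltn_ord.
by under eq_bigl do rewrite ltn_ord.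
Qed.

Let grid (n : nat) x : d.-tuple int := [tuple Num.floor (n.+1%:R * tnth x i) | i < d].
Let grid_point (n : nat) (k : d.-tuple int) : X := [tuple (tnth k i)%:~R / n.+1%:R | i < d].

Let measurable_grid n k : measurable [set x | grid n x = k].
Proof.
have -> : [set x | grid n x = k] = \bigcap_(i in [set: 'I_d])
    [set x : X | (tnth k i)%:~R <= n.+1%:R * tnth x i < (tnth k i + 1)%:~R].
  apply/seteqP; split => x /=.
    by move=> <- i _ /=; rewrite tnth_mktuple floor_itv.
  move=> h; apply: eq_from_tnth => i; rewrite tnth_mktuple.
  by apply/eqP; rewrite floor_eq; exact: h.
apply: fin_bigcap_measurable; first exact: finite_finset.
move=> i _.
have m1 : measurable_fun setT (fun x : X => n.+1%:R * tnth x i : measurableTypeR R).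
  by apply: measurable_funM => //; exact: measurable_tnth.
have := m1 measurableT _ (measurable_itv `[(tnth k i)%:~R, (tnth k i + 1)%:~R[).
by rewrite setTI; congr measurable; apply/seteqP; split => x; rewrite /= in_itv.
Qed.

(** A Lipschitz function is the limit of functions that are constant on the
    cells of finer and finer grids, hence measurable. This applies to Schwartz
    functions, whose partial derivatives are bounded. *)
Lemma lipschitz_measurable f (B : R) :
  (forall x y, cabs (f y - f x) <= B * \sum_(i < d) `|tnth y i - tnth x i|) ->
  cmeasurable f.
Proof.
move=> fB; pose F n x := f (grid_point n (grid n x)).
have mF n (h : R[i] -> R) : measurable_fun setT (fun x => h (F n x)).
  move=> _ Y mY; rewrite setTI.
  have -> : (fun x => h (F n x)) @^-1` Y =
      \bigcup_(k : d.-tuple int) ([set x | grid n x = k] `&` [set _ | Y (h (f (grid_point n k)))]).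
    apply/seteqP; split => x /=; first by move=> Yx; exists (grid n x).
    by move=> [k _ [<-]].
  apply: countable_bigcupT_measurable => // k; apply: measurableI => //.
  by have [Yk|nYk] := pselect (Y (h (f (grid_point n k)))); [rewrite (_ : [set _ | _] = setT)|
    rewrite (_ : [set _ | _] = set0)] => //; apply/seteqP; split.
have near_f x n : cabs (F n x - f x) <= `|B| * (d%:R * n.+1%:R^-1).
  apply: le_trans (fB _ _) _; apply: (@le_trans _ _ (`|B| *
      \sum_(i < d) `|tnth (grid_point n (grid n x)) i - tnth x i|)).
    by rewrite ler_wpM2r ?ler_norm// sumr_ge0.
  apply: ler_wpM2l => //.
  rewrite (_ : d%:R * n.+1%:R^-1 = \sum_(i < d) n.+1%:R^-1); last first.
    by rewrite sumr_const card_ord mulr_natl.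
  apply: ler_sum => i _; rewrite !tnth_mktuple.
  have n0 : 0 < n.+1%:R :> R by rewrite ltr0n.
  have /andP[h1 h2] := floor_itv (n.+1%:R * tnth x i).
  move: h1 h2; rewrite intrD /=; set k := (Num.floor _)%:~R => h1 h2.
  rewrite (_ : k / n.+1%:R - tnth x i = (k - n.+1%:R * tnth x i) / n.+1%:R); last first.
    by field; rewrite gt_eqF.
  rewrite normrM (ger0_norm (_ : 0 <= n.+1%:R^-1)) ?invr_ge0//.
  rewrite ler_piMl ?invr_ge0// ler_norml; move: (n.+1%:R * tnth x i) h1 h2 => t h1 h2.
  by apply/andP; split; lra.
have cvF (h : R[i] -> R) x : (forall z w, `|h z - h w| <= cabs (z - w)) ->
    h (F n x) @[n --> \oo] --> h (f x).
  move=> hL; apply/subr_cvg0/norm_cvg0P.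
  apply: (@squeeze_cvgr _ _ _ _ (fun=> 0) (fun n => `|B| * (d%:R * n.+1%:R^-1))).
  - by apply: nearW => n; rewrite normr_ge0 /= (le_trans (hL _ _))// near_f.
  - exact: cvg_cst.
  - rewrite -[X in _ --> X](mulr0 `|B|); apply: cvgM; first exact: cvg_cst.
    rewrite -[X in _ --> X](mulr0 (d%:R : R)); apply: cvgM; first exact: cvg_cst.
    by apply/gtr0_cvgV0; [exact: nearW|rewrite (cvg_shiftS (fun n => n%:R : R)); exact: cvgr_idn].
split.
  apply: (@measurable_fun_cvg _ _ _ setT (fun n x => complex.Re (F n x))) => [n|x _].
    exact: (mF n (@complex.Re R)).
  by apply: (cvF (@complex.Re R)) => z w; rewrite -ReN -ReD Re_le_cabs.
apply: (@measurable_fun_cvg _ _ _ setT (fun n x => complex.Im (F n x))) => [n|x _].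
  exact: (mF n (@complex.Im R)).
by apply: (cvF (@complex.Im R)) => z w; rewrite -ImN -ImD Im_le_cabs.
Qed.

Lemma schwartz_measurable phi : schwartz phi -> cmeasurable phi.
Proof. by move=> /schwartz_lipschitz[B _ /lipschitz_measurable]. Qed.

Lemma schwartz_integrable phi : schwartz phi -> cintegrable mu phi.
Proof.
move=> sphi; have [B hB] := sphi.2 (2 * d)%N.
apply: (dominated_cintegrable (schwartz_measurable sphi) (integrable_mull B measurableT integrable_decay)).
by move=> x; exact: schwartz_decay.
Qed.

End schwartz_theory.

(** * Fourier inversion for Schwartz functions *)

Section fourier_schwartz.
Context {R : realType} {d : nat}.
Local Notation leb := (@lebesgue_measure R).
Local Notation mu := (@lebesgue_Rd R d).
Local Notation X := (d.-tuple R).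
Local Notation c0 := (@fourier_cst R d).
Implicit Types (f g phi psi : X -> R[i]) (x y xi : X) (i j : 'I_d).

Lemma ccvg_unique (z : nat -> R[i]) (a b : R[i]) : cabs (z n - a) @[n --> \oo] --> 0 ->
  cabs (z n - b) @[n --> \oo] --> 0 -> a = b.
Proof.
move=> za zb; apply/eqP; rewrite -subr_eq0 -cabs_eq0; apply/eqP.
have h : cabs (z n - a) + cabs (z n - b) @[n --> \oo] --> 0.
  by have := cvgD za zb; rewrite addr0; exact.
apply/eqP; rewrite eq_le cabs_ge0 andbT; apply: (ler_cvg_to (cvg_cst (cabs (a - b))) h).
apply: nearW => n; rewrite (_ : a - b = (z n - b) - (z n - a)); last by ring.
by rewrite [leRHS]addrC cabsB.
Qed.

Lemma cvg0_scale (k : R) (u : nat -> R) : u n @[n --> \oo] --> 0 -> k * u n @[n --> \oo] --> 0.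
Proof. by move=> u0; rewrite -[X in _ --> X](mulr0 k); apply: cvgM => //; exact: cvg_cst. Qed.

Lemma cvg_invnS : n.+1%:R^-1 @[n --> \oo] --> (0 : R).
Proof.
by apply/gtr0_cvgV0; [exact: nearW|rewrite (cvg_shiftS (fun n => n%:R : R)); exact: cvgr_idn].
Qed.

Lemma cintegral_vaffine (a : X) (c : R) f : 0 < c -> cmeasurable f ->
  cintegral mu setT f = (c ^+ d)%:C * cintegral mu setT (fun x => f (vaffine a c x)).
Proof.
move=> c_gt0 [f1 f2]; apply: complexP; rewrite ?realCM_Re ?realCM_Im /=.
  exact: (Rintegral_vaffine a c_gt0 f1).
exact: (Rintegral_vaffine a c_gt0 f2).
Qed.

Definition gaussd (delta : R) x : R := expR (- (delta ^+ 2 * enorm x ^+ 2)).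

Lemma gaussd_prod delta x : gaussd delta x = \prod_(i < d) expR (- (delta ^+ 2 * tnth x i ^+ 2)).
Proof. by rewrite /gaussd sqr_enorm mulr_sumr -sumrN expR_sum. Qed.

Lemma gaussd_gt0 delta x : 0 < gaussd delta x.
Proof. exact: expR_gt0. Qed.

Lemma gaussd_le1 delta x : gaussd delta x <= 1.
Proof. by rewrite -[leRHS](expR0 R) ler_expR oppr_le0 mulr_ge0 ?sqr_ge0. Qed.

Lemma measurable_gaussd delta : measurable_fun setT (gaussd delta).
Proof.
apply: measurableT_comp => //; apply: measurableT_comp => //.
by apply: measurable_funM => //; exact: measurable_sqr_enorm.
Qed.

Lemma gauss_le_oneDsqrV (e r : R) : 0 < e ->
  expR (- (e * r ^+ 2)) <= (1 + e^-1) * (1 + r ^+ 2)^-1.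
Proof.
move=> e0; have r0 := sqr_ge0 r.
have h1 : 0 < 1 + e * r ^+ 2 by rewrite ltr_pwDl// mulr_ge0// ltW.
have h2 : 0 < 1 + r ^+ 2 by rewrite ltr_pwDl.
apply: (@le_trans _ _ (1 + e * r ^+ 2)^-1).
  by rewrite expRN lef_pV2 ?posrE ?expR_gt0// expR_ge1Dx.
rewrite ler_pdivlMr// ler_pdivrMl//.
have -> : (1 + e * r ^+ 2) * (1 + e^-1) = 1 + r ^+ 2 + (e * r ^+ 2 + e^-1).
  by move: (r ^+ 2) => v; field; rewrite gt_eqF.
by rewrite lerDl addr_ge0 ?invr_ge0 ?(ltW e0)// mulr_ge0// ltW.
Qed.

Lemma gaussd_decay delta x : 0 < delta ->
  gaussd delta x <= (1 + (delta ^+ 2)^-1) ^+ d * decay x.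
Proof.
move=> delta0; have e0 : 0 < delta ^+ 2 by rewrite exprn_gt0.
rewrite gaussd_prod (_ : _ ^+ d = \prod_(i < d) (1 + (delta ^+ 2)^-1)); last first.
  by rewrite prodr_const card_ord.
rewrite -big_split; apply: ler_prod => i _; rewrite expR_ge0 /=.
exact: gauss_le_oneDsqrV.
Qed.

Lemma cintegrable_gaussd delta : 0 < delta -> cintegrable mu (fun x => (gaussd delta x)%:C).
Proof.
move=> delta0; apply: (dominated_cintegrable _
  (integrable_mull ((1 + (delta ^+ 2)^-1) ^+ d) measurableT (@integrable_decay R d))).
  by apply: cmeasurable_real; exact: measurable_gaussd.
by move=> x; rewrite cabs_real ger0_norm ?expR_ge0// gaussd_decay.
Qed.

Lemma cintegral_gaussd (delta : R) xi : 0 < delta ->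
  cintegral mu setT (fun x => cis (dot xi x) * (gaussd delta x)%:C) =
  ((Num.sqrt pi / delta) ^+ d * expR (- (enorm xi ^+ 2 / (4 * delta ^+ 2))))%:C.
Proof.
move=> delta0; have dN : delta != 0 by rewrite gt_eqF.
have i0 : 0 < delta^-1 by rewrite invr_gt0.
have mf : cmeasurable (fun x => cis (dot xi x) * (gaussd delta x)%:C).
  apply: cmeasurableM; first by apply: cmeasurable_cis; exact: measurable_dot.
  by apply: cmeasurable_real; exact: measurable_gaussd.
rewrite (cintegral_vaffine [tuple 0 | _ < d] i0 mf).
pose F i (r : R) := cis ((tnth xi i / delta) * r) * (gauss_fun r)%:C.
have iF i : cintegrable leb (F i).
  apply: cis_cintegrableM; last exact: cintegrable_real integrableT_gauss.
  by apply: measurable_funM => //.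
have E x : cis (dot xi (vaffine [tuple 0 | _ < d] delta^-1 x)) *
    (gaussd delta (vaffine [tuple 0 | _ < d] delta^-1 x))%:C = \prod_(i < d) F i (tnth x i).
  rewrite big_split /=; congr (_ * _).
    rewrite -cis_sum; congr cis; apply: eq_bigr => i _; rewrite !tnth_mktuple; ring.
  rewrite -rmorph_prod /= gaussd_prod; congr (_%:C); apply: eq_bigr => i _.
  by rewrite /gauss_fun !tnth_mktuple add0r; congr expR; field.
rewrite (eq_cintegral _ E) (cintegral_prod iF).2.
under eq_bigr do rewrite cintegral_cis_gauss.
rewrite -rmorph_prod -rmorphM /= big_split /= prodr_const card_ord -expR_sum; congr (_%:C).
rewrite mulrA -exprMn [_^-1 * _]mulrC; congr (_ * expR _).
by rewrite sumrN sqr_enorm mulr_suml; congr (- _); apply: eq_bigr => i _; field.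
Qed.

Lemma fourierZ (z : R[i]) phi xi : cintegrable mu phi ->
  fourier (fun x => z * phi x) xi = z * fourier phi xi.
Proof.
move=> iphi; have ik := cintegrable_kernel xi iphi.
rewrite /fourier mulrCA; congr (_ * _); rewrite -cintegralZ//.
by apply: eq_cintegral => x; rewrite mulrCA.
Qed.

Lemma fourier_translate phi (a : X) xi : cintegrable mu phi ->
  fourier (fun x => phi (vaffine a 1 x)) xi = cis (dot xi a) * fourier phi xi.
Proof.
move=> iphi; have ik := cintegrable_kernel xi iphi.
rewrite /fourier mulrCA; congr (_ * _); rewrite -cintegralZ//.
have mF := cintegrable_measurable (cintegrableZ (cis (dot xi a)) ik).
rewrite (cintegral_vaffine a ltr01 mF) expr1n mul1r; apply: eq_cintegral => x.
rewrite mulrA -cisD; congr (cis _ * _).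
rewrite (_ : dot xi (vaffine a 1 x) = dot xi a + dot xi x); first by ring.
rewrite /dot -big_split; apply: eq_bigr => i _; rewrite /= tnth_mktuple; ring.
Qed.

(** This keeps one majorant for all the difference quotients. *)
Lemma decay_update x i r : `|r - tnth x i| <= 1 -> decay (update x i r) <= 3 * decay x.
Proof.
move=> hr; rewrite /decay (bigD1 i)//= [in leRHS](bigD1 i)//= mulrA.
rewrite tnth_update eqxx (eq_bigr (fun j => (1 + tnth x j ^+ 2)^-1)); last first.
  by move=> j ji; rewrite tnth_update (negbTE ji).
apply: ler_wpM2r; first by apply: prodr_ge0 => j _; rewrite invr_ge0 addr_ge0 ?sqr_ge0.
move: (tnth x i) hr => t; rewrite ler_norml => /andP[h1 h2].
have t0 : 0 < 1 + t ^+ 2 by rewrite ltr_pwDl ?sqr_ge0.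
have r0 : 0 < 1 + r ^+ 2 by rewrite ltr_pwDl ?sqr_ge0.
rewrite ler_pdivlMr// ler_pdivrMl//.
have := sqr_ge0 (2 * r - t); have : (r - t) ^+ 2 <= 1.
  have -> : (r - t) ^+ 2 = 1 - (1 - (r - t)) * (1 + (r - t)) by ring.
  by rewrite lerBlDr lerDl mulr_ge0//; lra.
by rewrite !expr2; nra.
Qed.

Lemma shift_update x i (h : R) : vaffine (update [tuple 0 | _ < d] i h) 1 x = update x i (tnth x i + h).
Proof.
apply: eq_from_tnth => j; rewrite !tnth_mktuple mul1r.
by case: (eqVneq j i) => [->|_]; rewrite ?tnth_mktuple ?add0r// addrC.
Qed.

(** Translate by 1/n along the axis and pass to the limit in the difference
    quotient. *)
Lemma fourier_partial phi i xi : schwartz phi ->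
  fourier (partial i phi) xi = (tnth xi i)%:C * 'i * fourier phi xi.
Proof.
move=> sphi; have iphi := schwartz_integrable sphi.
have sd := schwartz_partial i sphi; have id := schwartz_integrable sd.
have [B hB] := sd.2 (2 * d)%N.
have dB x : cabs (partial i phi x) <= B * decay x by exact: schwartz_decay.
have B0 : 0 <= B.
  have := le_trans (cabs_ge0 _) (dB [tuple 0 | _ < d]).
  by rewrite pmulr_lge0 ?decay_gt0.
pose a n : X := update [tuple 0 | _ < d] i n.+1%:R^-1.
pose D n x := n.+1%:R%:C * (phi (vaffine (a n) 1 x) - phi x).
have mphi := cintegrable_measurable iphi.
have ish n : cintegrable mu (fun x => phi (vaffine (a n) 1 x)).
  have [C hC] := sphi.2 (2 * d)%N.
  apply: (dominated_cintegrable (cmeasurable_comp (measurable_vaffine (a n) 1) mphi)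
    (integrable_mull (C * 3) measurableT (@integrable_decay R d))) => x.
  have h := schwartz_decay (vaffine (a n) 1 x) hC.
  apply: le_trans h _; rewrite shift_update -mulrA; apply: ler_wpM2l.
    have := le_trans (cabs_ge0 _) (schwartz_decay x hC).
    by rewrite pmulr_lge0 ?decay_gt0.
  by apply: decay_update; rewrite addrC addKr ger0_norm ?invr_ge0// invf_le1 ?ltr0n// ler1n.
have FD n : fourier (D n) xi = n.+1%:R%:C * (cis (tnth xi i * n.+1%:R^-1) - 1) * fourier phi xi.
  have -> : D n = (fun x => n.+1%:R%:C * phi (vaffine (a n) 1 x) + (- n.+1%:R%:C) * phi x).
    by apply/funext => x; rewrite /D mulrBr mulNr.
  rewrite fourier_linear//; last exact: cintegrableZ.
  rewrite fourier_translate//.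
  rewrite fourierZ//.
  rewrite (_ : dot xi (a n) = tnth xi i * n.+1%:R^-1); first by ring.
  rewrite /dot (bigD1 i)//= big1 ?addr0; last first.
    by move=> j ji; rewrite tnth_update (negbTE ji) tnth_mktuple mulr0.
  by rewrite tnth_update eqxx.
have Dle n x : cabs (D n x) <= 6 * B * decay x.
  have inv0 : 0 <= n.+1%:R^-1 :> R by rewrite invr_ge0.
  have inv1 : n.+1%:R^-1 <= 1 :> R by rewrite invf_le1 ?ltr0n// ler1n.
  have xi_n : tnth x i + n.+1%:R^-1 - tnth x i = n.+1%:R^-1 by ring.
  rewrite /D cabsM cabs_real ger0_norm// shift_update -[X in _ - phi X](update_id x i).
  have h : cabs (phi (update x i (tnth x i + n.+1%:R^-1)) - phi (update x i (tnth x i))) <=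
      2 * (B * (3 * decay x)) * `|tnth x i + n.+1%:R^-1 - tnth x i|.
    apply: (@mean_value_bound _ (fun r => phi (update x i r))) => r.
      exact: (has_partial_update (sphi.1 [::] i) x r).1.
    rewrite (has_partial_update (sphi.1 [::] i) x r).2 xi_n (ger0_norm inv0) => hr.
    apply: le_trans (dB _) _; apply: ler_wpM2l => //.
    by apply: decay_update; exact: le_trans hr inv1.
  apply: le_trans (ler_wpM2l (ler0n _ _) h) _.
  rewrite xi_n (ger0_norm inv0) mulrCA mulfV ?pnatr_eq0// mulr1.
  by rewrite le_eqVlt; apply/orP; left; apply/eqP; ring.
have cDx x : cabs (D n x - partial i phi x) @[n --> \oo] --> 0.
  have [e1 e2] := has_partial_update (sphi.1 [::] i) x (tnth x i).
  have := difference_quotient e1; rewrite e2 update_id.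
  by under eq_fun do rewrite -shift_update.
have mD n : cmeasurable (D n).
  rewrite /D; apply: cmeasurableM; first exact: cmeasurable_cst.
  apply: cmeasurableD; first exact: cintegrable_measurable (ish n).
  exact: cmeasurableN.
have md := cintegrable_measurable id.
have cD : cabs (fourier (D n) xi - fourier (partial i phi) xi) @[n --> \oo] --> 0.
  have mk : cmeasurable (fun x => cis (- dot xi x)).
    by apply: cmeasurable_cis; apply: measurableT_comp => //; exact: measurable_dot.
  have := @dominated_cvg_cintegral _ _ _ mu (fun n x => cis (- dot xi x) * D n x)
    (fun x => cis (- dot xi x) * partial i phi x) (fun x => 6 * B * decay x).
  have h1 n : cmeasurable (fun x => cis (- dot xi x) * D n x) by exact: cmeasurableM.
  have h2 : cmeasurable (fun x => cis (- dot xi x) * partial i phi x) by exact: cmeasurableM.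
  have h3 x : cabs (cis (- dot xi x) * D n x - cis (- dot xi x) * partial i phi x) @[n --> \oo] --> 0.
    by under eq_fun do rewrite -mulrBr cabs_cisM; exact: cDx.
  have h4 := integrable_mull (6 * B) measurableT (@integrable_decay R d).
  have h5 n x : cabs (cis (- dot xi x) * D n x) <= 6 * B * decay x by rewrite cabs_cisM.
  move=> /(_ h1 h2 h3 h4 h5) h6.
  have c00 : 0 <= c0 by exact/ltW/fourier_cst_gt0.
  apply: cvg_trans (@cvg0_scale c0 _ h6); apply: near_eq_cvg; apply: nearW => n.
  by rewrite /fourier -mulrBr cabsM cabs_real (ger0_norm c00).
apply: (ccvg_unique cD).
have [e1 e2] := @cderive_cis R 1 0 (tnth xi i) 0.
have := difference_quotient e1; rewrite e2 mulr0 addr0 cis0 mulr1.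
move=> h.
apply: cvg_trans (@cvg0_scale (cabs (fourier phi xi)) _ h); apply: near_eq_cvg; apply: nearW => n.
by rewrite FD -cabsM mulr1 !add0r mul1r; congr cabs; ring.
Qed.

End fourier_schwartz.

Section fourier_inversion.
Context {R : realType} {d : nat}.
Local Notation mu := (@lebesgue_Rd R d).
Local Notation X := (d.-tuple R).
Local Notation c0 := (@fourier_cst R d).
Implicit Types (f g phi psi : X -> R[i]) (x y xi : X) (i j : 'I_d).

Let oneBpartial2 i phi := (fun x => (-1) * partial i (partial i phi) x + phi x).

Let schwartz_oneBpartial2 i phi : schwartz phi -> schwartz (oneBpartial2 i phi).
Proof. by move=> h; apply: schwartz_linear => //; do 2 apply: schwartz_partial. Qed.

Let fourier_oneBpartial2 i phi xi : schwartz phi ->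
  fourier (oneBpartial2 i phi) xi = (1 + tnth xi i ^+ 2)%:C * fourier phi xi.
Proof.
move=> h; have h1 := schwartz_partial i h; have h2 := schwartz_partial i h1.
rewrite (fourier_linear (-1) xi (schwartz_integrable h2) (schwartz_integrable h)).
rewrite !fourier_partial// (mulrA (_ * 'i)) (mulrACA _ 'i) mulii -rmorphM /= rmorphD /= -expr2.
by rewrite rmorph1; move: (_%:C) (fourier phi xi) => a b; ring.
Qed.

(** Integrate by parts with 1 - d_i^2 once in each coordinate. *)
Lemma schwartz_fourier_integrable phi : schwartz phi -> cintegrable mu (fourier phi).
Proof.
move=> sphi; pose psi l := foldr oneBpartial2 phi l.
have spsi l : schwartz (psi l) by elim: l => //= i l IH; exact: schwartz_oneBpartial2.
have E l xi : fourier (psi l) xi = (\prod_(i <- l) (1 + tnth xi i ^+ 2))%:C * fourier phi xi.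
  elim: l => [|i l IH]; first by rewrite big_nil mul1r.
  by rewrite /= fourier_oneBpartial2// IH big_cons rmorphM /= mulrA.
have mphi := schwartz_measurable sphi.
pose l := index_enum 'I_d; pose K := c0 * \int[mu]_x cabs (psi l x).
apply: (dominated_cintegrable (cmeasurable_fourier mphi)
  (integrable_mull K measurableT (@integrable_decay R d))) => xi.
have := cabs_fourier_le xi (schwartz_integrable (spsi l)); rewrite -/K E cabsM cabs_real.
have p0 : 0 < \prod_(i <- l) (1 + tnth xi i ^+ 2).
  by apply: prodr_gt0 => i _; rewrite ltr_pwDl ?sqr_ge0.
by rewrite (ger0_norm (ltW p0)) /decay prodfV ler_pdivlMr// mulrC.
Qed.

Lemma schwartz_cvg_vaffine phi x w (c : nat -> R) : schwartz phi -> c n @[n --> \oo] --> 0 ->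
  cabs (phi (vaffine x (c n) w) - phi x) @[n --> \oo] --> 0.
Proof.
move=> /schwartz_lipschitz[C C0 CL] c0'; pose W := \sum_(i < d) `|tnth w i|.
have cN : `|c n| @[n --> \oo] --> 0 by apply/norm_cvg0P.
apply: (@squeeze_cvgr _ _ _ _ (fun=> 0) (fun n => (C * W) * `|c n|)).
- apply: nearW => n; rewrite cabs_ge0 /=; apply: le_trans (CL _ _) _.
  rewrite -[leRHS]mulrA; apply: ler_wpM2l => //; rewrite mulrC /W mulr_sumr.
  rewrite le_eqVlt; apply/orP; left; apply/eqP; apply: eq_bigr => i _; rewrite tnth_mktuple.
  by rewrite addrAC subrr add0r normrM.
- exact: cvg_cst.
- exact: (@cvg0_scale R (C * W) _ cN).
Qed.

(** Averages against a Gaussian of bounded functions that converge pointwise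
    to a constant. *)
Lemma cvg_gauss_average (F : nat -> X -> R[i]) (z : R[i]) (B : R) :
  (forall n, cmeasurable (F n)) -> (forall n w, cabs (F n w) <= B) ->
  (forall w, cabs (F n w - z) @[n --> \oo] --> 0) ->
  cabs (cintegral mu setT (fun w => (gaussd 1 w)%:C * F n w) -
        (Num.sqrt pi ^+ d)%:C * z) @[n --> \oo] --> 0.
Proof.
move=> mF FB Fz; have ig := @cintegrable_gaussd R d 1 ltr01.
have E : cintegral mu setT (fun w => (gaussd 1 w)%:C * z) = (Num.sqrt pi ^+ d)%:C * z.
  rewrite (eq_cintegral _ (fun w => mulrC (gaussd 1 w)%:C z)) cintegralZ// mulrC; congr (_ * _).
  have := @cintegral_gaussd R d 1 [tuple 0 | _ < d] ltr01.
  have e0 : dot [tuple 0 | _ < d] = (fun=> 0) :> (X -> R).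
    by apply/funext => x; apply: big1 => i _; rewrite tnth_mktuple mul0r.
  rewrite sqr_sqrtr ?dot_ge0// e0 mul0r oppr0 expR0 mulr1 divr1 => <-.
  by apply: eq_cintegral => x; rewrite cis0 mul1r.
rewrite -E; apply: (@dominated_cvg_cintegral _ _ _ mu _ _ (fun w => B * gaussd 1 w)).
- by move=> n; apply: cmeasurableM => //; exact: cintegrable_measurable ig.
- by apply: cmeasurableM; [exact: cintegrable_measurable ig|exact: cmeasurable_cst].
- move=> w; have := @cvg0_scale _ (gaussd 1 w) _ (Fz w).
  apply: cvg_trans; apply: near_eq_cvg; apply: nearW => n.
  by rewrite -mulrBr cabsM cabs_real ger0_norm// ltW// gaussd_gt0.
- by apply: (integrable_mull B measurableT); exact: ig.1.
- move=> n w; have g0 := ltW (gaussd_gt0 1 w).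
  by rewrite cabsM cabs_real (ger0_norm g0) mulrC; apply: ler_wpM2r.
Qed.

(** Damp the inversion integral by a wide Gaussian: by the multiplication
    formula it becomes an average of phi against a narrow one. *)
Lemma fourier_inversion phi x : schwartz phi -> inv_fourier (fourier phi) x = phi x.
Proof.
move=> sphi; have iphi := schwartz_integrable sphi; have iF := schwartz_fourier_integrable sphi.
have mphi := schwartz_measurable sphi; have mF := cintegrable_measurable iF.
pose dl n : R := n.+1%:R^-1.
have dl0 n : 0 < dl n by rewrite invr_gt0.
pose f n xi := cis (dot x xi) * (gaussd (dl n) xi)%:C.
have if_ n : cintegrable mu (f n).
  by apply: cis_cintegrableM; [exact: measurable_dot|exact: cintegrable_gaussd].
have Ff n y : fourier (f n) y = (c0 * (Num.sqrt pi / dl n) ^+ d)%:C *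
    (expR (- (enorm (vaffine x (-1) y) ^+ 2 / (4 * dl n ^+ 2))))%:C.
  rewrite /fourier /f rmorphM -mulrA; congr (_ * _).
  rewrite -rmorphM /= -cintegral_gaussd//; apply: eq_cintegral => xi.
  rewrite mulrA -cisD; congr (cis _ * _); rewrite /dot -sumrN -big_split.
  by apply: eq_bigr => i _; rewrite tnth_mktuple /=; ring.
pose k : R := c0 * (2 * Num.sqrt pi) ^+ d.
pose F n w := phi (vaffine x (2 * dl n) w).
have mFn n : cmeasurable (F n) by exact: (cmeasurable_comp (measurable_vaffine _ _) mphi).
have I1 n : cintegral mu setT (fun xi => f n xi * fourier phi xi) =
    k%:C * cintegral mu setT (fun w => (gaussd 1 w)%:C * F n w).
  rewrite multiplication_formula//.
  have ii : cintegrable mu (fun y => fourier (f n) y * phi y).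
    by have := cintegrable_mul_fourier iphi (if_ n); under eq_fun do rewrite mulrC.
  have s0 : 0 < 2 * dl n by rewrite mulr_gt0.
  rewrite (cintegral_vaffine x s0 (cintegrable_measurable ii)).
  have [B FB] := schwartz_bounded sphi.
  have ig : cintegrable mu (fun w => (gaussd 1 w)%:C * F n w).
    have := bounded_cintegrableM (mFn n) (fun w => FB _) (@cintegrable_gaussd R d 1 ltr01).
    by under eq_fun do rewrite mulrC.
  rewrite (_ : cintegral _ _ _ = (c0 * (Num.sqrt pi / dl n) ^+ d)%:C *
    cintegral mu setT (fun w => (gaussd 1 w)%:C * F n w)).
    rewrite mulrA -rmorphM /=; congr (_%:C * _); rewrite /k mulrCA -exprMn.
    by congr (_ * _ ^+ _); field; rewrite gt_eqF.
  rewrite -cintegralZ//; apply: eq_cintegral => w; rewrite Ff -mulrA; congr (_ * (_%:C * _)).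
  rewrite /gaussd expr1n mul1r; congr expR; congr (- _).
  rewrite !sqr_enorm mulr_suml; apply: eq_bigr => i _; rewrite !tnth_mktuple.
  by field; rewrite gt_eqF.
have L1 : cabs (cintegral mu setT (fun xi => f n xi * fourier phi xi) -
    (k * Num.sqrt pi ^+ d)%:C * phi x) @[n --> \oo] --> 0.
  have [B FB] := schwartz_bounded sphi.
  have cF w : cabs (F n w - phi x) @[n --> \oo] --> 0.
    by apply: schwartz_cvg_vaffine => //; exact: (@cvg0_scale R 2 _ (@cvg_invnS R)).
  have h := @cvg_gauss_average F (phi x) B mFn (fun n w => FB _) cF.
  apply: cvg_trans (@cvg0_scale _ (cabs k%:C) _ h); apply: near_eq_cvg; apply: nearW => n.
  by rewrite I1 -cabsM mulrBr mulrA -rmorphM.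
have L2 : cabs (cintegral mu setT (fun xi => f n xi * fourier phi xi) -
    cintegral mu setT (fun xi => cis (dot x xi) * fourier phi xi)) @[n --> \oo] --> 0.
  apply: (@dominated_cvg_cintegral _ _ _ mu _ _ (fun xi => cabs (fourier phi xi))).
  - by move=> n; apply: cmeasurableM => //; exact: cintegrable_measurable.
  - by apply: cmeasurableM => //; apply: cmeasurable_cis; exact: measurable_dot.
  - move=> xi; have g1 : gaussd (dl n) xi @[n --> \oo] --> (1 : R).
      rewrite -(expR0 R); apply: continuous_cvg; first exact: continuous_expR.
      rewrite -oppr0; apply: cvgN; rewrite -(mul0r (enorm xi ^+ 2)); apply: cvgM; last exact: cvg_cst.
      by rewrite -(mul0r 0) (_ : 0 * 0 = 0 * 0 :> R)//; apply: cvgM; exact: cvg_invnS.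
    have g2 : `|gaussd (dl n) xi - 1| @[n --> \oo] --> 0 by apply/norm_cvg0P/subr_cvg0.
    apply: cvg_trans (@cvg0_scale _ (cabs (fourier phi xi)) _ g2); apply: near_eq_cvg.
    apply: nearW => n; rewrite -cabs_real -cabsM rmorphB rmorph1 /f.
    rewrite -(cabs_cisM (dot x xi)); congr cabs; move: (fourier phi xi) => F0; ring.
  - exact: integrable_cabs.
  - move=> n xi; have g0 := ltW (gaussd_gt0 (dl n) xi).
    rewrite /f -mulrA cabs_cisM cabsM cabs_real (ger0_norm g0).
    by apply: ler_piMl; [exact: cabs_ge0|exact: gaussd_le1].
rewrite /inv_fourier (ccvg_unique L2 L1) mulrA -rmorphM /= (_ : c0 * _ = 1) ?mul1r//.
have tp : 0 < 2 * pi :> R by rewrite mulr_gt0// pi_gt0.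
rewrite /k /fourier_cst (_ : _ * _ = ((2 * pi) `^ (- (d%:R / 2)) * (2 * pi) `^ (- (d%:R / 2))) *
   (2 * Num.sqrt pi * Num.sqrt pi) ^+ d); last by rewrite [in RHS]exprMn; ring.
rewrite -(mulrA 2) -(expr2 (Num.sqrt pi)) sqr_sqrtr ?pi_ge0// -powR_mulrn; last exact: ltW.
rewrite -!powRD; try by apply/implyP => _; rewrite gt_eqF.
by rewrite (_ : _ + _ = 0) ?powRr0//; field.
Qed.

End fourier_inversion.

(** * Uniqueness of the Fourier transform of a distribution *)

Section tensor_gaussian.
Context {R : realType} {d : nat}.
Local Notation X := (d.-tuple R).
Variables (m : R) (a : X).
Hypothesis m0 : 0 <= m.
Implicit Types (x : X) (i j : 'I_d) (p : {poly R}) (P : 'I_d -> {poly R}).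

Let ex2P (T : Type) (A B : T -> Prop) : (exists2 z, A z & B z) -> exists z, A z /\ B z.
Proof. by case=> z; exists z. Qed.

Let bump (c r : R) := expR (- (r ^+ 2 + m * (r - c) ^+ 2)).

Definition gauss_tensor P x : R[i] :=
  (\prod_(i < d) ((P i).[tnth x i] * bump (tnth a i) (tnth x i)))%:C.

Let dpoly (c : R) p := p^`() - (2%:P * 'X + (2 * m)%:P * ('X - c%:P)) * p.
Let dtensor i P := fun j => if j == i then dpoly (tnth a i) (P i) else P j.

Let is_derive_factor (c : R) p (r : R) :
  is_derive r 1 (fun r => p.[r] * bump c r) ((dpoly c p).[r] * bump c r).
Proof.
have dp : is_derive r 1 (horner p) (p^`()).[r] by exact: is_derive_poly.
rewrite /bump; apply: is_derive_eq; rewrite /dpoly !hornerE /GRing.scale /=.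
move: (expR _) p.[r] p^`().[r] => u v w; ring.
Qed.

Let partial_gauss_tensor i P x : has_partial i (gauss_tensor P) x /\
  partial i (gauss_tensor P) x = gauss_tensor (dtensor i P) x.
Proof.
pose c := \prod_(j < d | j != i) ((P j).[tnth x j] * bump (tnth a j) (tnth x j)).
apply: is_derive_cderivable; last first.
  have -> : (fun t => complex.Im (gauss_tensor P (update x i t))) = (fun=> 0) by [].
  exact: is_derive_cst.
have -> : (fun t => complex.Re (gauss_tensor P (update x i t))) =
    (fun t => c * ((P i).[t] * bump (tnth a i) t)).
  apply/funext => t; rewrite /gauss_tensor /= (bigD1 i)//= tnth_update eqxx mulrC; congr (_ * _).
  by apply: eq_bigr => j ji; rewrite tnth_update (negbTE ji).
have -> : complex.Re (gauss_tensor (dtensor i P) x) =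
    c * ((dpoly (tnth a i) (P i)).[tnth x i] * bump (tnth a i) (tnth x i)).
  rewrite /gauss_tensor /= (bigD1 i)//= /dtensor eqxx mulrC; congr (_ * _).
  by apply: eq_bigr => j ji; rewrite (negbTE ji).
have h := is_derive_factor (tnth a i) (P i) (tnth x i).
by apply: is_derive_eq; rewrite /GRing.scale /=; ring.
Qed.

Let iter_gauss_tensor l P : exists Q, iter_partial l (gauss_tensor P) = gauss_tensor Q.
Proof.
elim: l => [|i l [Q E]]; first by exists P.
by exists (dtensor i Q); rewrite /= E; apply/funext => x; exact: (partial_gauss_tensor i Q x).2.
Qed.

Let factor_bounded (k : nat) (c : R) p : exists2 B : R, 0 <= B &
  forall r, (1 + `|r|) ^+ k * `|p.[r] * bump c r| <= B.
Proof.
pose C := \sum_(j < size p) `|p`_j|; pose M := (k + size p)%N.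
have C0 : 0 <= C by apply: sumr_ge0.
exists (C * expR (M%:R ^+ 2)); first by rewrite mulr_ge0// expR_ge0.
move=> r; have s1 : 1 <= 1 + `|r| by rewrite lerDl.
have s0 : 0 <= 1 + `|r| by exact: le_trans s1.
have hp : `|p.[r]| <= C * (1 + `|r|) ^+ size p.
  rewrite horner_coef mulr_suml; apply: le_trans (ler_norm_sum _ _ _) _.
  apply: ler_sum => j _; rewrite normrM; apply: ler_wpM2l => //; rewrite normrX.
  apply: (@le_trans _ _ ((1 + `|r|) ^+ j)); first by rewrite lerXn2r ?nnegrE// lerDr.
  by apply: ler_weXn2l => //; exact: ltnW (ltn_ord j).
rewrite normrM (ger0_norm (expR_ge0 _)).
apply: (@le_trans _ _ ((1 + `|r|) ^+ k * (C * (1 + `|r|) ^+ size p * bump c r))).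
  apply: ler_wpM2l; first by rewrite exprn_ge0.
  by apply: ler_wpM2r => //; exact: expR_ge0.
rewrite (_ : _ * _ = C * ((1 + `|r|) ^+ M * bump c r)); last by rewrite /M exprD; ring.
apply: ler_wpM2l => //.
apply: (@le_trans _ _ (expR (`|r| *+ M) * bump c r)).
  apply: ler_wpM2r; first exact: expR_ge0.
  by rewrite -mulr_natl expRM_natl lerXn2r ?nnegrE ?expR_ge0// expR_ge1Dx.
rewrite -expRD ler_expR -[`|r| *+ M]mulr_natl -(real_normK (num_real r)).
have q0 : 0 <= m * (r - c) ^+ 2 by rewrite mulr_ge0// sqr_ge0.
by move: (M%:R : R) `|r| (m * _) q0 => u v w q0; have := sqr_ge0 (u - v); have := sqr_ge0 u;
   have := sqr_ge0 v; rewrite !expr2; nra.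
Qed.

Let enorm_le_prod x : 1 + enorm x <= \prod_(i < d) (1 + `|tnth x i|).
Proof.
have h1 : enorm x <= \sum_(i < d) `|tnth x i|.
  rewrite -(ler_pXn2r (n := 2))// ?nnegrE ?enorm_ge0 ?sumr_ge0// sqr_enorm expr2 mulr_suml.
  apply: ler_sum => i _; rewrite -(real_normK (num_real (tnth x i))) expr2; apply: ler_wpM2l => //.
  by rewrite (bigD1 i)//= lerDl sumr_ge0.
apply: (@le_trans _ _ (1 + \sum_(i < d) `|tnth x i|)); first by rewrite lerD2l.
suff [] : 0 <= \sum_(i < d) `|tnth x i| /\
  1 + \sum_(i < d) `|tnth x i| <= \prod_(i < d) (1 + `|tnth x i|) by [].
elim/big_rec2: _ => [|i u v _ [h1' h2]]; first by rewrite addr0.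
have u0 := normr_ge0 (tnth x i); move: (`|_|) u0 => t t0; split; first by rewrite addr_ge0.
have u1 : 0 <= u - 1 by lra.
by have := mulr_ge0 t0 u1; lra.
Qed.

Let gauss_tensor_bounded (N : nat) P : exists2 B : R, 0 <= B &
  forall k x, (k <= N)%N -> (1 + enorm x) ^+ k * cabs (gauss_tensor P x) <= B.
Proof.
have /choice[B hB] i := ex2P (factor_bounded N (tnth a i) (P i)).
exists (\prod_(i < d) B i); first by apply: prodr_ge0 => i _; case: (hB i).
move=> k x kN; have s0 : 0 <= 1 + enorm x by rewrite addr_ge0 ?enorm_ge0.
apply: (@le_trans _ _ ((\prod_(i < d) (1 + `|tnth x i|)) ^+ N * cabs (gauss_tensor P x))).
  apply: ler_wpM2r; first exact: cabs_ge0.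
  apply: (@le_trans _ _ ((1 + enorm x) ^+ N)).
    by apply: ler_weXn2l => //; rewrite lerDl enorm_ge0.
  by rewrite lerXn2r ?nnegrE// ?enorm_le_prod// prodr_ge0// => i _; rewrite addr_ge0.
rewrite /gauss_tensor cabs_real normr_prod -prodrXl -big_split /=.
apply: ler_prod => i _; rewrite mulr_ge0 ?exprn_ge0 ?addr_ge0//=.
by case: (hB i).
Qed.

(** The partial derivatives of a product of functions P(r) exp(- q(r)), with q
    quadratic, have the same form; each factor is bounded together with all
    its products by powers of r. *)
Lemma schwartz_gauss_tensor P : schwartz (gauss_tensor P).
Proof.
split=> [l i x|N].
  have [Q ->] := iter_gauss_tensor l P; exact: (partial_gauss_tensor i Q x).1.
suff h n Q : exists2 B : R, 0 <= B & forall l k x, (size l <= n)%N -> (k <= N)%N ->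
    (1 + enorm x) ^+ k * cabs (iter_partial l (gauss_tensor Q) x) <= B.
  by have [B _ hB] := h N P; exists B.
elim: n Q => [|n IH] Q.
  have [B B0 hB] := gauss_tensor_bounded N Q; exists B => // l k x.
  by rewrite leqn0 size_eq0 => /eqP -> kN; exact: hB.
have [B B0 hB] := gauss_tensor_bounded N Q.
have /choice[C hC] i := ex2P (IH (dtensor i Q)).
have C0 i : 0 <= C i by case: (hC i).
exists (B + \sum_(i < d) C i); first by rewrite addr_ge0// sumr_ge0.
move=> l k x; case/lastP: l => [_ kN|l i].
  by apply: le_trans (hB k x kN) _; rewrite lerDl sumr_ge0.
rewrite size_rcons ltnS => ln kN.
rewrite /iter_partial foldr_rcons -/(iter_partial _ _).
have -> : partial i (gauss_tensor Q) = gauss_tensor (dtensor i Q).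
  by apply/funext => y; exact: (partial_gauss_tensor i Q y).2.
apply: le_trans ((hC i).2 l k x ln kN) _.
by rewrite (bigD1 i)//= addrCA lerDl addr_ge0// sumr_ge0.
Qed.

End tensor_gaussian.

Section boxes.
Context {R : realType} {d : nat}.
Local Notation mu := (@lebesgue_Rd R d).
Local Notation X := (d.-tuple R).
Implicit Types (x b : X).

Definition box b : set X := [set x | forall i, tnth x i < tnth b i].

Lemma measurable_box b : measurable (box b).
Proof.
have -> : box b = \bigcap_(i in [set: 'I_d]) [set x : X | tnth x i < tnth b i].
  by apply/seteqP; split => x h i; [move=> _|]; exact: h.
apply: fin_bigcap_measurable; first exact: finite_finset.
move=> i _.
have m1 : measurable_fun setT (fun x : X => tnth x i : measurableTypeR R).
  exact: measurable_tnth.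
have := m1 measurableT _ (measurable_itv `]-oo, tnth b i[).
by rewrite setTI; congr measurable; apply/seteqP; split => x; rewrite /= in_itv.
Qed.

Let top_box (n : nat) : X := [tuple n%:R | _ < d].

Lemma in_top_box x : \forall n \near \oo, box (top_box n) x.
Proof.
exists (Num.bound (enorm x)) => // n /= hn i; rewrite tnth_mktuple.
apply: (le_lt_trans (le_trans (ler_norm _) (normr_tnth_le x i))).
by apply: lt_le_trans (archi_boundP (enorm_ge0 x)) _; rewrite ler_nat.
Qed.

Lemma boxes_generate : @measurable _ X = <<s range box >>.
Proof.
apply/seteqP; split; last first.
  apply: smallest_sub; first exact: sigma_algebra_measurable.
  by move=> _ [b _ <-]; exact: measurable_box.
have : measurable_fun setT (id : g_sigma_algebraType (range box) -> X).
  apply/measurable_fun_tnthP => i.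
  apply: (@measurability _ _ _ _ _ _ (@RGenInftyO.G R)); first exact: RGenInftyO.measurableE.
  move=> _ [_ [y ->] <-]; rewrite setTI.
  have -> : (@tnth d R ^~ i \o id) @^-1` `]-oo, y[%classic =
      \bigcup_n box (update (top_box n) i y).
    apply/seteqP; split => x /=; rewrite in_itv /=.
      move=> xy; have [n _ hn] := in_top_box x; exists n => // j; rewrite tnth_update.
      by case: (eqVneq j i) => [->//|ji]; exact: (hn n (leqnn _) j).
    by move=> [n _ /(_ i)]; rewrite tnth_update eqxx.
  by apply: bigcupT_measurable => n; apply: sub_sigma_algebra; exists (update (top_box n) i y).
by move=> mid A mA; have := mid measurableT A mA; rewrite setTI.
Qed.

(** Boxes form a pi-system that generates the Borel sets. *)
Lemma ae_eq0_boxes (f : X -> R) : mu.-integrable setT (EFin \o f) ->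
  (forall b, \int[mu]_(x in box b) f x = 0) -> {ae mu, forall x, f x = 0}.
Proof.
move=> fi f0.
have fA A : measurable A -> mu.-integrable A (EFin \o f).
  by move=> mA; exact: (integrableS measurableT mA (@subsetT _ _) fi).
have EB b : (\int[mu]_(x in box b) (f x)%:E = 0)%E.
  rewrite -[LHS]fineK; first by rewrite -/(Rintegral _ _ _) f0.
  exact: (integrable_fin_num (measurable_box b) (fA _ (measurable_box b))).
have ET : (\int[mu]_x (f x)%:E = 0)%E.
  rewrite -[LHS]fineK; last exact: (integrable_fin_num measurableT fi).
  congr (_%:E); rewrite -/(Rintegral _ _ _).
  have h1 n : measurable_fun setT (f \_ (box (top_box n))).
    apply/(measurable_restrictT _ (measurable_box _)).
    by apply: measurable_funTS; apply/measurable_EFinP; exact: measurable_int fi.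
  have h2 x : (f \_ (box (top_box n))) x @[n --> \oo] --> f x.
    apply: cvg_near_cst; apply: filterS (in_top_box x) => n xn; rewrite patchE mem_set//.
  have h3 n x : `|(f \_ (box (top_box n))) x| <= `|f x|.
    by rewrite patchE; case: ifP => // _; rewrite normr0.
  have [_ h] := dominated_cvg_Rintegral measurableT h1 (fun x _ => h2 x)
    (integrable_normr fi) (fun n x _ => h3 n x).
  apply: (cvg_unique _ h) => //; apply: cvg_near_cst; apply: nearW => n.
  by rewrite -Rintegral_mkcond f0.
suff h A : measurable A -> (\int[mu]_(x in A) (EFin \o f) x = 0)%E.

  have m0 : measurable_fun setT (cst 0%E : X -> \bar R) by exact: measurable_cst.
  have E A : A `<=` setT -> measurable A ->
      (\int[mu]_(x in A) (EFin \o f) x = \int[mu]_(x in A) (cst 0%E : X -> \bar R) x)%E.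
    by move=> _ mA; rewrite [LHS]h//= integral0.
  have := integral_ae_eq measurableT fi m0 E.
  by apply: filterS => x /= /(_ I)[].
have := @dynkin_induction _ X (range box) (fun A => (\int[mu]_(x in A) (f x)%:E = 0)%E)
  boxes_generate.
rewrite -boxes_generate; apply => //.
- move=> _ _ [b _ <-] [c _ <-]; exists [tuple Order.min (tnth b i) (tnth c i) | i < d] => //.
  apply/seteqP; split => x /=.
    by move=> h; split => i; move: (h i); rewrite tnth_mktuple lt_min => /andP[].
  by move=> [h1 h2] i; rewrite tnth_mktuple lt_min h1 h2.
- by move=> _ [b _ <-].
- move=> S mS S0; have mC := measurableC mS.
  have := ET; rewrite -(setUv S) integral_setU//; last by apply/disj_setPS; rewrite setICr.
    by rewrite S0 add0e.
  by rewrite setUv; exact: measurable_int fi.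
- move=> F mF tF F0; rewrite integral_bigcup//; last exact/fA/bigcupT_measurable.
  by rewrite eseries0.
Qed.

End boxes.

Section uniqueness.
Context {R : realType} {d : nat}.
Local Notation mu := (@lebesgue_Rd R d).
Local Notation X := (d.-tuple R).
Implicit Types (f g h phi psi : X -> R[i]) (x a b w : X).

Let heat (m : R) x a : R := expR (- (m * \sum_(i < d) (tnth x i - tnth a i) ^+ 2)).

Let measurable_heat m : measurable_fun setT (fun p : X * X => heat m p.1 p.2).
Proof.
apply: measurableT_comp => //; apply: measurableT_comp => //.
apply: measurable_funM => //; apply: measurable_sum => i; apply: measurable_funX.
apply: measurable_funB.
  exact: (measurableT_comp (measurable_tnth i) measurable_fst).
exact: (measurableT_comp (measurable_tnth i) measurable_snd).
Qed.

Let heat_le1 m x a : 0 <= m -> heat m x a <= 1.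
Proof.
move=> m0; rewrite -[leRHS](expR0 R) ler_expR oppr_le0 mulr_ge0// sumr_ge0// => i _.
exact: sqr_ge0.
Qed.

Let gauss_tensor1 m a x :
  gauss_tensor m a (fun=> 1) x = (gaussd 1 x)%:C * (heat m x a)%:C.
Proof.
rewrite -rmorphM /= /gauss_tensor; congr (_%:C).
under eq_bigr do rewrite hornerC mul1r.
rewrite -expR_sum /gaussd /heat -expRD; congr expR.
by rewrite sumrN big_split /= -mulr_sumr -sqr_enorm; ring.
Qed.

(** Testing against narrow Gaussians centered at all points of a box, and
    weighting the centers, gives the integral over the box. The margin by
    which the box is shrunk tends to 0 more slowly than the width of the
    Gaussians, so that nothing is left on its boundary. *)
Lemma schwartz_test_box h b : cmeasurable h ->
  (forall phi, schwartz phi -> cintegrable mu (fun x => h x * phi x) /\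
     cintegral mu setT (fun x => h x * phi x) = 0) ->
  cintegrable mu (fun x => h x * (gaussd 1 x)%:C) /\
  cintegral mu setT (fun x => h x * (gaussd 1 x)%:C * (\1_(box b) x * gaussd 1 x)%:C) = 0.
Proof.
move=> mh h0; pose H x := h x * (gaussd 1 x)%:C.
have test m a : 0 <= m -> cintegrable mu (fun x => H x * (heat m x a)%:C) /\
    cintegral mu setT (fun x => H x * (heat m x a)%:C) = 0.
  move=> m0; have := h0 _ (schwartz_gauss_tensor a m0 (fun=> 1)).
  by rewrite (_ : (fun x => _ * gauss_tensor _ _ _ x) = (fun x => H x * (heat m x a)%:C))//;
    apply/funext => x; rewrite gauss_tensor1 mulrA.
have iH : cintegrable mu H.
  have [+ _] := test 0 [tuple 0 | _ < d] (lexx 0).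
  by under eq_fun do rewrite /heat mul0r oppr0 expR0 mulr1.
have mH := cintegrable_measurable iH.
split => //.
pose e n : R := n.+1%:R^-1; have e0 n : 0 < e n by rewrite invr_gt0.
pose dl n := e n ^+ 2; have dl0 n : 0 < dl n by rewrite exprn_gt0.
pose m n := (dl n ^+ 2)^-1.
have m0 n : 0 <= m n by rewrite invr_ge0 ltW// exprn_gt0.
pose B n : set X := box [tuple tnth b i - e n | i < d].
pose W n a : R := \1_(B n) a * gaussd 1 a.
have mW n : measurable_fun setT (W n).
  by apply: measurable_funM; [apply: measurable_indic; exact: measurable_box|exact: measurable_gaussd].
have g0 x : 0 <= gaussd 1 x :> R by exact: expR_ge0.
have W0 n a : 0 <= W n a by rewrite mulr_ge0.
have Wg n a : W n a <= gaussd 1 a.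
  by rewrite ler_piMl// indicE; case: (_ \in _).
have iW n : cintegrable mu (fun a => (W n a)%:C).
  apply: (dominated_cintegrable (cmeasurable_real (mW n)) (@cintegrable_gaussd R d 1 ltr01).1) => a.
  by rewrite cabs_real ger0_norm.
have [ig _] := @cintegrable_gaussd R d 1 ltr01.
pose A n x := cintegral mu setT (fun a => (heat (m n) x a)%:C * ((dl n ^- d)%:C * (W n a)%:C)).
have mk n : cmeasurable (fun p : X * X => (heat (m n) p.1 p.2)%:C).
  by apply: cmeasurable_real; exact: measurable_heat.
have k1 n x a : cabs (heat (m n) x a)%:C <= 1.
  by rewrite cabs_real ger0_norm ?expR_ge0// heat_le1.
have mA n : cmeasurable (A n).
  have m1 : cmeasurable (fun p : X * X => (heat (m n) p.1 p.2)%:C * ((dl n ^- d)%:C * (W n p.2)%:C)).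
    apply: cmeasurableM => //; apply: cmeasurableM; first exact: cmeasurable_cst.
    exact: (cmeasurable_comp measurable_snd (cmeasurable_real (mW n))).
  exact: (cmeasurable_cintegral_param (sf_lebesgue_Rd d) m1).
have iA n x : cintegrable mu (fun a => (heat (m n) x a)%:C * ((dl n ^- d)%:C * (W n a)%:C)).
  apply: (@bounded_cintegrableM _ _ _ _ _ _ 1 _ (k1 n x)); last exact: cintegrableZ.
  exact: (cmeasurable_comp (pair1_measurable _) (mk n)).
have W1 n a : W n a <= 1 by exact: le_trans (Wg n a) (gaussd_le1 _ _).
have mWv n x : cmeasurable (fun w => (W n (vaffine x (dl n) w))%:C).
  exact: (cmeasurable_comp (measurable_vaffine x (dl n)) (cmeasurable_real (mW n))).
have Gle n x w : cabs ((gaussd 1 w)%:C * (W n (vaffine x (dl n) w))%:C) <= gaussd 1 w.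
  by rewrite cabsM !cabs_real !ger0_norm// ler_piMr.
have iG n x : cintegrable mu (fun w => (gaussd 1 w)%:C * (W n (vaffine x (dl n) w))%:C).
  apply: (dominated_cintegrable _ ig (Gle n x)).
  by apply: cmeasurableM => //; apply: cmeasurable_real; exact: measurable_gaussd.
have AE n x : A n x = cintegral mu setT (fun w => (gaussd 1 w)%:C * (W n (vaffine x (dl n) w))%:C).
  rewrite /A (cintegral_vaffine x (dl0 n) (cintegrable_measurable (iA n x))).
  have hE w : heat (m n) x (vaffine x (dl n) w) = gaussd 1 w.
    rewrite /heat /gaussd; congr expR; congr (- _).
    rewrite expr1n mul1r sqr_enorm mulr_sumr; apply: eq_bigr => i _; rewrite tnth_mktuple.
    by rewrite /m; field; rewrite gt_eqF.
  rewrite (eq_cintegral _ (g := fun w => (dl n ^- d)%:C *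
    ((gaussd 1 w)%:C * (W n (vaffine x (dl n) w))%:C))); last by move=> w; rewrite hE mulrCA.
  rewrite cintegralZ// mulrA -rmorphM /= mulfV ?mul1r//.
  by rewrite expf_neq0// gt_eqF.
have A0 n : cintegral mu setT (fun x => H x * A n x) = 0.
  pose F (p : X * X) := (heat (m n) p.1 p.2)%:C * (H p.1 * ((dl n ^- d)%:C * (W n p.2)%:C)).
  pose M := @sf_lebesgue_Rd R d.
  have iF : cintegrable (M \x M)%E F.
    apply: (@bounded_cintegrableM _ _ _ _ _ _ 1 (mk n)); first by move=> p; exact: k1.
    have iW' := cintegrableZ (dl n ^- d)%:C (iW n).
    exact: (@cintegrable_tensor _ _ _ _ _ M M H (fun a => (dl n ^- d)%:C * (W n a)%:C)).
  have i1 x : cintegrable M (fun a => F (x, a)).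
    have := cintegrableZ (H x) (iA n x).
    by under eq_fun do rewrite mulrCA.
  have i2 a : cintegrable M (fun x => F (x, a)).
    have := cintegrableZ ((dl n ^- d)%:C * (W n a)%:C) (test (m n) a (m0 n)).1.
    rewrite (_ : (fun x => _) = (fun x => F (x, a)))//; apply/funext => x; rewrite /F /=; ring.
  have E1 x : H x * A n x = cintegral M setT (fun a => F (x, a)).
    rewrite /A -cintegralZ//; apply: eq_cintegral => a.
    by rewrite /F /= mulrCA.
  have E2 a : cintegral M setT (fun x => F (x, a)) = 0.
    have [j1 j2] := test (m n) a (m0 n).
    rewrite -(mulr0 ((dl n ^- d)%:C * (W n a)%:C)) -j2 -cintegralZ//; apply: eq_cintegral => x.
    rewrite /F /=; ring.
  apply: etrans (eq_cintegral M E1) _; apply: etrans (cfubini iF i1 i2) _.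
  apply: etrans (eq_cintegral M E2) _.
  by apply: complexP; rewrite /= /Rintegral integral0.
pose K := \int[mu]_w gaussd 1 w.
have AK n x : cabs (A n x) <= K.
  rewrite AE; apply: le_trans (cabs_cintegral_le (iG n x)) _.
  by apply: le_Rintegral => //; exact: integrable_cabs.
have cA x : cabs (A n x - (Num.sqrt pi ^+ d)%:C * (\1_(box b) x * gaussd 1 x)%:C) @[n --> \oo] --> 0.
  under eq_fun do rewrite AE.
  apply: (@cvg_gauss_average _ _ (fun n w => (W n (vaffine x (dl n) w))%:C) _ 1).
  - by move=> n; exact: mWv.
  - by move=> n w; rewrite cabs_real ger0_norm.
  - move=> w; have ce : e n @[n --> \oo] --> 0 by exact: cvg_invnS.
    have cdl : dl n @[n --> \oo] --> 0.
      by rewrite -(mul0r 0) /dl; under eq_fun do rewrite expr2; exact: cvgM.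
    have cg : gaussd 1 (vaffine x (dl n) w) @[n --> \oo] --> gaussd 1 x.
      have := schwartz_cvg_vaffine x w (schwartz_gauss_tensor x (lexx 0) (fun=> 1)) cdl.
      move=> h1; apply/subr_cvg0/norm_cvg0P; apply: cvg_trans h1; apply: near_eq_cvg.
      apply: nearW => n; rewrite !gauss_tensor1 /heat !mul0r oppr0 expR0 !mulr1 -cabs_real.
      by rewrite rmorphB.
    have c1 : (\1_(B n) (vaffine x (dl n) w) : R) @[n --> \oo] --> (\1_(box b) x : R).
      apply: cvg_near_cst; have [xb|xb] := pselect (box b x).
        have : \forall n \near \oo, forall i, tnth w i * dl n + e n < tnth b i - tnth x i.
          apply: filter_forall => i.
          have ci : tnth w i * dl n + e n @[n --> \oo] --> (0 : R).
            rewrite -[X in _ --> X]addr0; apply: cvgD => //.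
            exact: (@cvg0_scale _ (tnth w i) _ cdl).
          by apply: (cvgr_lt 0 ci); rewrite subr_gt0; exact: xb.
        apply: filterS => n hn; rewrite !indicE mem_set ?mem_set// => i.
        by rewrite !tnth_mktuple; have := hn i; rewrite mulrC => hi; lra.
      have [i xi] : exists i, tnth b i <= tnth x i.
        apply: contrapT => nx; apply: xb => i; rewrite ltNge; apply/negP => bi; apply: nx.
        by exists i.
      have : \forall n \near \oo, - tnth w i * e n < 1.
        by apply: (cvgr_lt 0 (@cvg0_scale _ (- tnth w i) _ ce)).
      apply: filterS => n hn; rewrite !indicE [x \in _]memNset// memNset// => /(_ i).
      rewrite !tnth_mktuple; have := e0 n; rewrite /dl; nra.
    have h2 : \1_(B n) (vaffine x (dl n) w) * gaussd 1 (vaffine x (dl n) w) @[n --> \oo] -->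
        \1_(box b) x * gaussd 1 x by exact: cvgM.
    have h3 : `|\1_(B n) (vaffine x (dl n) w) * gaussd 1 (vaffine x (dl n) w) -
        \1_(box b) x * gaussd 1 x| @[n --> \oo] --> 0 by apply/norm_cvg0P/subr_cvg0.
    apply: cvg_trans h3; apply: near_eq_cvg; apply: nearW => n.
    by rewrite -rmorphB cabs_real.
have L : cabs (cintegral mu setT (fun x => H x * A n x) - cintegral mu setT (fun x => H x *
     ((Num.sqrt pi ^+ d)%:C * (\1_(box b) x * gaussd 1 x)%:C))) @[n --> \oo] --> 0.
  apply: (@dominated_cvg_cintegral _ _ _ mu _ _ (fun x => K * cabs (H x))).
  - by move=> n; exact: cmeasurableM.
  - apply: cmeasurableM => //; apply: cmeasurableM; first exact: cmeasurable_cst.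
    apply: cmeasurable_real; apply: measurable_funM; last exact: measurable_gaussd.
    by apply: measurable_indic; exact: measurable_box.
  - move=> x; apply: cvg_trans (@cvg0_scale _ (cabs (H x)) _ (cA x)); apply: near_eq_cvg.
    by apply: nearW => n; rewrite -cabsM mulrBr.
  - by apply: (integrable_mull K measurableT); exact: integrable_cabs.
  - by move=> n x; rewrite cabsM mulrC; apply: ler_wpM2r; [exact: cabs_ge0|exact: AK].
have L0 : cabs (cintegral mu setT (fun x => H x * A n x) - 0) @[n --> \oo] --> 0.
  by apply: cvg_near_cst; apply: nearW => n; rewrite A0 subrr cabs0.
have := ccvg_unique L0 L.
rewrite (eq_cintegral _ (g := fun x => (Num.sqrt pi ^+ d)%:C *
    (H x * (\1_(box b) x * gaussd 1 x)%:C))); last by move=> x; rewrite mulrCA.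
rewrite cintegralZ; first by move/esym/eqP; rewrite mulf_eq0 => /orP[|/eqP//];
  rewrite -cabs_eq0 cabs_real normr_eq0 expf_eq0 sqrtr_eq0 leNgt pi_gt0 andbF.
under eq_fun do rewrite mulrC; apply: (bounded_cintegrableM (B := 1) _ _ iH).
  apply: cmeasurable_real; apply: measurable_funM; last exact: measurable_gaussd.
  by apply: measurable_indic; exact: measurable_box.
move=> x; rewrite cabs_real ger0_norm ?mulr_ge0// mulr_ile1// ?gaussd_le1//.
Qed.

(** The Gaussian factors make h integrable and vanish nowhere. *)
Lemma schwartz_test_eq0 h : cmeasurable h ->
  (forall phi, schwartz phi -> cintegrable mu (fun x => h x * phi x) /\
     cintegral mu setT (fun x => h x * phi x) = 0) ->
  {ae mu, forall x, h x = 0}.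
Proof.
move=> mh h0; pose K x := h x * (gaussd 1 x)%:C * (gaussd 1 x)%:C.
have iH := (schwartz_test_box [tuple 0 | _ < d] mh h0).1.
have iK : cintegrable mu K.
  rewrite /K; under eq_fun do rewrite mulrC; apply: (bounded_cintegrableM (B := 1) _ _ iH).
    by apply: cmeasurable_real; exact: measurable_gaussd.
  by move=> x; rewrite cabs_real ger0_norm ?expR_ge0// gaussd_le1.
have E b : cintegral mu setT (fun x => (\1_(box b) x)%:C * K x) = 0.
  rewrite -(schwartz_test_box b mh h0).2; apply: eq_cintegral => x; rewrite /K rmorphM /=; ring.
have aeP (f : X -> R) (b : X) : \int[mu]_(x in box b) f x = \int[mu]_x (\1_(box b) x * f x).
  rewrite Rintegral_mkcond; apply: eq_Rintegral => x _; rewrite patchE indicE.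
  by case: (_ \in _); rewrite ?mul1r ?mul0r.
have a1 : {ae mu, forall x, complex.Re (K x) = 0}.
  apply: (ae_eq0_boxes iK.1) => b; rewrite aeP; have := congr1 (@complex.Re R) (E b); rewrite /= => <-.
  by apply: eq_Rintegral => x _; rewrite realCM_Re.
have a2 : {ae mu, forall x, complex.Im (K x) = 0}.
  apply: (ae_eq0_boxes iK.2) => b; rewrite aeP; have := congr1 (@complex.Im R) (E b); rewrite /= => <-.
  by apply: eq_Rintegral => x _; rewrite realCM_Im.
apply: filterS2 a1 a2 => x k1 k2; have /eqP : K x = 0 by exact: complexP.
rewrite !mulf_eq0 -!cabs_eq0 cabs_real normr_eq0 (gt_eqF (gaussd_gt0 1 x)) !orbF cabs_eq0.
exact: eqP.
Qed.

Lemma is_fourier_unique (T : distr_Rd R d) g g' : is_fourier T g -> is_fourier T g' ->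
  {ae mu, forall x, g x = g' x}.
Proof.
move=> [mg hg] [mg' hg'].
have : {ae mu, forall x, g x - g' x = 0}.
  apply: schwartz_test_eq0; first by apply: cmeasurableD => //; exact: cmeasurableN.
  move=> phi sphi; have [i1 e1] := hg phi sphi; have [i2 e2] := hg' phi sphi.
  rewrite (_ : (fun x => _) = (fun x => g x * phi x - g' x * phi x)); last first.
    by apply/funext => x; rewrite mulrBl.
  split; first exact: cintegrableB.
  by rewrite cintegralB//; apply/eqP; rewrite subr_eq0; apply/eqP; rewrite -[LHS]e1 e2.
by apply: filterS => x /eqP; rewrite subr_eq0 => /eqP.
Qed.

End uniqueness.

(** * Fourier multipliers *)

Section multipliers.
Context {R : realType} {d : nat}.
Local Notation mu := (@lebesgue_Rd R d).
Local Notation X := (d.-tuple R).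
Local Notation c0 := (@fourier_cst R d).
Implicit Types (f g m : X -> R[i]) (T : distr_Rd R d) (x xi : X).

Lemma is_fourier_hat T g : is_fourier T g ->
  is_fourier T (hat T) /\ {ae mu, forall xi, hat T xi = g xi}.
Proof.
move=> Tg; have h : is_fourier T (hat T).
  by apply: (@xgetPex _ (fun _ => 0) [set g | is_fourier T g]); exists g.
by split => //; exact: is_fourier_unique h Tg.
Qed.

Lemma cintegrable_mul_schwartz f phi : cintegrable mu f -> schwartz phi ->
  cintegrable mu (fun x => f x * phi x).
Proof.
move=> fi sphi; have [B hB] := schwartz_bounded sphi.
have := bounded_cintegrableM (schwartz_measurable sphi) hB fi.
by under eq_fun do rewrite mulrC.
Qed.

(** The functional evaluates at a Schwartz function the inverse transform of
    its transform. *)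
Lemma is_fourier_multiplier m T : cintegrable mu (fun xi => m xi * hat T xi) ->
  is_fourier (multiplier m T) (fun xi => m xi * hat T xi).
Proof.
move=> iF; split; first exact: cintegrable_measurable iF.
move=> phi sphi; split; first exact: cintegrable_mul_schwartz.
by rewrite /multiplier (funext (fun x => fourier_inversion x sphi)).
Qed.

Lemma is_fourier_sub T1 T2 g1 g2 : is_fourier T1 g1 -> is_fourier T2 g2 ->
  is_fourier (dist_sub T1 T2) (fun xi => g1 xi - g2 xi).
Proof.
move=> [m1 h1] [m2 h2]; split; first by apply: cmeasurableD => //; exact: cmeasurableN.
move=> phi sphi; have [i1 e1] := h1 phi sphi; have [i2 e2] := h2 phi sphi.
have E : (fun xi => (g1 xi - g2 xi) * phi xi) = (fun xi => g1 xi * phi xi - g2 xi * phi xi).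
  by apply/funext => xi; rewrite mulrBl.
split; first by rewrite E; exact: cintegrableB.
by rewrite /dist_sub e1 e2 /dist_of_fun E cintegralB.
Qed.

Lemma tempered_multiplier m T : cintegrable mu (fun xi => m xi * hat T xi) ->
  tempered (multiplier m T).
Proof.
move=> iF; have mF := cintegrable_measurable iF.
have iM phi : schwartz phi -> cintegrable mu (fun xi => m xi * hat T xi * inv_fourier phi xi).
  move=> sphi; have iphi := schwartz_integrable sphi.
  have := bounded_cintegrableM (cmeasurable_inv_fourier (schwartz_measurable sphi))
    (fun x => cabs_inv_fourier_le x iphi) iF.
  by under eq_fun do rewrite mulrC.
split=> [a phi psi sphi spsi|].
  rewrite /multiplier /dist_of_fun -cintegralZ; last exact: iM.
  rewrite -cintegralD; [|by apply: cintegrableZ; exact: iM|exact: iM].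
  apply: eq_cintegral => xi; rewrite inv_fourier_linear; [|exact: schwartz_integrable..].
  by rewrite mulrDr mulrCA.
pose A := \int[mu]_xi cabs (m xi * hat T xi); pose D := \int[mu]_x @decay R d x.
have c00 : 0 <= c0 by exact/ltW/fourier_cst_gt0.
exists (A * (c0 * D)), (2 * d)%N => phi B sphi hB.
have iphi := schwartz_integrable sphi.
have K xi : cabs (inv_fourier phi xi) <= c0 * (B * D).
  apply: le_trans (cabs_inv_fourier_le xi iphi) _; apply: ler_wpM2l => //.
  rewrite /D -RintegralZl//; last exact: integrable_decay.
  apply: le_Rintegral => //; first exact: integrable_cabs.
    exact: integrable_mull (@integrable_decay R d).
  by move=> x _; exact: schwartz_decay.
rewrite /multiplier /dist_of_fun; apply: le_trans (cabs_cintegral_le (iM _ sphi)) _.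
rewrite (_ : A * _ * B = c0 * (B * D) * A); last by ring.
rewrite /A -RintegralZl//; last exact: integrable_cabs.
apply: le_Rintegral => //; first exact/integrable_cabs/iM.
  by apply: integrable_mull => //; exact: integrable_cabs.
by move=> xi _; rewrite cabsM mulrC; apply: ler_wpM2r; rewrite ?cabs_ge0.
Qed.

Lemma sqr_expe (x : \bar R) : (0 <= x -> x ^+ 2 = x `^ 2)%E.
Proof.
case: x => [r||//] h.
  by rewrite poweR_EFin -EFin_expe powR_mulrn// -lee_fin.
by rewrite poweRyr// expe2.
Qed.

Lemma sqr_Hs_norm s T : is_fourier T (hat T) -> (Hs_norm s T ^+ 2 =
  \int[mu]_xi ((japanese xi `^ (2 * s) * cabs (hat T xi) ^+ 2)%:E))%E.
Proof.
move=> Tg; rewrite sqr_expe ?Lnorm_ge0// poweR_Lnorm//; apply: eq_integral => xi _.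
have h0 : 0 <= japanese xi `^ s * cabs (hat T xi) by rewrite mulr_ge0 ?powR_ge0 ?cabs_ge0.
rewrite gee0_abs ?lee_fin// poweR_EFin; congr (_%:E); rewrite powR_mulrn//.
rewrite exprMn; congr (_ * _).
by rewrite -powR_mulrn ?powR_ge0// -powRrM mulrC.
Qed.

Lemma measurable_weight_cabs (s : R) g : cmeasurable g ->
  measurable_fun setT (fun xi => (japanese xi `^ s * cabs (g xi) ^+ 2)%:E).
Proof.
move=> mg; apply/measurable_EFinP; apply: measurable_funM; last first.
  by apply: measurable_funX; exact: measurable_cabs.
by apply: (measurableT_comp (measurable_powR s)); exact: measurable_japanese.
Qed.

Lemma sqr_Hs_norm_ae s T g : is_fourier T g -> (Hs_norm s T ^+ 2 =
  \int[mu]_xi ((japanese xi `^ (2 * s) * cabs (g xi) ^+ 2)%:E))%E.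
Proof.
move=> Tg; have [Th hg] := is_fourier_hat Tg; rewrite sqr_Hs_norm//.
apply: ae_eq_integral => //; [exact: measurable_weight_cabs Th.1|exact: measurable_weight_cabs Tg.1|].
by apply: filterS hg => xi -> _.
Qed.

(** The multiplication formula, and the fact that exp(-|x|^2 / 2) is its own
    Fourier transform. *)
Lemma is_fourier_gaussian : is_fourier (@gaussian R d) (fun xi => (expR (- (enorm xi ^+ 2 / 2)))%:C).
Proof.
pose dl : R := (Num.sqrt 2)^-1; have s2 : 0 < Num.sqrt 2 :> R by rewrite sqrtr_gt0.
have dl0 : 0 < dl by rewrite invr_gt0.
have dl2 : dl ^+ 2 = 2^-1 by rewrite exprVn sqr_sqrtr.
have E x : expR (- (enorm x ^+ 2 / 2)) = gaussd dl x.
  by rewrite /gaussd dl2 mulrC.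
have ig := cintegrable_gaussd (d := d) dl0.
rewrite /gaussian; under eq_fun do rewrite E.
split; first exact: cintegrable_measurable ig.
move=> phi sphi; have iphi := schwartz_integrable sphi.
split; first exact: cintegrable_mul_schwartz.
rewrite /dist_of_fun multiplication_formula//; apply: eq_cintegral => xi; congr (_ * _).
rewrite /fourier (eq_cintegral _ (g := fun x => cis (dot (vneg xi) x) * (gaussd dl x)%:C)); last first.
  by move=> x; rewrite dot_vneg.
rewrite cintegral_gaussd// -rmorphM /=; congr (_%:C).
rewrite mulrA (_ : c0 * _ = 1) ?mul1r; last first.
  rewrite /fourier_cst (_ : Num.sqrt pi / dl = Num.sqrt (2 * pi)); last first.
    by rewrite /dl invrK sqrtrM// mulrC.
  have tp : 0 < 2 * pi :> R by rewrite mulr_gt0// pi_gt0.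
  rewrite -powR12_sqrt ?(ltW tp)// -powR_mulrn ?powR_ge0// -powRrM -powRD.
    by rewrite (_ : _ + _ = 0) ?powRr0//; field.
  by apply/implyP => _; rewrite gt_eqF.
rewrite /gaussd dl2; congr expR; congr (- _).
rewrite (_ : enorm (vneg xi) ^+ 2 = enorm xi ^+ 2); first by field.
by rewrite !sqr_enorm; apply: eq_bigr => i _; rewrite tnth_mktuple sqrrN.
Qed.

End multipliers.

Section multiplier_of_hat.
Context {R : realType} {d : nat}.
Local Notation mu := (@lebesgue_Rd R d).
Local Notation X := (d.-tuple R).
Implicit Types (f g m : X -> R[i]) (T : distr_Rd R d) (x xi : X).

Lemma is_fourier_ae T f g : is_fourier T f -> cmeasurable g ->
  {ae mu, forall xi, f xi = g xi} -> is_fourier T g.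
Proof.
move=> [mf hf] mg fg; split => // phi sphi; have [i1 ->] := hf phi sphi.
have mp := schwartz_measurable sphi.
have h : {ae mu, forall xi, f xi * phi xi = g xi * phi xi}.
  by apply: filterS fg => xi ->.
have m1 := cmeasurableM mf mp; have m2 := cmeasurableM mg mp.
split; first exact: (ae_cintegrable m2 i1 h).
exact: ae_eq_cintegral.
Qed.

Lemma multiplierP m T g : cmeasurable m -> is_fourier T g ->
  cintegrable mu (fun xi => m xi * g xi) ->
  cintegrable mu (fun xi => m xi * hat T xi) /\
  is_fourier (multiplier m T) (fun xi => m xi * g xi).
Proof.
move=> mm Tg ig; have [Th hg] := is_fourier_hat Tg.
have mh : cmeasurable (fun xi => m xi * hat T xi) by apply: cmeasurableM => //; exact: Th.1.
have e1 : {ae mu, forall xi, m xi * hat T xi = m xi * g xi}.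
  by apply: filterS hg => xi ->.
have ih : cintegrable mu (fun xi => m xi * hat T xi).
  by apply: (ae_cintegrable mh ig); apply: filterS e1 => xi ->.
split => //; apply: is_fourier_ae (is_fourier_multiplier ih) _ e1.
exact: cintegrable_measurable ig.
Qed.

End multiplier_of_hat.

(** * The linear evolution *)

Section linear_evolution.
Context {R : realType} {d : nat}.
Local Notation D := d.+1.
Local Notation mu := (@lebesgue_Rd R D).
Local Notation leb := (@lebesgue_measure R).
Local Notation I0 := (`[0%R, +oo[%classic : set R).
Local Notation X := (D.-tuple R).
Implicit Types (x xi : X).

Let sigma : R := (1 - D%:R) / 2.

Let japanese_ge1 xi : 1 <= japanese xi.
Proof. by rewrite -[leLHS](@sqrtr1 R) ler_wsqrtr// lerDl sqr_ge0. Qed.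

Let powR_japanese_le (a : R) xi :
  japanese xi `^ a <= expR (4^-1 + a ^+ 2) * expR (4^-1 * enorm xi ^+ 2).
Proof.
have J1 := japanese_ge1 xi; have J0 := japanese_gt0 xi.
rewrite /powR gt_eqF// -expRD ler_expR.
have JE : japanese xi ^+ 2 = 1 + enorm xi ^+ 2 by rewrite sqr_sqrtr// addr_ge0 ?sqr_ge0.
have l0 : 0 <= ln (japanese xi) by exact: ln_ge0.
have l1 := ln_sublinear J0.
have -> : enorm xi ^+ 2 = japanese xi ^+ 2 - 1 by rewrite JE; ring.
move: (japanese xi) (ln _) J1 l0 l1 => J l J1 l0 l1.
have h1 := sqr_ge0 (l / 2 - a); have h2 : l ^+ 2 <= J ^+ 2.
  by rewrite ler_pXn2r ?nnegrE// ltW// (le_lt_trans l0).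
move: h1 h2; rewrite !expr2; nra.
Qed.

Let gauss_lty (k : R) : 0 < k -> (\int[leb]_(r in I0) (expR (- (k * r ^+ 2)))%:E < +oo)%E.
Proof.
move=> k0; have i1 := integrable_mull (1 + k^-1) (@measurable_I0 R)
  (integrableS measurableT (@measurable_I0 R) (@subsetT _ _) (@integrableT_oneDsqrV R)).
have /integrableP[_] : leb.-integrable I0 (EFin \o (fun r : R => expR (- (k * r ^+ 2)))).
  apply: (bounded_integrable (@measurable_I0 R) _ i1).
    apply: measurable_funTS; apply: measurableT_comp => //; apply: measurableT_comp => //.
    by apply: measurable_funM => //; exact: measurable_funX.
  by move=> r _; rewrite ger0_norm ?expR_ge0// gauss_le_oneDsqrV.
by under eq_integral do rewrite /= ger0_norm ?expR_ge0//.
Qed.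

Let continuous_gauss (k : R) : continuous (fun r : R => expR (- (k * r ^+ 2))).
Proof.
move=> r; apply: (cvg_comp _ expR); last exact: continuous_expR.
apply: cvgN; apply: cvgM; first exact: cvg_cst.
exact: exprn_continuous.
Qed.

(** The value at a = - s is the Fourier transform of the initial data. *)
Definition amplitude (a : R) xi : R :=
  japanese xi `^ a * (enorm xi `^ sigma * expR (- (enorm xi ^+ 2 / 2))).

Lemma measurable_amplitude a : measurable_fun setT (amplitude a).
Proof.
apply: measurable_funM.
  by apply: (measurableT_comp (measurable_powR a)); exact: measurable_japanese.
apply: measurable_funM.
  by apply: (measurableT_comp (measurable_powR sigma)); exact: measurable_enorm.
apply: measurableT_comp => //; apply: measurableT_comp => //; apply: measurable_funM => //.
exact: measurable_sqr_enorm.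
Qed.

Let enorm_sigma_le xi : enorm xi `^ sigma <= 1 + enorm xi `^ (1 - D%:R).
Proof.
have D1 : 1 - D%:R <= 0 :> R by rewrite subr_le0 ler1n.
have s0 : sigma <= 0 by rewrite /sigma pmulr_lle0 ?invr_gt0.
have sD : 1 - D%:R <= sigma by rewrite /sigma; lra.
have := enorm_ge0 xi; rewrite le_eqVlt => /predU1P[<-|e0].
  have p0 : 0 <= 0 `^ (1 - D%:R) :> R by exact: powR_ge0.
  by have [->|s1] := eqVneq sigma 0; [rewrite powRr0 lerDl|rewrite powR0// addr_ge0].
have [e1|e1] := leP 1 (enorm xi).
  apply: (@le_trans _ _ 1); last by rewrite lerDl powR_ge0.
  by rewrite -(powRr0 (enorm xi)) ler_powR.
apply: (@le_trans _ _ (enorm xi `^ (1 - D%:R))); last by rewrite lerDr.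
rewrite /powR gt_eqF// ler_expR; have l0 : ln (enorm xi) <= 0 by exact/ltW/ln_lt0/andP.
by move: (ln _) l0 => l l0; nra.
Qed.

(** The weight of order a is absorbed by half of the Gaussian, and the
    singularity at 0 is weaker than |xi|^(1-d). *)
Lemma integrable_amplitude a : cintegrable mu (fun xi => (amplitude a xi)%:C).
Proof.
have [c c0 polar] := @polar_coordinates R d.
pose g4 (r : R) := expR (- (4^-1 * r ^+ 2)).
have G xi : gaussd 2^-1 xi = g4 (enorm xi).
  by rewrite /gaussd /g4; congr expR; congr (- (_ * _)); field.
have i2 : mu.-integrable setT (EFin \o (fun xi => enorm xi `^ (1 - D%:R) * g4 (enorm xi))).
  apply/integrableP; split.
    apply/measurable_EFinP; apply: measurable_funM.
      by apply: (measurableT_comp (measurable_powR _)); exact: measurable_enorm.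
    by rewrite -(funext G); exact: measurable_gaussd.
  under eq_integral do rewrite /= ger0_norm ?mulr_ge0 ?powR_ge0 ?expR_ge0//.
  rewrite (polar g4) ?lte_mul_pinfty ?lee_fin ?(ltW c0)//; first exact: gauss_lty.
    exact: continuous_gauss.
  by move=> r _; exact: expR_ge0.
have h0 : 0 < 2^-1 :> R by rewrite invr_gt0.
have i1 : mu.-integrable setT (EFin \o gaussd 2^-1) := (@cintegrable_gaussd R D _ h0).1.
pose K := expR (4^-1 + a ^+ 2).
apply: (dominated_cintegrable (cmeasurable_real (measurable_amplitude a))
  (integrable_mull K measurableT (integrable_add measurableT i1 i2))) => xi.
have e0 := expR_ge0; rewrite cabs_real ger0_norm ?mulr_ge0 ?powR_ge0 ?expR_ge0//.
rewrite /amplitude.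
have E : expR (- (enorm xi ^+ 2 / 2)) = g4 (enorm xi) * expR (- (4^-1 * enorm xi ^+ 2)).
  by rewrite /g4 -expRD; congr expR; field.

rewrite G E -[X in X + _]mul1r -mulrDl.
apply: (@le_trans _ _ (K * expR (4^-1 * enorm xi ^+ 2) *
   ((1 + enorm xi `^ (1 - D%:R)) * (g4 (enorm xi) * expR (- (4^-1 * enorm xi ^+ 2)))))).
  apply: ler_pM.
  - exact: powR_ge0.
  - by rewrite !mulr_ge0 ?powR_ge0 ?expR_ge0.
  - exact: powR_japanese_le.
  - by apply: ler_wpM2r; [rewrite mulr_ge0// expR_ge0|exact: enorm_sigma_le].
rewrite expRN; move: (expR (4^-1 * _)) (expR_gt0 (4^-1 * enorm xi ^+ 2)) => y y0.
rewrite le_eqVlt; apply/orP; left; apply/eqP; move: (g4 _) (_ `^ _) => u v.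
by field; rewrite gt_eqF.
Qed.

Variable s : R.
Let u0 : distr_Rd R D := japanese_mult (- s) (riesz_mult sigma gaussian).

Lemma is_fourier_u0 : tempered u0 /\ is_fourier u0 (fun xi => (amplitude (- s) xi)%:C).
Proof.
have mJ (a : R) : cmeasurable (fun xi : X => (japanese xi `^ a)%:C).
  apply: cmeasurable_real; apply: (measurableT_comp (measurable_powR a)).
  exact: measurable_japanese.
have mE (a : R) : cmeasurable (fun xi : X => (enorm xi `^ a)%:C).
  apply: cmeasurable_real; apply: (measurableT_comp (measurable_powR a)).
  exact: measurable_enorm.
have E1 : (fun xi : X => (enorm xi `^ sigma)%:C * (expR (- (enorm xi ^+ 2 / 2)))%:C) =
    (fun xi => (amplitude 0 xi)%:C).
  by apply/funext => xi; rewrite /amplitude powRr0 mul1r rmorphM.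
have [_ F1] := multiplierP (mE sigma) (@is_fourier_gaussian R D)
  (eq_ind_r (cintegrable mu) (integrable_amplitude 0) E1).
rewrite E1 in F1.
have E2 : (fun xi : X => (japanese xi `^ (- s))%:C * (amplitude 0 xi)%:C) =
    (fun xi => (amplitude (- s) xi)%:C).
  by apply/funext => xi; rewrite -rmorphM /= /amplitude powRr0 mul1r.
have [ih F2] := multiplierP (mJ (- s)) F1 (eq_ind_r (cintegrable mu) (integrable_amplitude (- s)) E2).
rewrite E2 in F2; split => //.
exact: tempered_multiplier.
Qed.

Let weighted_amplitude xi : japanese xi `^ (2 * s) * amplitude (- s) xi ^+ 2 =
  enorm xi `^ (1 - D%:R) * expR (- enorm xi ^+ 2).
Proof.
have sq (r a : R) : (r `^ a) ^+ 2 = r `^ (a * 2) by rewrite -powR_mulrn ?powR_ge0// -powRrM.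
rewrite /amplitude !exprMn !sq !mulrA (_ : _ `^ (2 * s) * _ = 1) ?mul1r; last first.
  have p0 : 2 * s + - s * 2 = 0 by ring.
  rewrite -powRD; first by rewrite p0 powRr0.
  by rewrite (gt_eqF (japanese_gt0 xi)) implybT.
rewrite -mulrA -expRD; congr (_ `^ _ * expR _); first by rewrite /sigma; field.
by field.
Qed.

Lemma in_Hs_u0 : in_Hs s u0.
Proof.
have [tu Fu] := is_fourier_u0; split => //; first by eexists; exact: Fu.
have [c c0 polar] := @polar_coordinates R d.
have : (Hs_norm s u0 ^+ 2 < +oo)%E.
  rewrite (sqr_Hs_norm_ae s Fu).
  under eq_integral do rewrite cabs_real real_normK ?num_real// weighted_amplitude.
  rewrite (polar (fun r => expR (- r ^+ 2))) ?lte_mul_pinfty ?lee_fin ?(ltW c0)//.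
  - by have := gauss_lty ltr01; under eq_integral do rewrite mul1r.
  - by have := @continuous_gauss 1; under eq_fun do rewrite mul1r.
have := Lnorm_ge0 mu 2%:E (fun xi => (japanese xi `^ s * cabs (hat u0 xi))%:E).
rewrite -/(Hs_norm s u0); case: (Hs_norm s u0) => [r _ _|_|//]; first exact: ltry.
by rewrite expe2 mulyy.
Qed.

Let w eps t := dist_sub (propagator eps t u0) (propagator 0 t u0).

(** The common phase exp(-i t |xi|^2) factors out of the difference of the
    multipliers. *)
Lemma sqr_Hs_norm_linear (eps t : R) : (Hs_norm s (w eps t) ^+ 2 =
  \int[mu]_xi (2 * (1 - cos (eps ^+ 2 * t * enorm xi ^+ 4)) *
     japanese xi `^ (2 * s) * cabs (hat u0 xi) ^+ 2)%:E)%E.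
Proof.
have [_ Fu] := is_fourier_u0; have [Fh hu] := is_fourier_hat Fu.
have ihat : cintegrable mu (hat u0).
  apply: (ae_cintegrable Fh.1 (integrable_amplitude (- s))).
  by apply: filterS hu => xi ->.
have iP e : cintegrable mu (fun xi => cis (- (t * (e ^+ 2 * enorm xi ^+ 4 + enorm xi ^+ 2))) * hat u0 xi).
  apply: cis_cintegrableM => //; apply: measurableT_comp => //; apply: measurable_funM => //.
  apply: measurable_funD; last exact: measurable_sqr_enorm.
  apply: measurable_funM => //; apply: measurable_funX; exact: measurable_enorm.
have Fw := is_fourier_sub (is_fourier_multiplier (iP eps)) (is_fourier_multiplier (iP 0)).
rewrite (sqr_Hs_norm_ae s Fw); apply: eq_integral => xi _; congr (_%:E).
have -> : cis (- (t * (eps ^+ 2 * enorm xi ^+ 4 + enorm xi ^+ 2))) * hat u0 xi -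
    cis (- (t * (0 ^+ 2 * enorm xi ^+ 4 + enorm xi ^+ 2))) * hat u0 xi =
    cis (- (t * enorm xi ^+ 2)) * ((cis (- (eps ^+ 2 * t * enorm xi ^+ 4)) - 1) * hat u0 xi).
  rewrite mulrBl mul1r mulrBr mulrA -cisD; congr (cis _ * _ - cis _ * _); ring.
by rewrite cabs_cisM cabsM exprMn cis_sub1 cosN; ring.
Qed.

Lemma sqr_Hs_norm_polar (c : R) (eps t : R) :
  (forall G : R -> R, continuous G -> (forall r, 0 <= r -> 0 <= G r) ->
    (\int[mu]_x (enorm x `^ (1 - D%:R) * G (enorm x))%:E =
     c%:E * \int[leb]_(r in I0) (G r)%:E)%E) ->
  (Hs_norm s (w eps t) ^+ 2 = (2 * c * osc_gauss (eps ^+ 2 * t))%:E)%E.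
Proof.
move=> polar; rewrite sqr_Hs_norm_linear.
have [_ Fu] := is_fourier_u0; have [Fh hu] := is_fourier_hat Fu.
pose G (r : R) := 2 * ((1 - cos (eps ^+ 2 * t * r ^+ 4)) * expR (- r ^+ 2)).
transitivity (\int[mu]_x (enorm x `^ (1 - D%:R) * G (enorm x))%:E)%E.
  have mc : measurable_fun setT (fun xi : X => 2 * (1 - cos (eps ^+ 2 * t * enorm xi ^+ 4))).
    apply: measurable_funM => //; apply: measurable_funB => //; apply: measurableT_comp.
      by apply: continuous_measurable_fun; exact: continuous_cos.
    by apply: measurable_funM => //; apply: measurable_funX; exact: measurable_enorm.
  apply: ae_eq_integral => //.
  - under eq_fun do rewrite -mulrA; apply/measurable_EFinP; apply: measurable_funM => //.
    by apply/measurable_EFinP; exact: measurable_weight_cabs Fh.1.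
  - apply/measurable_EFinP; apply: measurable_funM.
      by apply: (measurableT_comp (measurable_powR _)); exact: measurable_enorm.
    rewrite /G; under eq_fun do rewrite mulrA; apply: measurable_funM => //.
    apply: measurableT_comp => //; apply: measurableT_comp => //; exact: measurable_sqr_enorm.
  - apply: filterS hu => xi -> _; congr (_%:E).
    rewrite cabs_real real_normK ?num_real// -mulrA weighted_amplitude /G; ring.
rewrite polar.
- rewrite /G; under eq_integral do rewrite EFinM.
  rewrite ge0_integralZl//.
  + rewrite fin_osc_gauss -!EFinM; congr (_%:E); ring.
  + apply/measurable_EFinP; apply: measurable_funTS; apply: continuous_measurable_fun.
    exact: continuous_osc_gauss_fun.

- move=> r; apply: cvgM; first exact: cvg_cst.
  exact: continuous_osc_gauss_fun.
- by move=> r _; rewrite /G mulr_ge0// mulr_ge0 ?expR_ge0// subr_ge0 cos_le1.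
Qed.

End linear_evolution.

(** For each eps the norm tends to a positive limit, the same for all eps, as t
    tends to infinity; so its supremum in t cannot tend to 0 with eps. *)
Lemma linear_evolution_diverges {R : realType} (d : nat) : (0 < d)%N ->
   exists C1 C2 : R, [/\ 0 < C1, 0 < C2 & forall s : R,
     let u0 : distr_Rd R d :=
       japanese_mult (- s) (riesz_mult ((1 - d%:R) / 2) gaussian) in
     let w eps t := dist_sub (propagator eps t u0) (propagator 0 t u0) in
     [/\ in_Hs s u0,
         (forall eps t : R, 0 < eps -> 0 <= t ->
            [/\ (Hs_norm s (w eps t) ^+ 2 =
                 \int[lebesgue_Rd d]_xi
                   (2 * (1 - cos (eps ^+ 2 * t * enorm xi ^+ 4)) *
                    japanese xi `^ (2 * s) * cabs (hat u0 xi) ^+ 2)%:E)%E,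
                (Hs_norm s (w eps t) ^+ 2 =
                 C1%:E * \int[lebesgue_measure]_(r in `[0%R, +oo[)
                   ((1 - cos (eps ^+ 2 * t * r ^+ 4)) *
                    expR (- (r ^+ 2)))%:E)%E &
                (Hs_norm s (w eps t) ^+ 2 = (bessel_expr C2 eps t)%:E)%E]),
         (forall eps : R, 0 < eps ->
            [/\ bessel_expr C2 eps t @[t --> 0^'+] --> 0,
                {in `[0, +oo[ &,
                  {homo bessel_expr C2 eps : t1 t2 / t1 < t2}} &
                bessel_expr C2 eps t @[t --> +oo] --> 4 * C2]) &
         ~ (ereal_sup [set Hs_norm s (w eps t) | t in `[0, +oo[%classic]
              @[eps --> 0^'+] --> 0%E)]].
Proof.
case: d => // d _; have [c c0 polar] := @polar_coordinates R d.
have sp : 0 < Num.sqrt pi :> R by rewrite sqrtr_gt0 pi_gt0.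
pose C2 := 2 * c * Num.sqrt pi / 8.
have C20 : 0 < C2 by rewrite /C2 !mulr_gt0// invr_gt0.
exists (2 * c), C2; split => //; first by rewrite mulr_gt0.
move=> s u0 w.
have E eps t : 0 < eps -> 0 <= t -> (Hs_norm s (w eps t) ^+ 2 = (bessel_expr C2 eps t)%:E)%E.
  move=> e0 t0; rewrite (sqr_Hs_norm_polar s eps t polar) bessel_expr_osc_gauss//.
  by congr (_%:E); rewrite /C2 [t * _]mulrC; field; rewrite gt_eqF.
split.
- exact: in_Hs_u0.
- move=> eps t e0 t0; split; [exact: sqr_Hs_norm_linear| |exact: E].
  by rewrite (sqr_Hs_norm_polar s eps t polar) fin_osc_gauss -EFinM.
- move=> eps e0; split.
  + exact: cvg_bessel_expr0.
  + exact: bessel_expr_increasing.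
  + exact: cvg_bessel_expry.
have q0 : 0 < Num.sqrt (2 * C2) by rewrite sqrtr_gt0 mulr_gt0.
apply: (@not_cvg0_at_right _ _ (Num.sqrt (2 * C2))) => // eps e0.
have h : 2 * C2 < 4 * C2 by rewrite ltr_pM2r// ltr_nat.
have [M [_ hM]] : \forall t \near +oo, 2 * C2 < bessel_expr C2 eps t.
  exact: (cvgr_gt (4 * C2) (@cvg_bessel_expry R C2 eps e0)).
pose t := Num.max 0 (M + 1).
have t0 : 0 <= t by rewrite le_max lexx.
have tM : M < t by rewrite lt_max ltrDl ltr01 orbT.
have := hM t tM; rewrite -lte_fin -(E eps t e0 t0) => ht.
have h1 : ((Num.sqrt (2 * C2))%:E <= Hs_norm s (w eps t))%E.
  move: ht (Lnorm_ge0 (lebesgue_Rd d.+1) 2%:E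
    (fun xi => (japanese xi `^ s * cabs (hat (w eps t) xi))%:E)).
  rewrite -/(Hs_norm s (w eps t)); case: (Hs_norm s (w eps t)) => [r|_ _|//]; last exact: leey.
  rewrite -EFin_expe lte_fin !lee_fin => hr r0.
  rewrite -(ler_pXn2r (n := 2))// ?nnegrE ?sqrtr_ge0// sqr_sqrtr; first exact: ltW.
  by rewrite mulr_ge0// ltW.
apply: le_trans h1 _; apply: ereal_sup_ubound; exists t => //.
by rewrite /= in_itv /= andbT.
Qed.

Theorem mainTheorem4 (R : realType) :
  (* convergence in C([0, oo); H^1(T)) fails for data as in the finite time    *)
  (* convergence theorem                                                       *)
  ~ (forall (u0e : R -> 1.-tuple R -> R[i]) (u0 : 1.-tuple R -> R[i])
       (ue : R -> R -> 1.-tuple R -> R[i]) (u : R -> 1.-tuple R -> R[i]),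
       (exists B : R, forall eps, 0 < eps ->
          (HsT_norm 2 (u0e eps) <= B%:E)%E) ->
       HsT_norm 1 (fun x => u0e eps x - u0 x) @[eps --> 0^'+] --> 0%E ->
       (forall eps, 0 < eps -> regularized_NLS eps (u0e eps) (ue eps)) ->
       cubic_NLS u0 u ->
       ereal_sup [set HsT_norm 1 (fun x => ue eps t x - u t x)
                 | t in `[0, +oo[%classic] @[eps --> 0^'+] --> 0%E)
  /\
  (* on R^d: the linear evolution *)
  (forall d : nat, (0 < d)%N ->
   exists C1 C2 : R, [/\ 0 < C1, 0 < C2 & forall s : R,
     let u0 : distr_Rd R d :=
       japanese_mult (- s) (riesz_mult ((1 - d%:R) / 2) gaussian) in
     let w eps t := dist_sub (propagator eps t u0) (propagator 0 t u0) in
     [/\ in_Hs s u0,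
         (forall eps t : R, 0 < eps -> 0 <= t ->
            [/\ (Hs_norm s (w eps t) ^+ 2 =
                 \int[lebesgue_Rd d]_xi
                   (2 * (1 - cos (eps ^+ 2 * t * enorm xi ^+ 4)) *
                    japanese xi `^ (2 * s) * cabs (hat u0 xi) ^+ 2)%:E)%E,
                (Hs_norm s (w eps t) ^+ 2 =
                 C1%:E * \int[lebesgue_measure]_(r in `[0%R, +oo[)
                   ((1 - cos (eps ^+ 2 * t * r ^+ 4)) *
                    expR (- (r ^+ 2)))%:E)%E &
                (Hs_norm s (w eps t) ^+ 2 = (bessel_expr C2 eps t)%:E)%E]),
         (forall eps : R, 0 < eps ->
            [/\ bessel_expr C2 eps t @[t --> 0^'+] --> 0,
                {in `[0, +oo[ &,
                  {homo bessel_expr C2 eps : t1 t2 / t1 < t2}} &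
                bessel_expr C2 eps t @[t --> +oo] --> 4 * C2]) &
         ~ (ereal_sup [set Hs_norm s (w eps t) | t in `[0, +oo[%classic]
              @[eps --> 0^'+] --> 0%E)]])
  /\
  (* on T^d: plane waves *)
  (forall d : nat, (0 < d)%N ->
   exists c : R, 0 < c /\ forall (s : R) (n : d.-tuple int),
     let u0 : d.-tuple R -> R[i] := plane_wave s n in
     let u := wave_solution s n 0 in
     let dist eps := ereal_sup
       [set HsT_norm s (fun x => wave_solution s n eps t x - u t x)
       | t in `[0, +oo[%classic] in
     [/\ forall eps : R, 0 < eps ->
           regularized_NLS eps u0 (wave_solution s n eps),
         cubic_NLS u0 u,
         forall eps : R, 0 < eps ->
           dist eps =
           ereal_sup
             [set (c * cabs (cis (- (t * eps ^+ 2 *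
                       enorm (zvec n : d.-tuple R) ^+ 4)) - 1))%:E
             | t in `[0, +oo[%classic] &
         (* every t gives 0 when n = 0 *)
         (exists i, tnth n i != 0) ->
           (forall eps : R, 0 < eps -> dist eps = (2 * c)%:E) /\
           ~ (dist eps @[eps --> 0^'+] --> 0%E)]).
Proof.
split; first exact: torus_convergence_fails.
by split=> d d0; [exact: linear_evolution_diverges d0|exact: torus_plane_waves].
Qed.
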